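(* Let $K$ be a compact Hausdorff dispersed space and $X=C(K)$ (complex scalars), with open unit ball $B$. Then $X$ satisfies the cluster value theorem for $H^\infty(B)$ at every $x^{**}\in\bar B^{**}$: for every $f\in H^\infty(B)$, $Cl_B(f,x^{**})=\hat f(M_{x^{**}}(B))$, where $M_{x^{**}}(B)$ is the fiber over $x^{**}$ in the spectrum of $H^\infty(B)$.
   Context: A topological space is dispersed (scattered) if it contains no nonempty perfect subset. $H^\infty(B)$ is the uniform algebra (supremum norm) of all bounded holomorphic functions on $B$; $\bar B^{**}$ is the closed unit ball of $X^{**}$. For $x^{**}\in\bar B^{**}$, $M_{x^{**}}(B)$ is the set of nonzero multiplicative linear functionals $\tau$ on $H^\infty(B)$ with $\tau(x^* )=x^{**}(x^* )$ for all $x^*\in X^*$; $\hat f(\tau)=\tau(f)$. $Cl_B(f,x^{**})$ is the set of all $\lambda\in\mathbb C$ with $\lambda=\lim_\alpha f(x_\alpha)$ for some net $(x_\alpha)\subset B$ converging weak-star to $x^{**}$. (The inclusion $Cl_B(f,x^{**})\subset\hat f(M_{x^{**}}(B))$ always holds.) *)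

(* Defs.v *)
From Stdlib Require Import Reals List Classical.
Open Scope R_scope.

Definition Cx := (R * R)%type.
Definition C0 : Cx := (0, 0).
Definition Cadd (z w : Cx) : Cx := (fst z + fst w, snd z + snd w).
Definition Cmul (z w : Cx) : Cx :=
  (fst z * fst w - snd z * snd w, fst z * snd w + snd z * fst w).
Definition Copp (z : Cx) : Cx := (- fst z, - snd z).
Definition Csub (z w : Cx) : Cx := Cadd z (Copp w).
Definition Cmod (z : Cx) : R := sqrt (fst z ^ 2 + snd z ^ 2).

Definition is_topology {K : Type} (op : (K -> Prop) -> Prop) : Prop :=
  op (fun _ => True) /\ op (fun _ => False) /\
  (forall U V, op U -> op V -> op (fun x => U x /\ V x)) /\
  (forall F : (K -> Prop) -> Prop, (forall U, F U -> op U) ->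
     op (fun x => exists U, F U /\ U x)).

Definition hausdorff {K : Type} (op : (K -> Prop) -> Prop) : Prop :=
  forall x y : K, x <> y -> exists U V, op U /\ op V /\ U x /\ V y /\
    forall z, ~ (U z /\ V z).

Definition compact_space {K : Type} (op : (K -> Prop) -> Prop) : Prop :=
  forall F : (K -> Prop) -> Prop, (forall U, F U -> op U) ->
    (forall x, exists U, F U /\ U x) ->
    exists l : list (K -> Prop), (forall U, In U l -> F U) /\
      (forall x, exists U, In U l /\ U x).

Definition closed_set {K : Type} (op : (K -> Prop) -> Prop) (A : K -> Prop) :=
  op (fun x => ~ A x).

Definition isolated_in {K : Type} (op : (K -> Prop) -> Prop) (A : K -> Prop) (x : K) :=
  A x /\ exists U, op U /\ U x /\ forall y, U y -> A y -> y = x.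

Definition perfect_set {K : Type} (op : (K -> Prop) -> Prop) (A : K -> Prop) :=
  closed_set op A /\ forall x, A x -> ~ isolated_in op A x.

Definition dispersed {K : Type} (op : (K -> Prop) -> Prop) : Prop :=
  forall A, perfect_set op A -> forall x, ~ A x.

Definition continuousC {K : Type} (op : (K -> Prop) -> Prop) (x : K -> Cx) : Prop :=
  forall k eps, 0 < eps -> exists U, op U /\ U k /\
    forall k', U k' -> Cmod (Csub (x k') (x k)) < eps.

Definition CK {K : Type} (op : (K -> Prop) -> Prop) := { x : K -> Cx | continuousC op x }.

Definition normle {K} {op : (K -> Prop) -> Prop} (x : CK op) (M : R) : Prop :=
  forall k, Cmod (proj1_sig x k) <= M.

Definition inB {K} {op : (K -> Prop) -> Prop} (x : CK op) : Prop :=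
  exists r, r < 1 /\ normle x r.

Definition Bset {K : Type} (op : (K -> Prop) -> Prop) := { x : CK op | inB x }.

Definition linearX {K} {op : (K -> Prop) -> Prop} (L : CK op -> Cx) : Prop :=
  (forall x y z : CK op, (forall k, proj1_sig z k = Cadd (proj1_sig x k) (proj1_sig y k)) ->
     L z = Cadd (L x) (L y)) /\
  (forall (c : Cx) (x z : CK op), (forall k, proj1_sig z k = Cmul c (proj1_sig x k)) ->
     L z = Cmul c (L x)).

Definition opnormle {K} {op : (K -> Prop) -> Prop} (L : CK op -> Cx) (M : R) : Prop :=
  forall x : CK op, normle x 1 -> Cmod (L x) <= M.

Definition Xstar {K : Type} (op : (K -> Prop) -> Prop) :=
  { phi : CK op -> Cx | linearX phi /\ exists M, opnormle phi M }.

Definition in_bidual_ball {K} {op : (K -> Prop) -> Prop} (xss : Xstar op -> Cx) : Prop :=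
  (forall phi psi chi : Xstar op,
     (forall x, proj1_sig chi x = Cadd (proj1_sig phi x) (proj1_sig psi x)) ->
     xss chi = Cadd (xss phi) (xss psi)) /\
  (forall (c : Cx) (phi chi : Xstar op),
     (forall x, proj1_sig chi x = Cmul c (proj1_sig phi x)) ->
     xss chi = Cmul c (xss phi)) /\
  (forall (phi : Xstar op) M, opnormle (proj1_sig phi) M -> Cmod (xss phi) <= M).

Definition holomorphic_on_B {K} {op : (K -> Prop) -> Prop} (f : Bset op -> Cx) : Prop :=
  forall b : Bset op, exists L : CK op -> Cx,
    linearX L /\ (exists M, opnormle L M) /\
    forall eps, 0 < eps -> exists delta, 0 < delta /\
      forall (b' : Bset op) (h : CK op),
        (forall k, proj1_sig (proj1_sig b') k =
                   Cadd (proj1_sig (proj1_sig b) k) (proj1_sig h k)) ->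
        normle h delta ->
        forall M, normle h M ->
          Cmod (Csub (Csub (f b') (f b)) (L h)) <= eps * M.

Definition in_Hinf {K} {op : (K -> Prop) -> Prop} (f : Bset op -> Cx) : Prop :=
  holomorphic_on_B f /\ exists M, forall b, Cmod (f b) <= M.

(* fiber M_{x**}(B): nonzero multiplicative linear functionals on H^oo(B)
   (given as maps on all of (Bset -> Cx), constrained only on H^oo(B))
   agreeing with x** on (restrictions of) elements of X^*. *)
Definition in_fiber {K} {op : (K -> Prop) -> Prop}
    (xss : Xstar op -> Cx) (tau : (Bset op -> Cx) -> Cx) : Prop :=
  (exists f, in_Hinf f /\ tau f <> C0) /\
  (forall f g h, in_Hinf f -> in_Hinf g -> in_Hinf h ->
     (forall b, h b = Cadd (f b) (g b)) -> tau h = Cadd (tau f) (tau g)) /\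
  (forall (c : Cx) f h, in_Hinf f -> in_Hinf h ->
     (forall b, h b = Cmul c (f b)) -> tau h = Cmul c (tau f)) /\
  (forall f g h, in_Hinf f -> in_Hinf g -> in_Hinf h ->
     (forall b, h b = Cmul (f b) (g b)) -> tau h = Cmul (tau f) (tau g)) /\
  (forall phi : Xstar op,
     tau (fun b : Bset op => proj1_sig phi (proj1_sig b)) = xss phi).

Definition directed {D : Type} (le : D -> D -> Prop) : Prop :=
  (exists d : D, True) /\
  (forall d, le d d) /\ (forall a b c, le a b -> le b c -> le a c) /\
  (forall a b, exists c, le a c /\ le b c).

Definition net_conv {D : Type} (le : D -> D -> Prop) (a : D -> Cx) (l : Cx) : Prop :=
  forall eps, 0 < eps -> exists d0, forall d, le d0 d -> Cmod (Csub (a d) l) < eps.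

Definition cluster_value {K} {op : (K -> Prop) -> Prop}
    (f : Bset op -> Cx) (xss : Xstar op -> Cx) (lam : Cx) : Prop :=
  exists (D : Type) (le : D -> D -> Prop) (net : D -> Bset op),
    directed le /\
    (forall phi : Xstar op,
       net_conv le (fun d => proj1_sig phi (proj1_sig (net d))) (xss phi)) /\
    net_conv le (fun d => f (net d)) lam.

(* Main.v *)
Require Import Defs.
From Stdlib Require Import Reals List Classical Lra Lia ClassicalEpsilon FunctionalExtensionality PropExtensionality ProofIrrelevance Permutation.
From Coquelicot Require Import Coquelicot.
From mathcomp Require filter.
Open Scope R_scope.

(** A scattered compact space is zero-dimensional and every functional on [C(K)] is, up to a small norm, a finite
combination of evaluations, so weak-slope_estimate neighbourhoods only constrain finitely many coordinates [x(k)].  Suppose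
[tau] lies in the fibre, [tau f = 0], and [|f| >= d] on the part of the ball where [x(k)] is close to [a k] for [k] in
a finite set [F].

If [|a k| < 1], then [f - f0 = (x(k) - a k) g], where [f0] is [f] with the coordinate [k] frozen at [a k]; hence
[tau f0 = 0], and the constraint at [k] has been removed.  If [|a k| = 1] for all remaining [k], one starts from [1/f]
near the fibre and frees one coordinate at a time: a function [G] bounded where [x(k)] is near [a k] is replaced by a
bounded [h] defined without this restriction, with [|h - G| <= A |x(k) - a k|], using weighted Cauchy integrals in the
variable [x(k)].  At the end [q = 1 - f h] is small near the fibre, and [p^N q] is uniformly small for the peak function
[p = prod (1 + conj (a k) x(k)) / 2]; but [tau (p^N q) = 1].

A coordinate [x(k)] with [k] not isolated cannot be varied independently of the others.  Composing [x] with a locally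
constant retraction of [K] fixing the points of [F] makes this possible, and the outcome is passed to the limit over
such retractions along an ultrafilter; all bounds are uniform. *)

(** * Ultrafilter limits *)

(** When |a k| = 1 the value a k is not taken by x(k) on the open ball, so nothing can be frozen
    there. One settles for an approximate inverse of [f] with error O(|x(k) - a k|), and the peak
    function absorbs this error. Coordinates with |a k| < 1 are removed beforehand, because freezing
    uses [f] on the whole ball, whereas 1/f is available only near the fibre.

    A plain Cauchy integral along a chord of the disc may grow logarithmically at the two endpoints
    of the chord; the weight is there to cancel this growth.

    Retractions are directed by finite sets of continuous functions, and in general no sequence is
    cofinal among them. Compactness arguments for sequences are therefore replaced by inequalities
    between finitely many values of a function, with constants that depend only on a radius and a
    supremum: such inequalities pass to pointwise limits along an ultrafilter, and also to integrals
    over a parameter.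

    Continuity of [tau] is not part of [in_fiber]; the bound on [tau] comes from invertibility in
    the algebra. *)

Record ultrafilter {I : Type} (U : (I -> Prop) -> Prop) : Prop := {
  ultra_mono : forall A B : I -> Prop, (forall i, A i -> B i) -> U A -> U B;
  ultra_inter : forall A B : I -> Prop, U A -> U B -> U (fun i => A i /\ B i);
  ultra_inhabited : forall A : I -> Prop, U A -> exists i, A i;
  ultra_dichotomy : forall A : I -> Prop, U A \/ U (fun i => ~ A i) }.

(** A directed base of inhabited sets generates a proper filter, to which the ultrafilter lemma of
    mathcomp applies; its result is translated into the record above. *)
Lemma ultrafilter_extends {I : Type} (B : (I -> Prop) -> Prop) :
  (exists A, B A) -> (forall A, B A -> exists i, A i) ->
  (forall A A', B A -> B A' -> exists A'', B A'' /\ forall i, A'' i -> A i /\ A' i) ->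
  exists U, ultrafilter U /\ forall A, B A -> U A.
Proof.
  intros [A0 HA0] Bne Bdir.
  set (F := fun A : I -> Prop => exists A', B A' /\ forall i, A' i -> A i).
  assert (PF : @filter.ProperFilter I F).
  { split.
    - intros [A' [HA' HA'0]]. destruct (Bne _ HA') as [i Hi]. exact (HA'0 i Hi).
    - split.
      + exists A0. split; [assumption|]. intros i _. exact Logic.I.
      + intros A A' [P [HP HPA]] [Q [HQ HQA]]. destruct (Bdir _ _ HP HQ) as [T [HT HTi]].
        exists T. split; [assumption|]. intros i Hi. destruct (HTi i Hi) as [Hp Hq]. split; [apply HPA|apply HQA]; assumption.
      + intros P Q HPQ [A' [HA' H]]. exists A'. split; [assumption|]. intros i Hi. apply HPQ, H, Hi. }
  destruct (filter.ultraFilterLemma PF) as [U [HU FU]].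
  exists U. split.
  - assert (Uf : filter.Filter U) by apply HU.
    split.
    + intros A A' H HA. exact (@filter.filterS _ _ Uf A A' H HA).
    + intros A A' HA HA'. exact (@filter.filterI _ _ Uf A A' HA HA').
    + intros A HA. apply NNPP. intros Hn.
      apply (@filter.filter_not_empty _ U (filter.ultra_proper (UltraFilter := HU))).
      apply (@filter.filterS _ _ Uf A); [|exact HA]. intros i Hi. apply Hn. exists i. exact Hi.
    + intros A. exact (@filter.in_ultra_setVsetC _ U A HU).
  - intros A HA. apply FU. exists A. split; auto.
Qed.

Section UltraLimit.
Context {I : Type} {U : (I -> Prop) -> Prop} (HU : ultrafilter U).

Lemma ultra_all (A : I -> Prop) : (forall i, A i) -> U A.
Proof.
  intros H. destruct (ultra_dichotomy U HU A) as [HA|HA]; auto.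
  destruct (ultra_inhabited U HU _ HA) as [i Hi]. exfalso. apply Hi, H.
Qed.

Lemma ultra_mp (A B : I -> Prop) : U A -> (forall i, A i -> B i) -> U B.
Proof. intros HA H. exact (ultra_mono U HU A B H HA). Qed.

Lemma ultra_mp2 (A B D : I -> Prop) : U A -> U B -> (forall i, A i -> B i -> D i) -> U D.
Proof.
  intros HA HB H. apply (ultra_mp _ _ (ultra_inter U HU A B HA HB)). intros i [? ?]; auto.
Qed.

Definition is_ulim (u : I -> C) (l : C) : Prop :=
  forall eps, 0 < eps -> U (fun i => Cmod (u i - l) < eps).

(** The limit is the supremum of the levels [t] with [t <= u i] for almost all [i];
    [ultra_dichotomy] turns the failure of an inequality almost everywhere into its negation almost
    everywhere. *)
Lemma real_ulim (u : I -> R) (M : R) :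
  U (fun i => Rabs (u i) <= M) ->
  exists l, forall eps, 0 < eps -> U (fun i => Rabs (u i - l) < eps).
Proof.
  intros HM.
  destruct (completeness (fun t => U (fun i => t <= u i))) as [l [Hub Hlub]].
  - exists M. intros t Ht. destruct (ultra_inhabited U HU _ (ultra_inter U HU _ _ HM Ht)) as [i [H1 H2]].
    apply Rabs_le_between in H1. lra.
  - exists (- M). apply (ultra_mp _ _ HM). intros i H. apply Rabs_le_between in H. lra.
  - exists l. intros eps Heps.
    assert (H1 : U (fun i => l - eps < u i)).
    { destruct (ultra_dichotomy U HU (fun i => l - eps < u i)) as [H|H]; auto.
      exfalso. assert (l <= l - eps); [|lra]. apply Hlub. intros t Ht.
      destruct (ultra_inhabited U HU _ (ultra_inter U HU _ _ H Ht)) as [i [H1 H2]]. lra. }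
    assert (H2 : U (fun i => u i < l + eps)).
    { destruct (ultra_dichotomy U HU (fun i => u i < l + eps)) as [H|H]; auto.
      exfalso. assert (l + eps <= l); [|lra]. apply Hub.
      apply (ultra_mp _ _ H). intros i Hi. lra. }
    apply (ultra_mp2 _ _ _ H1 H2). intros i ? ?. apply Rabs_lt_between. lra.
Qed.

Lemma ulim_exists (u : I -> C) (M : R) : U (fun i => Cmod (u i) <= M) -> exists l, is_ulim u l.
Proof.
  intros HM.
  destruct (real_ulim (fun i => fst (u i)) M) as [a Ha].
  { apply (ultra_mp _ _ HM). intros i Hi. pose proof (Rmax_Cmod (u i)).
    pose proof (Rmax_l (Rabs (fst (u i))) (Rabs (snd (u i)))). lra. }
  destruct (real_ulim (fun i => snd (u i)) M) as [b Hb].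
  { apply (ultra_mp _ _ HM). intros i Hi. pose proof (Rmax_Cmod (u i)).
    pose proof (Rmax_r (Rabs (fst (u i))) (Rabs (snd (u i)))). lra. }
  exists (a, b). intros eps Heps.
  apply (ultra_mp2 _ _ _ (Ha (eps/2) ltac:(lra)) (Hb (eps/2) ltac:(lra))).
  intros i H1 H2.
  pose proof (Cmod_2Rmax (u i - (a,b))) as H.
  assert (Rmax (Rabs (fst (u i - (a,b))%C)) (Rabs (snd (u i - (a,b))%C)) < eps/2).
  { apply Rmax_lub_lt; simpl; assumption. }
  assert (Hs : sqrt 2 < 2). { rewrite <- (sqrt_Rsqr 2) at 2 by lra. apply sqrt_lt_1; unfold Rsqr; lra. }
  assert (0 <= sqrt 2) by apply sqrt_pos.
  assert (0 <= Rmax (Rabs (fst (u i - (a,b))%C)) (Rabs (snd (u i - (a,b))%C))).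
  { eapply Rle_trans; [apply Rabs_pos|apply Rmax_l]. }
  nra.
Qed.

Lemma is_ulim_const (c : C) : is_ulim (fun _ => c) c.
Proof. intros eps H. apply ultra_all. intros _. replace (c - c)%C with (RtoC 0) by ring. rewrite Cmod_0. lra. Qed.

Lemma is_ulim_bounded (u : I -> C) (l : C) :
  is_ulim u l -> U (fun i => Cmod (u i) <= Cmod l + 1).
Proof.
  intros H. apply (ultra_mp _ _ (H 1 Rlt_0_1)). intros i Hi.
  replace (u i) with ((u i - l) + l)%C by ring. eapply Rle_trans; [apply Cmod_triangle|]. lra.
Qed.

Lemma is_ulim_plus (u v : I -> C) (l m : C) :
  is_ulim u l -> is_ulim v m -> is_ulim (fun i => u i + v i)%C (l + m)%C.
Proof.
  intros Hu Hv eps He.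
  apply (ultra_mp2 _ _ _ (Hu (eps/2) ltac:(lra)) (Hv (eps/2) ltac:(lra))). intros i H1 H2.
  replace (u i + v i - (l + m))%C with ((u i - l) + (v i - m))%C by ring.
  eapply Rle_lt_trans; [apply Cmod_triangle|]. lra.
Qed.

Lemma is_ulim_mult (u v : I -> C) (l m : C) :
  is_ulim u l -> is_ulim v m -> is_ulim (fun i => u i * v i)%C (l * m)%C.
Proof.
  intros Hu Hv eps He.
  pose proof (Cmod_ge_0 l). pose proof (Cmod_ge_0 m).
  set (A := Cmod l + Cmod m + 2).
  assert (0 < eps / (2 * A)) by (apply Rdiv_lt_0_compat; unfold A; lra).
  apply (ultra_mp2 _ _ _ (Hu (eps / (2*A)) H1) (ultra_inter U HU _ _ (Hv (eps/(2*A)) H1) (is_ulim_bounded _ _ Hv))).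
  intros i H2 [H3 H4].
  replace (u i * v i - l * m)%C with ((u i - l) * v i + l * (v i - m))%C by ring.
  eapply Rle_lt_trans; [apply Cmod_triangle|]. rewrite !Cmod_mult.
  assert (Ha : Cmod (u i - l) * Cmod (v i) <= eps/(2*A) * (Cmod m + 1)).
  { apply Rmult_le_compat; try apply Cmod_ge_0; lra. }
  assert (Hb : Cmod l * Cmod (v i - m) <= Cmod l * (eps/(2*A))).
  { apply Rmult_le_compat_l; lra. }
  apply Rle_lt_trans with (eps / (2*A) * (Cmod l + Cmod m + 1)); [lra|].
  apply Rlt_le_trans with (eps/(2*A) * A). { apply Rmult_lt_compat_l; auto. unfold A; lra. }
  replace (eps/(2*A) * A) with (eps/2) by (field; unfold A; lra). lra.
Qed.

Lemma is_ulim_unique (u : I -> C) (l m : C) : is_ulim u l -> is_ulim u m -> l = m.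
Proof.
  intros Hl Hm. apply NNPP. intros Hn.
  assert (Hp : 0 < Cmod (l - m)).
  { apply Cmod_gt_0. intros H. apply Hn. replace l with ((l - m) + m)%C by ring. rewrite H. ring. }
  destruct (ultra_inhabited U HU _ (ultra_inter U HU _ _ (Hl (Cmod (l-m) / 2) ltac:(lra)) (Hm (Cmod (l-m) / 2) ltac:(lra)))) as [i [H1 H2]].
  assert (Cmod (l - m) <= Cmod (u i - l) + Cmod (u i - m)); [|lra].
  replace (l - m)%C with (- (u i - l) + (u i - m))%C by ring.
  eapply Rle_trans; [apply Cmod_triangle|]. rewrite Cmod_opp. lra.
Qed.

Lemma is_ulim_ext (u v : I -> C) (l : C) : U (fun i => u i = v i) -> is_ulim u l -> is_ulim v l.
Proof. intros H Hu eps He. apply (ultra_mp2 _ _ _ H (Hu eps He)). intros i <-. auto. Qed.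

Lemma is_ulim_le (u : I -> C) (l : C) (M : R) : U (fun i => Cmod (u i) <= M) -> is_ulim u l -> Cmod l <= M.
Proof.
  intros H Hu. apply le_epsilon. intros eps He.
  destruct (ultra_inhabited U HU _ (ultra_inter U HU _ _ H (Hu eps He))) as [i [H1 H2]].
  replace l with (u i + - (u i - l))%C by ring.
  eapply Rle_trans; [apply Cmod_triangle|]. rewrite Cmod_opp. lra.
Qed.

Lemma is_ulim_ge (u : I -> C) (l : C) (M : R) : U (fun i => M <= Cmod (u i)) -> is_ulim u l -> M <= Cmod l.
Proof.
  intros H Hu. apply le_epsilon. intros eps He.
  destruct (ultra_inhabited U HU _ (ultra_inter U HU _ _ H (Hu eps He))) as [i [H1 H2]].
  eapply Rle_trans; [apply H1|].
  replace (u i) with (l + (u i - l))%C by ring.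
  eapply Rle_trans; [apply Cmod_triangle|]. lra.
Qed.

Lemma is_ulim_minus (u v : I -> C) (l m : C) :
  is_ulim u l -> is_ulim v m -> is_ulim (fun i => u i - v i)%C (l - m)%C.
Proof.
  intros Hu Hv. replace (l - m)%C with (l + (-(1)) * m)%C by ring.
  apply (is_ulim_ext (fun i => u i + (-(1)) * v i)%C).
  { apply ultra_all. intros i. ring. }
  apply is_ulim_plus; auto. apply is_ulim_mult; auto. apply is_ulim_const.
Qed.

End UltraLimit.

(** A choice operator makes the limit total, so that a limit of functions can be written pointwise
    without convergence proofs; for divergent families the value is meaningless. *)
Definition ulim {I : Type} (U : (I -> Prop) -> Prop) (u : I -> C) : C :=
  epsilon (inhabits (RtoC 0)) (fun l => is_ulim (U := U) u l).

Lemma ulim_spec {I : Type} {U : (I -> Prop) -> Prop} (HU : ultrafilter U) (u : I -> C) (M : R) :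
  U (fun i => Cmod (u i) <= M) -> is_ulim (U := U) u (ulim U u).
Proof. intros H. unfold ulim. apply epsilon_spec. exact (ulim_exists HU u M H). Qed.

Lemma ulim_eq {I : Type} {U : (I -> Prop) -> Prop} (HU : ultrafilter U) (u : I -> C) (l : C) :
  is_ulim (U := U) u l -> ulim U u = l.
Proof.
  intros H. apply (is_ulim_unique HU u); auto.
  apply (ulim_spec HU u (Cmod l + 1)). apply (is_ulim_bounded HU); auto.
Qed.

(** * Complex differentiability *)

Definition ccont (g : C -> C) (z : C) : Prop :=
  forall eps, 0 < eps -> exists d, 0 < d /\ forall w, Cmod (w - z) < d -> Cmod (g w - g z) < eps.

(** Caratheodory's form of differentiability: the increment is w - z times a function continuous at
    [z]. Product and inverse rules then reduce to algebraic identities. *)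
Definition cdiff (F : C -> C) (z : C) : Prop :=
  exists phi : C -> C, ccont phi z /\ exists d, 0 < d /\
    forall w, Cmod (w - z) < d -> F w = (F z + phi w * (w - z))%C.

Lemma ccont_const (c z : C) : ccont (fun _ => c) z.
Proof. intros eps He. exists 1. split; [lra|]. intros w _. replace (c - c)%C with (RtoC 0) by ring. rewrite Cmod_0. lra. Qed.

Lemma ccont_id (z : C) : ccont (fun w => w) z.
Proof. intros eps He. exists eps. split; auto. Qed.

Lemma ccont_ext (g h : C -> C) (z : C) (d : R) :
  0 < d -> (forall w, Cmod (w - z) < d -> g w = h w) -> ccont g z -> ccont h z.
Proof.
  intros Hd H Hg eps He. destruct (Hg eps He) as [d' [Hd' H']].
  exists (Rmin d d'). split; [apply Rmin_pos; auto|]. intros w Hw.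
  rewrite <- !H; [apply H'|..].
  - eapply Rlt_le_trans; [apply Hw|apply Rmin_r].
  - replace (z - z)%C with (RtoC 0) by ring. rewrite Cmod_0. auto.
  - eapply Rlt_le_trans; [apply Hw|apply Rmin_l].
Qed.

Lemma ccont_plus (g h : C -> C) (z : C) : ccont g z -> ccont h z -> ccont (fun w => g w + h w)%C z.
Proof.
  intros Hg Hh eps He. destruct (Hg (eps/2) ltac:(lra)) as [d1 [Hd1 H1]]. destruct (Hh (eps/2) ltac:(lra)) as [d2 [Hd2 H2]].
  exists (Rmin d1 d2). split; [apply Rmin_pos; auto|]. intros w Hw.
  pose proof (Rmin_l d1 d2). pose proof (Rmin_r d1 d2).
  specialize (H1 w ltac:(lra)). specialize (H2 w ltac:(lra)).
  replace (g w + h w - (g z + h z))%C with ((g w - g z) + (h w - h z))%C by ring.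
  eapply Rle_lt_trans; [apply Cmod_triangle|]. lra.
Qed.

Lemma ccont_bounded (g : C -> C) (z : C) : ccont g z ->
  exists d, 0 < d /\ forall w, Cmod (w - z) < d -> Cmod (g w) <= Cmod (g z) + 1.
Proof.
  intros Hg. destruct (Hg 1 ltac:(lra)) as [d [Hd H]]. exists d. split; auto. intros w Hw.
  specialize (H w Hw). replace (g w) with (g z + (g w - g z))%C by ring.
  eapply Rle_trans; [apply Cmod_triangle|]. lra.
Qed.

Lemma ccont_mult (g h : C -> C) (z : C) : ccont g z -> ccont h z -> ccont (fun w => g w * h w)%C z.
Proof.
  intros Hg Hh eps He.
  destruct (ccont_bounded _ _ Hh) as [d0 [Hd0 K0]].
  pose proof (Cmod_ge_0 (g z)). pose proof (Cmod_ge_0 (h z)).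
  set (A := Cmod (g z) + Cmod (h z) + 2).
  assert (Hq : 0 < eps / A) by (apply Rdiv_lt_0_compat; unfold A; lra).
  destruct (Hg (eps/A) Hq) as [d1 [Hd1 K1]]. destruct (Hh (eps/A) Hq) as [d2 [Hd2 K2]].
  exists (Rmin d0 (Rmin d1 d2)). split; [repeat apply Rmin_pos; auto|]. intros w Hw.
  pose proof (Rmin_l d0 (Rmin d1 d2)). pose proof (Rmin_r d0 (Rmin d1 d2)).
  pose proof (Rmin_l d1 d2). pose proof (Rmin_r d1 d2).
  specialize (K1 w ltac:(lra)). specialize (K2 w ltac:(lra)). specialize (K0 w ltac:(lra)).
  replace (g w * h w - g z * h z)%C with ((g w - g z) * h w + g z * (h w - h z))%C by ring.
  eapply Rle_lt_trans; [apply Cmod_triangle|]. rewrite !Cmod_mult.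
  apply Rle_lt_trans with (eps/A * (Cmod (h z) + 1) + Cmod (g z) * (eps/A)).
  { apply Rplus_le_compat; [apply Rmult_le_compat|apply Rmult_le_compat_l]; try apply Cmod_ge_0; lra. }
  apply Rlt_le_trans with (eps / A * A); [|right; field; unfold A; lra].
  replace (eps / A * (Cmod (h z) + 1) + Cmod (g z) * (eps / A)) with (eps/A * (Cmod (g z) + Cmod (h z) + 1)) by ring.
  apply Rmult_lt_compat_l; auto. unfold A; lra.
Qed.

Lemma ccont_inv (g : C -> C) (z : C) : ccont g z -> g z <> 0%C -> ccont (fun w => / g w)%C z.
Proof.
  intros Hg Hz eps He. apply Cmod_gt_0 in Hz. set (m := Cmod (g z)) in *.
  destruct (Hg (m/2) ltac:(lra)) as [d1 [Hd1 H1]].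
  destruct (Hg (eps * (m * m / 2))) as [d2 [Hd2 H2]]; [apply Rmult_lt_0_compat; [auto|nra]|].
  exists (Rmin d1 d2). split; [apply Rmin_pos; auto|]. intros w Hw.
  pose proof (Rmin_l d1 d2). pose proof (Rmin_r d1 d2).
  specialize (H1 w ltac:(lra)). specialize (H2 w ltac:(lra)).
  assert (Hw2 : m / 2 < Cmod (g w)).
  { assert (m <= Cmod (g w) + Cmod (g w - g z)); [|lra]. unfold m.
    replace (g z) with (g w + - (g w - g z))%C at 1 by ring.
    eapply Rle_trans; [apply Cmod_triangle|]. rewrite Cmod_opp. lra. }
  assert (g w <> 0%C) by (apply Cmod_gt_0; lra).
  assert (g z <> 0%C) by (apply Cmod_gt_0; assumption).
  replace (/ g w - / g z)%C with (- (g w - g z) / (g w * g z))%C by (field; auto).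
  rewrite Cmod_div by (apply Cmult_neq_0; auto). rewrite Cmod_opp, Cmod_mult.
  fold m. assert (Hgm : 0 < Cmod (g w) * m) by (apply Rmult_lt_0_compat; lra).
  apply Rmult_lt_reg_r with (Cmod (g w) * m); [auto|].
  unfold Rdiv. rewrite Rmult_assoc, Rinv_l by lra. rewrite Rmult_1_r.
  eapply Rlt_trans; [apply H2|]. apply Rmult_lt_compat_l; auto.
  replace (m * m / 2) with (m / 2 * m) by field. apply Rmult_lt_compat_r; auto.
Qed.

Lemma cdiff_ccont (F : C -> C) (z : C) : cdiff F z -> ccont F z.
Proof.
  intros [phi [Hp [d [Hd H]]]].
  apply (ccont_ext (fun w => F z + phi w * (w + - z))%C _ z d Hd).
  { intros w Hw. rewrite (H w Hw). ring. }
  apply ccont_plus; [apply ccont_const|]. apply ccont_mult; auto.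
  apply ccont_plus; [apply ccont_id|apply ccont_const].
Qed.

Lemma cdiff_const (c z : C) : cdiff (fun _ => c) z.
Proof. exists (fun _ => 0%C). split; [apply ccont_const|]. exists 1. split; [lra|]. intros w _. ring. Qed.

Lemma cdiff_id (z : C) : cdiff (fun w => w) z.
Proof. exists (fun _ => 1%C). split; [apply ccont_const|]. exists 1. split; [lra|]. intros w _. ring. Qed.

Lemma cdiff_plus (F G : C -> C) (z : C) : cdiff F z -> cdiff G z -> cdiff (fun w => F w + G w)%C z.
Proof.
  intros [p [Hp [d [Hd H]]]] [q [Hq [e [He H']]]].
  exists (fun w => p w + q w)%C. split; [apply ccont_plus; auto|].
  exists (Rmin d e). split; [apply Rmin_pos; auto|]. intros w Hw.
  pose proof (Rmin_l d e). pose proof (Rmin_r d e).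
  rewrite H, H' by lra. ring.
Qed.

Lemma cdiff_mult (F G : C -> C) (z : C) : cdiff F z -> cdiff G z -> cdiff (fun w => F w * G w)%C z.
Proof.
  intros HF HG. pose proof (cdiff_ccont G z HG) as HGc.
  destruct HF as [p [Hp [d [Hd H]]]]. destruct HG as [q [Hq [e [He H']]]].
  exists (fun w => p w * G w + F z * q w)%C.
  split; [apply ccont_plus; apply ccont_mult; auto; apply ccont_const|].
  exists (Rmin d e). split; [apply Rmin_pos; auto|]. intros w Hw.
  pose proof (Rmin_l d e). pose proof (Rmin_r d e).
  rewrite H, H' by lra. ring.
Qed.

Lemma cdiff_inv (F : C -> C) (z : C) : cdiff F z -> F z <> 0%C -> cdiff (fun w => / F w)%C z.
Proof.
  intros HF Hz. pose proof (cdiff_ccont F z HF) as HFc.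
  pose proof (ccont_inv F z HFc Hz) as Hi.
  destruct HF as [p [Hp [d [Hd H]]]].
  destruct (HFc (Cmod (F z)) ltac:(apply Cmod_gt_0; auto)) as [e [He H']].
  exists (fun w => (- (1)) * (p w * (/ F w * / F z)))%C.
  split.
  { apply ccont_mult; [apply ccont_const|]. apply ccont_mult; auto. apply ccont_mult; auto. apply ccont_const. }
  exists (Rmin d e). split; [apply Rmin_pos; auto|]. intros w Hw.
  pose proof (Rmin_l d e). pose proof (Rmin_r d e).
  assert (Hw0 : F w <> 0%C).
  { intros E. specialize (H' w ltac:(lra)). rewrite E in H'.
    replace (0 - F z)%C with (- F z)%C in H' by ring. rewrite Cmod_opp in H'. lra. }
  replace (- (1) * (p w * (/ F w * / F z)) * (w - z))%C with (- (1) * (p w * (w - z)) * (/ F w * / F z))%C by ring.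
  replace (p w * (w - z))%C with (F w - F z)%C by (rewrite (H w) by lra; ring).
  field. auto.
Qed.

Lemma cdiff_ext (F G : C -> C) (z : C) (d : R) :
  0 < d -> (forall w, Cmod (w - z) < d -> F w = G w) -> cdiff F z -> cdiff G z.
Proof.
  intros Hd H [p [Hp [e [He H']]]]. exists p. split; auto.
  exists (Rmin d e). split; [apply Rmin_pos; auto|]. intros w Hw.
  pose proof (Rmin_l d e). pose proof (Rmin_r d e).
  rewrite <- !H; [apply H'; lra| |lra].
  replace (z - z)%C with (RtoC 0) by ring. rewrite Cmod_0. auto.
Qed.

Lemma cdiff_affine (F : C -> C) (a b z : C) : cdiff F (a + z * b) -> cdiff (fun w => F (a + w * b)%C) z.
Proof.
  intros [p [Hp [e [He H]]]].
  (* Radii are divided by [Cmod b + 1] so that b = 0 needs no separate case. *)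
  assert (HB : 0 < Cmod b + 1) by (pose proof (Cmod_ge_0 b); lra).
  assert (Hk : forall w r, Cmod (w - z) < r / (Cmod b + 1) -> Cmod (a + w * b - (a + z * b)) < r).
  { intros w r Hw. replace (a + w * b - (a + z * b))%C with ((w - z) * b)%C by ring.
    rewrite Cmod_mult. apply Rmult_lt_compat_r with (r := Cmod b + 1) in Hw; auto.
    replace (r / (Cmod b + 1) * (Cmod b + 1)) with r in Hw by (field; lra).
    pose proof (Cmod_ge_0 (w - z)). nra. }
  exists (fun w => b * p (a + w * b))%C. split.
  - apply ccont_mult; [apply ccont_const|]. intros eps Heps.
    destruct (Hp eps Heps) as [d [Hd H']]. exists (d / (Cmod b + 1)).
    split; [apply Rdiv_lt_0_compat; auto|]. intros w Hw. apply H', Hk, Hw.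
  - exists (e / (Cmod b + 1)). split; [apply Rdiv_lt_0_compat; auto|]. intros w Hw.
    rewrite (H _ (Hk _ _ Hw)). ring.
Qed.

Lemma cdiff_minus (F G : C -> C) (z : C) : cdiff F z -> cdiff G z -> cdiff (fun w => F w - G w)%C z.
Proof.
  intros HF HG. apply (cdiff_ext (fun w => F w + (-(1)) * G w)%C _ z 1 ltac:(lra)).
  { intros; ring. }
  apply cdiff_plus; auto. apply cdiff_mult; auto. apply cdiff_const.
Qed.

Lemma cdiff_div (F G : C -> C) (z : C) : cdiff F z -> cdiff G z -> G z <> 0%C -> cdiff (fun w => F w / G w)%C z.
Proof. intros. apply cdiff_mult; auto. apply cdiff_inv; auto. Qed.

(** * Integrals over rectangles *)

Definition CI (f : R -> C) (a b : R) : C := RInt (V := C_R_CompleteNormedModule) f a b.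
Definition exCI (f : R -> C) (a b : R) : Prop := ex_RInt (V := C_R_CompleteNormedModule) f a b.
Definition isCI (f : R -> C) (a b : R) (l : C) : Prop := is_RInt (V := C_R_CompleteNormedModule) f a b l.

Lemma CI_correct (f : R -> C) (a b : R) : exCI f a b -> isCI f a b (CI f a b).
Proof. exact (RInt_correct (V := C_R_CompleteNormedModule) f a b). Qed.

Lemma isCI_unique (f : R -> C) (a b : R) (l : C) : isCI f a b l -> CI f a b = l.
Proof. exact (is_RInt_unique (V := C_R_CompleteNormedModule) f a b l). Qed.

Lemma isCI_pair (f : R -> C) (a b : R) (l : C) :
  is_RInt (fun t => fst (f t)) a b (fst l) -> is_RInt (fun t => snd (f t)) a b (snd l) -> isCI f a b l.
Proof. intros H1 H2. destruct l as [l1 l2]. exact (is_RInt_fct_extend_pair f a b l1 l2 H1 H2). Qed.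

Lemma isCI_fst (f : R -> C) (a b : R) (l : C) : isCI f a b l -> is_RInt (fun t => fst (f t)) a b (fst l).
Proof. exact (is_RInt_fct_extend_fst f a b l). Qed.

Lemma isCI_snd (f : R -> C) (a b : R) (l : C) : isCI f a b l -> is_RInt (fun t => snd (f t)) a b (snd l).
Proof. exact (is_RInt_fct_extend_snd f a b l). Qed.

Lemma isCI_plus (f g : R -> C) (a b : R) (l m : C) :
  isCI f a b l -> isCI g a b m -> isCI (fun t => f t + g t)%C a b (l + m)%C.
Proof. exact (is_RInt_plus (V := C_R_CompleteNormedModule) f g a b l m). Qed.

(** Integration treats [C] as a module over the reals, so a complex factor has to be handled on real
    and imaginary parts. *)
Lemma isCI_mult (c : C) (f : R -> C) (a b : R) (l : C) :
  isCI f a b l -> isCI (fun t => c * f t)%C a b (c * l)%C.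
Proof.
  intros H. pose proof (isCI_fst _ _ _ _ H) as H1. pose proof (isCI_snd _ _ _ _ H) as H2.
  apply isCI_pair; simpl.
  - exact (is_RInt_minus _ _ _ _ _ _ (is_RInt_scal _ _ _ (fst c) _ H1) (is_RInt_scal _ _ _ (snd c) _ H2)).
  - exact (is_RInt_plus _ _ _ _ _ _ (is_RInt_scal _ _ _ (fst c) _ H2) (is_RInt_scal _ _ _ (snd c) _ H1)).
Qed.

Lemma isCI_const (c : C) (a b : R) : isCI (fun _ => c) a b (RtoC (b - a) * c)%C.
Proof.
  apply isCI_pair; simpl.
  - replace ((b - a) * fst c - 0 * snd c) with (scal (b - a) (fst c)) by (unfold scal; simpl; unfold mult; simpl; ring). apply (is_RInt_const (V := R_NormedModule)).
  - replace ((b - a) * snd c + 0 * fst c) with (scal (b - a) (snd c)) by (unfold scal; simpl; unfold mult; simpl; ring). apply (is_RInt_const (V := R_NormedModule)).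
Qed.

Lemma isCI_ext (f g : R -> C) (a b : R) (l : C) : a <= b ->
  (forall t, a <= t <= b -> f t = g t) -> isCI f a b l -> isCI g a b l.
Proof.
  intros Hab H. apply is_RInt_ext. rewrite Rmin_left, Rmax_right by auto. intros t Ht. apply H. lra.
Qed.

Lemma isCI_bound (f : R -> C) (a b : R) (l : C) (M : R) : a <= b ->
  (forall t, a <= t <= b -> Cmod (f t) <= M) -> isCI f a b l -> Cmod l <= (b - a) * M.
Proof.
  intros Hab H Hf. rewrite Cmod_norm.
  apply (norm_RInt_le_const (V := C_R_NormedModule) f a b l M Hab); [|exact Hf].
  intros t Ht. rewrite <- Cmod_norm. apply H, Ht.
Qed.

Lemma CI_Chasles (f : R -> C) (a b c : R) : exCI f a b -> exCI f b c -> CI f a c = (CI f a b + CI f b c)%C.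
Proof. intros H1 H2. symmetry. exact (RInt_Chasles (V := C_R_CompleteNormedModule) f a b c H1 H2). Qed.

Lemma CI_ext (f g : R -> C) (a b : R) : a <= b -> (forall t, a <= t <= b -> f t = g t) -> CI f a b = CI g a b.
Proof.
  intros Hab H. apply (RInt_ext (V := C_R_CompleteNormedModule)). rewrite Rmin_left, Rmax_right by auto.
  intros t Ht. apply H. lra.
Qed.

Lemma exCI_cont (f : R -> C) (a b : R) : a <= b ->
  (forall t, a <= t <= b -> forall eps, 0 < eps -> exists d, 0 < d /\ forall s, Rabs (s - t) < d -> Cmod (f s - f t) < eps) ->
  exCI f a b.
Proof.
  intros Hab H. apply (ex_RInt_continuous (V := C_R_CompleteNormedModule)).
  rewrite Rmin_left, Rmax_right by auto. intros t Ht.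
  apply filterlim_locally. intros eps. destruct (H t Ht eps (cond_pos eps)) as [d [Hd Hs]].
  exists (mkposreal d Hd). intros s Hb. specialize (Hs s Hb).
  exact (C_NormedModule_mixin_compat1 _ _ _ Hs).
Qed.

Lemma Cmod_pair_x (x x' y : R) : Cmod ((x, y) - (x', y)) = Rabs (x - x').
Proof.
  replace ((x, y) - (x', y))%C with (RtoC (x - x')). apply Cmod_R.
  unfold RtoC, Cminus, Cplus, Copp; simpl; f_equal; ring.
Qed.

Lemma Cmod_pair_y (x y y' : R) : Cmod ((x, y) - (x, y')) = Rabs (y - y').
Proof.
  replace ((x, y) - (x, y'))%C with (Ci * RtoC (y - y'))%C.
  - rewrite Cmod_mult, Cmod_Ci, Cmod_R. ring.
  - unfold RtoC, Ci, Cminus, Cmult, Cplus, Copp; simpl; f_equal; ring.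
Qed.

(** [Hor] and [Ver] integrate against dx and dy; the factor [Ci] of a vertical tangent is supplied
    where they are combined. *)
Definition Hor (F : C -> C) (y a b : R) : C := CI (fun x => F (x, y)) a b.
Definition Ver (F : C -> C) (x a b : R) : C := CI (fun y => F (x, y)) a b.

Lemma ex_Hor (F : C -> C) (y a b : R) : a <= b -> (forall x, a <= x <= b -> ccont F (x, y)) ->
  exCI (fun x => F (x, y)) a b.
Proof.
  intros Hab H. apply exCI_cont; auto. intros t Ht eps He. destruct (H t Ht eps He) as [d [Hd H']].
  exists d. split; auto. intros s Hs. apply H'. rewrite Cmod_pair_x. auto.
Qed.

Lemma ex_Ver (F : C -> C) (x a b : R) : a <= b -> (forall y, a <= y <= b -> ccont F (x, y)) ->
  exCI (fun y => F (x, y)) a b.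
Proof.
  intros Hab H. apply exCI_cont; auto. intros t Ht eps He. destruct (H t Ht eps He) as [d [Hd H']].
  exists d. split; auto. intros s Hs. apply H'. rewrite Cmod_pair_y. auto.
Qed.

(** The counterclockwise contour integral of F(s) ds. *)
Definition Rect (F : C -> C) (x0 x1 y0 y1 : R) : C :=
  (Hor F y0 x0 x1 - Hor F y1 x0 x1 + Ci * (Ver F x1 y0 y1 - Ver F x0 y0 y1))%C.

Definition on_sides (x0 x1 y0 y1 : R) (z : C) : Prop :=
  (x0 <= fst z <= x1 /\ (snd z = y0 \/ snd z = y1)) \/ (y0 <= snd z <= y1 /\ (fst z = x0 \/ fst z = x1)).

Definition in_rect (x0 x1 y0 y1 : R) (z : C) : Prop := x0 <= fst z <= x1 /\ y0 <= snd z <= y1.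

Lemma on_sides_in_rect (x0 x1 y0 y1 : R) (z : C) : x0 <= x1 -> y0 <= y1 ->
  on_sides x0 x1 y0 y1 z -> in_rect x0 x1 y0 y1 z.
Proof. intros ? ? [[? [?|?]]|[? [?|?]]]; unfold in_rect; lra. Qed.

Lemma isCI_sides (F : C -> C) (x0 x1 y0 y1 : R) : x0 <= x1 -> y0 <= y1 ->
  (forall z, on_sides x0 x1 y0 y1 z -> ccont F z) ->
  isCI (fun x => F (x, y0)) x0 x1 (Hor F y0 x0 x1) /\ isCI (fun x => F (x, y1)) x0 x1 (Hor F y1 x0 x1) /\
  isCI (fun y => F (x0, y)) y0 y1 (Ver F x0 y0 y1) /\ isCI (fun y => F (x1, y)) y0 y1 (Ver F x1 y0 y1).
Proof.
  intros Hx Hy H. split; [|split; [|split]].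
  - apply (CI_correct (fun x => F (x, y0)) x0 x1), ex_Hor; auto. intros t Ht; apply H; unfold on_sides; simpl; auto.
  - apply (CI_correct (fun x => F (x, y1)) x0 x1), ex_Hor; auto. intros t Ht; apply H; unfold on_sides; simpl; auto.
  - apply (CI_correct (fun y => F (x0, y)) y0 y1), ex_Ver; auto. intros t Ht; apply H; unfold on_sides; simpl; auto.
  - apply (CI_correct (fun y => F (x1, y)) y0 y1), ex_Ver; auto. intros t Ht; apply H; unfold on_sides; simpl; auto.
Qed.

Lemma Rect_unique (F : C -> C) (x0 x1 y0 y1 : R) (b t l r : C) :
  isCI (fun x => F (x, y0)) x0 x1 b -> isCI (fun x => F (x, y1)) x0 x1 t ->
  isCI (fun y => F (x0, y)) y0 y1 l -> isCI (fun y => F (x1, y)) y0 y1 r ->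
  Rect F x0 x1 y0 y1 = (b - t + Ci * (r - l))%C.
Proof.
  intros Hb Ht Hl Hr. unfold Rect, Hor, Ver.
  rewrite (isCI_unique _ _ _ _ Hb), (isCI_unique _ _ _ _ Ht), (isCI_unique _ _ _ _ Hl), (isCI_unique _ _ _ _ Hr). reflexivity.
Qed.

Lemma Rect_plus (F G : C -> C) (x0 x1 y0 y1 : R) : x0 <= x1 -> y0 <= y1 ->
  (forall z, on_sides x0 x1 y0 y1 z -> ccont F z) -> (forall z, on_sides x0 x1 y0 y1 z -> ccont G z) ->
  Rect (fun z => F z + G z)%C x0 x1 y0 y1 = (Rect F x0 x1 y0 y1 + Rect G x0 x1 y0 y1)%C.
Proof.
  intros Hx Hy HF HG.
  destruct (isCI_sides F x0 x1 y0 y1 Hx Hy HF) as [A1 [A2 [A3 A4]]].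
  destruct (isCI_sides G x0 x1 y0 y1 Hx Hy HG) as [B1 [B2 [B3 B4]]].
  rewrite (Rect_unique (fun z => F z + G z)%C x0 x1 y0 y1 _ _ _ _ (isCI_plus _ _ _ _ _ _ A1 B1) (isCI_plus _ _ _ _ _ _ A2 B2)
    (isCI_plus _ _ _ _ _ _ A3 B3) (isCI_plus _ _ _ _ _ _ A4 B4)).
  unfold Rect. ring.
Qed.

Lemma Rect_mult (c : C) (F : C -> C) (x0 x1 y0 y1 : R) : x0 <= x1 -> y0 <= y1 ->
  (forall z, on_sides x0 x1 y0 y1 z -> ccont F z) ->
  Rect (fun z => c * F z)%C x0 x1 y0 y1 = (c * Rect F x0 x1 y0 y1)%C.
Proof.
  intros Hx Hy HF.
  destruct (isCI_sides F x0 x1 y0 y1 Hx Hy HF) as [A1 [A2 [A3 A4]]].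
  rewrite (Rect_unique (fun z => c * F z)%C x0 x1 y0 y1 _ _ _ _ (isCI_mult c _ _ _ _ A1) (isCI_mult c _ _ _ _ A2)
    (isCI_mult c _ _ _ _ A3) (isCI_mult c _ _ _ _ A4)).
  unfold Rect. ring.
Qed.

Lemma Rect_ext (F G : C -> C) (x0 x1 y0 y1 : R) : x0 <= x1 -> y0 <= y1 ->
  (forall z, on_sides x0 x1 y0 y1 z -> F z = G z) -> Rect F x0 x1 y0 y1 = Rect G x0 x1 y0 y1.
Proof.
  intros Hx Hy H. unfold Rect, Hor, Ver.
  rewrite (CI_ext (fun x => F (x, y0)) (fun x => G (x, y0))) by (auto; intros; apply H; unfold on_sides; simpl; auto).
  rewrite (CI_ext (fun x => F (x, y1)) (fun x => G (x, y1))) by (auto; intros; apply H; unfold on_sides; simpl; auto).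
  rewrite (CI_ext (fun y => F (x0, y)) (fun y => G (x0, y))) by (auto; intros; apply H; unfold on_sides; simpl; auto).
  rewrite (CI_ext (fun y => F (x1, y)) (fun y => G (x1, y))) by (auto; intros; apply H; unfold on_sides; simpl; auto).
  reflexivity.
Qed.

Lemma Rect_bound (F : C -> C) (x0 x1 y0 y1 M : R) : x0 <= x1 -> y0 <= y1 ->
  (forall z, on_sides x0 x1 y0 y1 z -> ccont F z) -> (forall z, on_sides x0 x1 y0 y1 z -> Cmod (F z) <= M) ->
  Cmod (Rect F x0 x1 y0 y1) <= 2 * ((x1 - x0) + (y1 - y0)) * M.
Proof.
  intros Hx Hy HF HM.
  destruct (isCI_sides F x0 x1 y0 y1 Hx Hy HF) as [A1 [A2 [A3 A4]]].
  apply (isCI_bound _ _ _ _ M Hx) in A1; [|intros; apply HM; unfold on_sides; simpl; auto].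
  apply (isCI_bound _ _ _ _ M Hx) in A2; [|intros; apply HM; unfold on_sides; simpl; auto].
  apply (isCI_bound _ _ _ _ M Hy) in A3; [|intros; apply HM; unfold on_sides; simpl; auto].
  apply (isCI_bound _ _ _ _ M Hy) in A4; [|intros; apply HM; unfold on_sides; simpl; auto].
  unfold Rect, Cminus.
  eapply Rle_trans; [apply Cmod_triangle|]. rewrite Cmod_mult, Cmod_Ci.
  pose proof (Cmod_triangle (Hor F y0 x0 x1) (- Hor F y1 x0 x1)) as T1.
  pose proof (Cmod_triangle (Ver F x1 y0 y1) (- Ver F x0 y0 y1)) as T2.
  rewrite Cmod_opp in T1, T2. lra.
Qed.

Lemma Rect_split_x (F : C -> C) (x0 x1 x2 y0 y1 : R) : x0 <= x1 -> x1 <= x2 ->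
  (forall x, x0 <= x <= x2 -> ccont F (x, y0)) -> (forall x, x0 <= x <= x2 -> ccont F (x, y1)) ->
  Rect F x0 x2 y0 y1 = (Rect F x0 x1 y0 y1 + Rect F x1 x2 y0 y1)%C.
Proof.
  intros H0 H1 Hb Ht. unfold Rect, Hor.
  rewrite (CI_Chasles (fun x => F (x, y0)) x0 x1 x2) by (apply ex_Hor; auto; intros; apply Hb; lra).
  rewrite (CI_Chasles (fun x => F (x, y1)) x0 x1 x2) by (apply ex_Hor; auto; intros; apply Ht; lra).
  ring.
Qed.

Lemma Rect_split_y (F : C -> C) (x0 x1 y0 y1 y2 : R) : y0 <= y1 -> y1 <= y2 ->
  (forall y, y0 <= y <= y2 -> ccont F (x0, y)) -> (forall y, y0 <= y <= y2 -> ccont F (x1, y)) ->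
  Rect F x0 x1 y0 y2 = (Rect F x0 x1 y0 y1 + Rect F x0 x1 y1 y2)%C.
Proof.
  intros H0 H1 Hb Ht. unfold Rect, Ver.
  rewrite (CI_Chasles (fun y => F (x0, y)) y0 y1 y2) by (apply ex_Ver; auto; intros; apply Hb; lra).
  rewrite (CI_Chasles (fun y => F (x1, y)) y0 y1 y2) by (apply ex_Ver; auto; intros; apply Ht; lra).
  ring.
Qed.

(** Opposite sides differ by a constant, so each pair is the integral of a constant, and the two
    pairs cancel. No primitive is involved. *)
Lemma Rect_affine (a b : C) (x0 x1 y0 y1 : R) : x0 <= x1 -> y0 <= y1 ->
  Rect (fun z => a + b * z)%C x0 x1 y0 y1 = 0%C.
Proof.
  intros Hx Hy.
  assert (Hc : forall z, on_sides x0 x1 y0 y1 z -> ccont (fun z => a + b * z)%C z).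
  { intros z _. apply ccont_plus; [apply ccont_const|]. apply ccont_mult; [apply ccont_const|apply ccont_id]. }
  destruct (isCI_sides _ x0 x1 y0 y1 Hx Hy Hc) as [A1 [A2 [A3 A4]]].
  assert (E1 := isCI_plus _ _ _ _ _ _ A1 (isCI_mult (-(1)) _ _ _ _ A2)).
  assert (E2 := isCI_plus _ _ _ _ _ _ A4 (isCI_mult (-(1)) _ _ _ _ A3)).
  apply (isCI_ext _ (fun _ => b * (Ci * RtoC (y0 - y1)))%C _ _ _ Hx) in E1.
  2:{ intros t _. unfold RtoC, Ci, Cplus, Cmult, Copp; simpl; f_equal; ring. }
  apply (isCI_ext _ (fun _ => b * RtoC (x1 - x0))%C _ _ _ Hy) in E2.
  2:{ intros t _. unfold RtoC, Ci, Cplus, Cmult, Copp; simpl; f_equal; ring. }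
  pose proof (isCI_unique _ _ _ _ E1) as U1. rewrite (isCI_unique _ _ _ _ (isCI_const _ _ _)) in U1.
  pose proof (isCI_unique _ _ _ _ E2) as U2. rewrite (isCI_unique _ _ _ _ (isCI_const _ _ _)) in U2.
  unfold Rect.
  transitivity ((Hor (fun z => a + b * z) y0 x0 x1 + - (1) * Hor (fun z => a + b * z) y1 x0 x1) +
    Ci * (Ver (fun z => a + b * z) x1 y0 y1 + - (1) * Ver (fun z => a + b * z) x0 y0 y1))%C; [ring|].
  rewrite <- U1, <- U2. rewrite !RtoC_minus. ring.
Qed.

(** * Goursat's theorem *)

Lemma pow2_pos (n : nat) : 0 < 2 ^ n.
Proof. apply pow_lt; lra. Qed.

Lemma Cmod_le_abs (z : C) : Cmod z <= Rabs (fst z) + Rabs (snd z).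
Proof.
  replace z with ((fst z, snd z) - (0, snd z) + ((0, snd z) - (0, 0)))%C at 1.
  - eapply Rle_trans; [apply Cmod_triangle|]. rewrite Cmod_pair_x, Cmod_pair_y, !Rminus_0_r. lra.
  - destruct z. unfold Cminus, Cplus, Copp; simpl; f_equal; ring.
Qed.

(** The four quarters add up to the whole, so one of them carries at least a fourth of its
    modulus. *)
Lemma Rect_quarter (F : C -> C) (x0 y0 w h : R) : 0 <= w -> 0 <= h ->
  (forall z, in_rect x0 (x0 + 2 * w) y0 (y0 + 2 * h) z -> ccont F z) ->
  exists x y, (x = x0 \/ x = x0 + w) /\ (y = y0 \/ y = y0 + h) /\
    Cmod (Rect F x0 (x0 + 2 * w) y0 (y0 + 2 * h)) / 4 <= Cmod (Rect F x (x + w) y (y + h)).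
Proof.
  intros Hw Hh HF.
  assert (S1 := Rect_split_x F x0 (x0 + w) (x0 + 2 * w) y0 (y0 + 2 * h) ltac:(lra) ltac:(lra)).
  rewrite S1 by (intros; apply HF; unfold in_rect; simpl; lra). clear S1.
  rewrite (Rect_split_y F x0 (x0 + w) y0 (y0 + h) (y0 + 2 * h)) by (try lra; intros; apply HF; unfold in_rect; simpl; lra).
  rewrite (Rect_split_y F (x0 + w) (x0 + 2 * w) y0 (y0 + h) (y0 + 2 * h)) by (try lra; intros; apply HF; unfold in_rect; simpl; lra).
  set (a := Rect F x0 (x0 + w) y0 (y0 + h)). set (b := Rect F x0 (x0 + w) (y0 + h) (y0 + 2 * h)).
  set (c := Rect F (x0 + w) (x0 + 2 * w) y0 (y0 + h)). set (d := Rect F (x0 + w) (x0 + 2 * w) (y0 + h) (y0 + 2 * h)).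
  assert (T : Cmod (a + b + (c + d)) <= Cmod a + Cmod b + Cmod c + Cmod d).
  { pose proof (Cmod_triangle (a + b) (c + d)). pose proof (Cmod_triangle a b). pose proof (Cmod_triangle c d). lra. }
  destruct (Rle_dec (Cmod (a + b + (c + d)) / 4) (Cmod a)) as [|Na].
  { exists x0, y0. auto. }
  destruct (Rle_dec (Cmod (a + b + (c + d)) / 4) (Cmod b)) as [|Nb].
  { exists x0, (y0 + h). replace (y0 + h + h) with (y0 + 2 * h) by ring. auto. }
  destruct (Rle_dec (Cmod (a + b + (c + d)) / 4) (Cmod c)) as [|Nc].
  { exists (x0 + w), y0. replace (x0 + w + w) with (x0 + 2 * w) by ring. auto. }
  exists (x0 + w), (y0 + h). replace (y0 + h + h) with (y0 + 2 * h) by ring. replace (x0 + w + w) with (x0 + 2 * w) by ring.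
  split; [auto|]. split; [auto|]. fold d. lra.
Qed.

(** Every left endpoint lies below every right endpoint, and the common point is the supremum of the
    left endpoints. *)
Lemma nested_intervals (a : nat -> R) (W : R) : 0 <= W ->
  (forall n, a n <= a (S n) <= a n + W / 2 ^ S n) ->
  exists p, forall n, a n <= p <= a n + W / 2 ^ n.
Proof.
  intros HW H.
  assert (E : forall n, W / 2 ^ n = 2 * (W / 2 ^ S n)).
  { intros n. simpl. field. pose proof (pow2_pos n). lra. }
  assert (Hmon : forall n k, a n <= a (n + k)%nat /\ a (n + k)%nat + W / 2 ^ (n + k) <= a n + W / 2 ^ n).
  { intros n k. induction k.
    - rewrite Nat.add_0_r. lra.
    - rewrite Nat.add_succ_r. specialize (H (n + k)%nat). specialize (E (n + k)%nat). lra. }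
  assert (Hpos : forall n, 0 <= W / 2 ^ n).
  { intros n. apply Rmult_le_pos; auto. left. apply Rinv_0_lt_compat, pow2_pos. }
  assert (Hall : forall n m, a m <= a n + W / 2 ^ n).
  { intros n m. destruct (Nat.le_ge_cases n m) as [L|L].
    - destruct (Hmon n (m - n)%nat) as [_ H2]. replace (n + (m - n))%nat with m in H2 by lia.
      pose proof (Hpos m). lra.
    - destruct (Hmon m (n - m)%nat) as [H1 _]. replace (m + (n - m))%nat with n in H1 by lia.
      pose proof (Hpos n). lra. }
  destruct (completeness (fun t => exists n, t = a n)) as [p [Hp1 Hp2]].
  - exists (a 0%nat + W / 2 ^ 0). intros t [n ->]. apply Hall.
  - exists (a 0%nat), 0%nat. reflexivity.
  - exists p. intros n. split.
    + apply Hp1. exists n. reflexivity.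
    + apply Hp2. intros t [m ->]. apply Hall.
Qed.

Lemma quarter_sequence (F : C -> C) (x0 y0 W H : R) : 0 <= W -> 0 <= H ->
  (forall z, in_rect x0 (x0 + W) y0 (y0 + H) z -> ccont F z) ->
  exists p q, forall n, exists x y,
    x0 <= x /\ x + W / 2 ^ n <= x0 + W /\ y0 <= y /\ y + H / 2 ^ n <= y0 + H /\
    x <= p <= x + W / 2 ^ n /\ y <= q <= y + H / 2 ^ n /\
    Cmod (Rect F x0 (x0 + W) y0 (y0 + H)) / 4 ^ n <= Cmod (Rect F x (x + W / 2 ^ n) y (y + H / 2 ^ n)).
Proof.
  intros HW HH HF.
  set (A := Cmod (Rect F x0 (x0 + W) y0 (y0 + H))).
  set (P := fun (n : nat) (s : R * R) =>
    x0 <= fst s /\ fst s + W / 2 ^ n <= x0 + W /\ y0 <= snd s /\ snd s + H / 2 ^ n <= y0 + H /\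
    A / 4 ^ n <= Cmod (Rect F (fst s) (fst s + W / 2 ^ n) (snd s) (snd s + H / 2 ^ n))).
  assert (Hd : forall V n, V / 2 ^ n = 2 * (V / 2 ^ S n)).
  { intros V n. simpl. field. pose proof (pow2_pos n). lra. }
  assert (Hp : forall V n, 0 <= V -> 0 <= V / 2 ^ n).
  { intros V n HV. apply Rmult_le_pos; auto. left. apply Rinv_0_lt_compat, pow2_pos. }
  assert (Hstep : forall n (s : {s | P n s}), exists t, P (S n) t /\
     (fst (proj1_sig s) <= fst t <= fst (proj1_sig s) + W / 2 ^ S n) /\
     (snd (proj1_sig s) <= snd t <= snd (proj1_sig s) + H / 2 ^ S n)).
  { intros n [[x y] (H1 & H2 & H3 & H4 & H5)]. simpl fst in *. simpl snd in *. simpl proj1_sig.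
    pose proof (Hp W (S n) HW). pose proof (Hp H (S n) HH).
    rewrite (Hd W n) in H2, H5. rewrite (Hd H n) in H4, H5.
    destruct (Rect_quarter F x y (W / 2 ^ S n) (H / 2 ^ S n)) as [x' [y' [Hx [Hy HQ]]]]; auto.
    { intros z [Hz1 Hz2]. apply HF. unfold in_rect. lra. }
    exists (x', y'). unfold P. cbn [fst snd]. split; [|destruct Hx, Hy; subst; lra].
    repeat split; try (destruct Hx, Hy; subst; lra).
    eapply Rle_trans; [|apply HQ]. replace (A / 4 ^ S n) with (A / 4 ^ n / 4); [lra|].
    simpl. field. pose proof (pow_lt 4 n ltac:(lra)). lra. }
  assert (H0 : P 0%nat (x0, y0)).
  { unfold P. cbn [fst snd]. simpl pow. unfold Rdiv. rewrite Rinv_1, !Rmult_1_r. unfold A. lra. }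
  (* Dependent choice: the invariant [P n] travels with the corner, since the next quarter can be
     selected only from a corner that satisfies it. *)
  set (nxt := fun n (s : {s | P n s}) => constructive_indefinite_description _ (Hstep n s)).
  set (sq := fix sq (n : nat) : {s | P n s} := match n with
    | O => exist _ (x0, y0) H0
    | S n => exist _ (proj1_sig (nxt n (sq n))) (proj1 (proj2_sig (nxt n (sq n)))) end).
  destruct (nested_intervals (fun n => fst (proj1_sig (sq n))) W HW) as [p Hpp].
  { intros n. exact (proj1 (proj2 (proj2_sig (nxt n (sq n))))). }
  destruct (nested_intervals (fun n => snd (proj1_sig (sq n))) H HH) as [q Hq].
  { intros n. exact (proj2 (proj2 (proj2_sig (nxt n (sq n))))). }
  exists p, q. intros n. exists (fst (proj1_sig (sq n))), (snd (proj1_sig (sq n))).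
  destruct (proj2_sig (sq n)) as (H1 & H2 & H3 & H4 & H5).
  repeat split; auto; first [apply Hpp|apply Hq].
Qed.

(** At the limit point of the bisection the affine part of [F] integrates to zero. The remainder is
    small compared with the diameter, and the perimeter is of the order of the diameter, so the n-th
    integral is o(4^-n). *)
Lemma goursat (F : C -> C) (x0 x1 y0 y1 : R) : x0 <= x1 -> y0 <= y1 ->
  (forall z, in_rect x0 x1 y0 y1 z -> cdiff F z) -> Rect F x0 x1 y0 y1 = 0%C.
Proof.
  intros Hx Hy HF.
  set (W := x1 - x0). set (H := y1 - y0).
  replace x1 with (x0 + W) in * by (unfold W; ring). replace y1 with (y0 + H) in * by (unfold H; ring).
  assert (HW : 0 <= W) by lra. assert (HH : 0 <= H) by lra. clearbody W H.
  assert (HFc : forall z, in_rect x0 (x0 + W) y0 (y0 + H) z -> ccont F z) by (intros; apply cdiff_ccont; auto).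
  destruct (quarter_sequence F x0 y0 W H HW HH HFc) as [p [q Hpq]].
  set (A := Cmod (Rect F x0 (x0 + W) y0 (y0 + H))) in *.
  apply Cmod_eq_0. fold A. apply Rle_antisym; [|apply Cmod_ge_0].
  apply le_epsilon. intros e He. rewrite Rplus_0_l.
  (* The summand 1 keeps [L] positive for a degenerate rectangle. *)
  set (L := W + H + 1). assert (HL : 1 <= L) by (unfold L; lra).
  assert (Hin : in_rect x0 (x0 + W) y0 (y0 + H) (p, q)).
  { destruct (Hpq 0%nat) as [x [y Hxy]]. unfold in_rect; simpl in *. lra. }
  destruct (HF _ Hin) as [phi [Hphi [d [Hd Hloc]]]].
  (* The perimeter is at most 2 L / 2^n and the remainder at most e' L / 2^n; their product is e /
     4^n. *)
  set (e' := e / (2 * L * L)). assert (He' : 0 < e') by (apply Rdiv_lt_0_compat; nra).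
  destruct (Hphi e' He') as [d' [Hd' Hphi']].
  destruct (pow_lt_1_zero (/2) ltac:(rewrite Rabs_pos_eq; lra) (Rmin d d' / L) ltac:(apply Rdiv_lt_0_compat; [apply Rmin_pos; auto|lra])) as [n Hn].
  specialize (Hn n (le_n n)). rewrite Rabs_pos_eq in Hn by (apply pow_le; lra).
  rewrite pow_inv in Hn.
  assert (Hsmall : L * / 2 ^ n < Rmin d d').
  { apply Rmult_lt_compat_l with (r := L) in Hn; [|lra]. replace (L * (Rmin d d' / L)) with (Rmin d d') in Hn by (field; lra). auto. }
  pose proof (Rmin_l d d') as Rl. pose proof (Rmin_r d d') as Rr.
  destruct (Hpq n) as [x [y (H1 & H2 & H3 & H4 & H5 & H6 & H7)]].
  assert (Hi : 0 < / 2 ^ n) by apply Rinv_0_lt_compat, pow2_pos.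
  set (w := W / 2 ^ n) in *. set (h := H / 2 ^ n) in *.
  assert (Hw : 0 <= w) by (apply Rmult_le_pos; lra). assert (Hh : 0 <= h) by (apply Rmult_le_pos; lra).
  assert (Hwh : w + h <= L * / 2 ^ n) by (unfold w, h, L, Rdiv; nra).
  assert (Hdist : forall z, in_rect x (x + w) y (y + h) z -> Cmod (z - (p, q)) <= L * / 2 ^ n).
  { intros z [Hz1 Hz2]. eapply Rle_trans; [apply Cmod_le_abs|]. simpl.
    apply Rle_trans with (w + h); auto. apply Rplus_le_compat; apply Rabs_le; lra. }
  set (a := (F (p, q) - phi (p, q) * (p, q))%C). set (b := phi (p, q)).
  assert (Hsub : forall z, on_sides x (x + w) y (y + h) z -> in_rect x (x + w) y (y + h) z).
  { intros z. apply on_sides_in_rect; lra. }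
  assert (Hcc : forall z, on_sides x (x + w) y (y + h) z -> ccont F z).
  { intros z Hz. apply Hsub in Hz. apply HFc. unfold in_rect in *. lra. }
  assert (Hca : forall z, ccont (fun z => a + b * z)%C z).
  { intros z. apply ccont_plus; [apply ccont_const|]. apply ccont_mult; [apply ccont_const|apply ccont_id]. }
  set (E := fun z => (F z + (-(1)) * (a + b * z))%C).
  assert (HEc : forall z, on_sides x (x + w) y (y + h) z -> ccont E z).
  { intros z Hz. apply ccont_plus; auto. apply ccont_mult; [apply ccont_const|auto]. }
  assert (ER : Rect F x (x + w) y (y + h) = Rect E x (x + w) y (y + h)).
  { unfold E. rewrite (Rect_plus F (fun z => (-(1)) * (a + b * z))%C); try lra; auto.
    2:{ intros z _. apply ccont_mult; [apply ccont_const|auto]. }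
    rewrite (Rect_mult (-(1)) (fun z => a + b * z)%C); try lra; auto.
    rewrite Rect_affine by lra. ring. }
  assert (HB : Cmod (Rect E x (x + w) y (y + h)) <= 2 * ((x + w - x) + (y + h - y)) * (e' * (L * / 2 ^ n))).
  { apply Rect_bound; try lra; auto. intros z Hz. apply Hsub in Hz. specialize (Hdist z Hz).
    unfold E. rewrite (Hloc z) by lra.
    replace (F (p, q) + phi z * (z - (p, q)) + - (1) * (a + b * z))%C with ((phi z - phi (p, q)) * (z - (p, q)))%C by (unfold a, b; ring).
    rewrite Cmod_mult. apply Rmult_le_compat; try apply Cmod_ge_0; auto. left. apply Hphi'. lra. }
  rewrite <- ER in HB.
  assert (Hfin : A / 4 ^ n <= e * / 4 ^ n).
  { eapply Rle_trans; [apply H7|]. eapply Rle_trans; [apply HB|].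
    replace (x + w - x + (y + h - y)) with (w + h) by ring.
    assert (0 < e' * (L * / 2 ^ n)) by (apply Rmult_lt_0_compat; nra).
    apply Rle_trans with (2 * (L * / 2 ^ n) * (e' * (L * / 2 ^ n))); [nra|].
    right. unfold e'. replace 4 with (2 * 2) by ring. rewrite Rpow_mult_distr. field.
    split; [|lra]. pose proof (pow2_pos n). lra. }
  apply Rmult_le_reg_r with (/ 4 ^ n); auto. apply Rinv_0_lt_compat, pow_lt. lra.
Qed.

(** * Cauchy's formula *)

(** Four rectangles surround the small square and avoid [z]; Goursat's theorem removes each of
    them. *)
Lemma Rect_puncture (F : C -> C) (x0 x1 y0 y1 eta : R) (z : C) : 0 < eta ->
  x0 <= fst z - eta -> fst z + eta <= x1 -> y0 <= snd z - eta -> snd z + eta <= y1 ->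
  (forall s, in_rect x0 x1 y0 y1 s -> s <> z -> cdiff F s) ->
  Rect F x0 x1 y0 y1 = Rect F (fst z - eta) (fst z + eta) (snd z - eta) (snd z + eta).
Proof.
  intros He H1 H2 H3 H4 HF. destruct z as [a b]. simpl in *.
  assert (HC : forall x y, x0 <= x <= x1 -> y0 <= y <= y1 -> x <> a \/ y <> b -> cdiff F (x, y)).
  { intros x y Hx Hy Hn. apply HF; [split; auto|]. intros E. injection E. intros. destruct Hn; auto. }
  assert (HCc : forall x y, x0 <= x <= x1 -> y0 <= y <= y1 -> x <> a \/ y <> b -> ccont F (x, y)).
  { intros. apply cdiff_ccont; auto. }
  rewrite (Rect_split_x F x0 (a - eta) x1) by (try lra; intros; apply HCc; first [lra|left; lra|right; lra]).
  rewrite (Rect_split_x F (a - eta) (a + eta) x1) by (try lra; intros; apply HCc; first [lra|left; lra|right; lra]).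
  rewrite (Rect_split_y F (a - eta) (a + eta) y0 (b - eta) y1) by (try lra; intros; apply HCc; first [lra|left; lra|right; lra]).
  rewrite (Rect_split_y F (a - eta) (a + eta) (b - eta) (b + eta) y1) by (try lra; intros; apply HCc; first [lra|left; lra|right; lra]).
  rewrite (goursat F x0 (a - eta)); try lra.
  2:{ intros [x y] [Hx Hy]; simpl in *. apply HC; first [lra|left; lra|right; lra]. }
  rewrite (goursat F (a + eta) x1); try lra.
  2:{ intros [x y] [Hx Hy]; simpl in *. apply HC; first [lra|left; lra|right; lra]. }
  rewrite (goursat F (a - eta) (a + eta) y0); try lra.
  2:{ intros [x y] [Hx Hy]; simpl in *. apply HC; first [lra|left; lra|right; lra]. }
  rewrite (goursat F (a - eta) (a + eta) (b + eta)); try lra.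
  2:{ intros [x y] [Hx Hy]; simpl in *. apply HC; first [lra|left; lra|right; lra]. }
  ring.
Qed.

(** This integrand is what remains of 1 / (s - z) after pairing opposite sides of a square centred
    at [z]. *)
Lemma is_RInt_atan (a eta : R) : 0 < eta ->
  is_RInt (fun x => 2 * eta / ((x - a) ^ 2 + eta ^ 2)) (a - eta) (a + eta) PI.
Proof.
  intros He.
  assert (H : is_RInt (fun x => 2 * eta / ((x - a) ^ 2 + eta ^ 2)) (a - eta) (a + eta)
     (minus (2 * atan ((a + eta - a) / eta)) (2 * atan ((a - eta - a) / eta)))).
  { apply (is_RInt_derive (fun x => 2 * atan ((x - a) / eta))).
    - intros x _. auto_derive; auto. field. split; [|lra].
      assert (0 < eta ^ 2) by (apply pow_lt; lra). pose proof (pow2_ge_0 (x - a)). lra.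
    - intros x _. apply (ex_derive_continuous (fun x => 2 * eta / ((x - a) ^ 2 + eta ^ 2))).
      auto_derive. assert (0 < eta ^ 2) by (apply pow_lt; lra). pose proof (pow2_ge_0 (x - a)). simpl in *. lra. }
  replace PI with (minus (2 * atan ((a + eta - a) / eta)) (2 * atan ((a - eta - a) / eta))); auto.
  replace ((a + eta - a) / eta) with 1 by (field; lra).
  replace ((a - eta - a) / eta) with (- (1)) by (field; lra).
  rewrite atan_opp, atan_1. unfold minus, plus, opp; simpl. field.
Qed.

Lemma pair_neq_re (z : C) : fst z <> 0 -> z <> 0%C.
Proof. intros H E. apply H. rewrite E. reflexivity. Qed.

Lemma pair_neq_im (z : C) : snd z <> 0 -> z <> 0%C.
Proof. intros H E. apply H. rewrite E. reflexivity. Qed.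

(** Each of the two pairs of opposite sides contributes i PI, by the arctangent integral. *)
Lemma Rect_winding_square (z : C) (eta : R) : 0 < eta ->
  Rect (fun s => / (s - z))%C (fst z - eta) (fst z + eta) (snd z - eta) (snd z + eta) = (2 * PI * Ci)%C.
Proof.
  intros He. destruct z as [a b]. simpl.
  assert (La : a - eta <= a + eta) by lra. assert (Lb : b - eta <= b + eta) by lra.
  assert (Hp : forall t, 0 < t ^ 2 + eta ^ 2).
  { intros t. assert (0 < eta ^ 2) by (apply pow_lt; lra). pose proof (pow2_ge_0 t). lra. }
  assert (Hc : forall s, on_sides (a - eta) (a + eta) (b - eta) (b + eta) s -> ccont (fun s => / (s - (a, b)))%C s).
  { intros s Hs. apply ccont_inv.
    - apply ccont_plus; [apply ccont_id|apply ccont_const].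
    - destruct Hs as [[_ Hs]|[_ Hs]]; [apply pair_neq_im|apply pair_neq_re]; simpl; lra. }
  destruct (isCI_sides _ (a - eta) (a + eta) (b - eta) (b + eta) ltac:(lra) ltac:(lra) Hc) as [A1 [A2 [A3 A4]]].
  assert (E1 := isCI_plus _ _ _ _ _ _ A1 (isCI_mult (-(1)) _ _ _ _ A2)).
  assert (E2 := isCI_plus _ _ _ _ _ _ A4 (isCI_mult (-(1)) _ _ _ _ A3)).
  apply (isCI_ext _ (fun x => Ci * RtoC (2 * eta / ((x - a) ^ 2 + eta ^ 2)))%C _ _ _ La) in E1.
  2:{ intros t _. specialize (Hp (t - a)).
      unfold Cinv, RtoC, Ci, Cminus, Cplus, Cmult, Copp; simpl; f_equal; field; simpl in Hp; repeat split; nra. }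
  apply (isCI_ext _ (fun x => RtoC (2 * eta / ((x - b) ^ 2 + eta ^ 2)))%C _ _ _ Lb) in E2.
  2:{ intros t _. specialize (Hp (t - b)).
      unfold Cinv, RtoC, Ci, Cminus, Cplus, Cmult, Copp; simpl; f_equal; field; simpl in Hp; repeat split; nra. }
  assert (K : forall c, isCI (fun x => RtoC (2 * eta / ((x - c) ^ 2 + eta ^ 2))) (c - eta) (c + eta) (RtoC PI)).
  { intros c. apply isCI_pair; simpl.
    - apply (is_RInt_ext (fun x => 2 * eta / ((x - c) ^ 2 + eta ^ 2))); [intros; simpl; reflexivity|].
      apply is_RInt_atan; auto.
    - refine (eq_rect _ (fun l => is_RInt _ _ _ l) (is_RInt_const (V := R_NormedModule) _ _ 0) _ _).
      unfold scal; simpl; unfold mult; simpl; ring. }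
  pose proof (isCI_unique _ _ _ _ E1) as U1. rewrite (isCI_unique _ _ _ _ (isCI_mult Ci _ _ _ _ (K a))) in U1.
  pose proof (isCI_unique _ _ _ _ E2) as U2. rewrite (isCI_unique _ _ _ _ (K b)) in U2.
  unfold Rect.
  replace (2 * PI * Ci)%C with (Ci * PI + Ci * PI)%C by ring.
  rewrite U1 at 1. rewrite U2. ring.
Qed.

Definition inv_2pi_i : C := (/ (2 * PI * Ci))%C.

Lemma Ci_neq_0 : Ci <> 0%C.
Proof. apply pair_neq_im. simpl. lra. Qed.

Lemma two_pi_i_neq_0 : (2 * PI * Ci)%C <> 0%C.
Proof.
  apply Cmult_neq_0; [apply Cmult_neq_0|apply Ci_neq_0]; apply pair_neq_re; simpl; [lra|].
  pose proof PI_RGT_0. lra.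
Qed.

Lemma inv_2pi_i_small : Cmod inv_2pi_i <= 1.
Proof.
  unfold inv_2pi_i. rewrite Cmod_inv by apply two_pi_i_neq_0. rewrite !Cmod_mult, Cmod_Ci, !Cmod_R.
  pose proof PI2_1. rewrite !Rabs_pos_eq by lra. apply Rle_trans with (/ 1); [apply Rinv_le_contravar; lra|rewrite Rinv_1; lra].
Qed.

(** F(s) / (s - z) is the difference quotient [Q] plus F(z) / (s - z). Since [Q] is bounded near
    [z], its integral over shrinking squares tends to zero; the other term gives the winding
    integral. *)
Lemma cauchy_formula (F : C -> C) (x0 x1 y0 y1 : R) (z : C) :
  x0 < fst z < x1 -> y0 < snd z < y1 ->
  (forall s, in_rect x0 x1 y0 y1 s -> cdiff F s) ->
  (inv_2pi_i * Rect (fun s => F s / (s - z)) x0 x1 y0 y1)%C = F z.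
Proof.
  intros Hx Hy HF.
  set (rho := Rmin (Rmin (fst z - x0) (x1 - fst z)) (Rmin (snd z - y0) (y1 - snd z))).
  assert (Hrho : 0 < rho) by (unfold rho; repeat apply Rmin_pos; lra).
  assert (Hr : rho <= fst z - x0 /\ rho <= x1 - fst z /\ rho <= snd z - y0 /\ rho <= y1 - snd z).
  { unfold rho. pose proof (Rmin_l (Rmin (fst z - x0) (x1 - fst z)) (Rmin (snd z - y0) (y1 - snd z))).
    pose proof (Rmin_r (Rmin (fst z - x0) (x1 - fst z)) (Rmin (snd z - y0) (y1 - snd z))).
    pose proof (Rmin_l (fst z - x0) (x1 - fst z)). pose proof (Rmin_r (fst z - x0) (x1 - fst z)).
    pose proof (Rmin_l (snd z - y0) (y1 - snd z)). pose proof (Rmin_r (snd z - y0) (y1 - snd z)). lra. }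
  clearbody rho.
  assert (Hne : forall s, s <> z -> (s - z)%C <> 0%C).
  { intros s Hs E. apply Hs. replace s with ((s - z) + z)%C by ring. rewrite E. ring. }
  set (Q := fun s => ((F s - F z) / (s - z))%C).
  assert (HQ : forall s, in_rect x0 x1 y0 y1 s -> s <> z -> cdiff Q s).
  { intros s Hs Hsz. apply cdiff_div; auto; apply cdiff_minus; auto using cdiff_const, cdiff_id. }
  assert (HI : forall s, s <> z -> cdiff (fun s => / (s - z))%C s).
  { intros s Hs. apply cdiff_inv; auto. apply cdiff_minus; auto using cdiff_const, cdiff_id. }
  assert (HS : forall s, on_sides x0 x1 y0 y1 s -> s <> z /\ in_rect x0 x1 y0 y1 s).
  { intros s Hs. split; [|apply on_sides_in_rect; auto; lra].
    intros ->. destruct Hs as [[_ ?]|[_ ?]]; lra. }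
  assert (HQ0 : Rect Q x0 x1 y0 y1 = 0%C).
  { destruct (HF z) as [phi [Hphi [d [Hd Hloc]]]]; [unfold in_rect; lra|].
    destruct (ccont_bounded _ _ Hphi) as [d' [Hd' Hb]].
    set (M := Cmod (phi z) + 1) in *. assert (HM : 0 < M) by (pose proof (Cmod_ge_0 (phi z)); unfold M; lra).
    apply Cmod_eq_0. apply Rle_antisym; [|apply Cmod_ge_0].
    apply le_epsilon. intros e He. rewrite Rplus_0_l.
    (* The square has perimeter 8 eta, whence e / (8 M); its points lie within 2 eta of [z], whence
       d / 4 and d' / 4. *)
    set (eta := Rmin rho (Rmin (Rmin (d / 4) (d' / 4)) (e / (8 * M)))).
    assert (Heta : 0 < eta).
    { unfold eta. repeat apply Rmin_pos; try lra. apply Rdiv_lt_0_compat; lra. }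
    assert (He2 : eta <= rho /\ eta <= d / 4 /\ eta <= d' / 4 /\ eta <= e / (8 * M)).
    { unfold eta. pose proof (Rmin_l rho (Rmin (Rmin (d / 4) (d' / 4)) (e / (8 * M)))).
      pose proof (Rmin_r rho (Rmin (Rmin (d / 4) (d' / 4)) (e / (8 * M)))).
      pose proof (Rmin_l (Rmin (d / 4) (d' / 4)) (e / (8 * M))). pose proof (Rmin_r (Rmin (d / 4) (d' / 4)) (e / (8 * M))).
      pose proof (Rmin_l (d / 4) (d' / 4)). pose proof (Rmin_r (d / 4) (d' / 4)). lra. }
    clearbody eta.
    rewrite (Rect_puncture Q x0 x1 y0 y1 eta z) by (try lra; auto).
    assert (Hin : forall s, on_sides (fst z - eta) (fst z + eta) (snd z - eta) (snd z + eta) s ->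
       s <> z /\ in_rect x0 x1 y0 y1 s /\ Cmod (s - z) <= 2 * eta).
    { intros s Hs. split; [|split].
      - intros ->. destruct Hs as [[_ ?]|[_ ?]]; lra.
      - apply on_sides_in_rect in Hs; try lra. unfold in_rect in *. lra.
      - apply on_sides_in_rect in Hs; try lra. unfold in_rect in *.
        eapply Rle_trans; [apply Cmod_le_abs|]. simpl.
        assert (Rabs (fst s + - fst z) <= eta) by (apply Rabs_le; lra).
        assert (Rabs (snd s + - snd z) <= eta) by (apply Rabs_le; lra). lra. }
    eapply Rle_trans.
    - apply (Rect_bound Q _ _ _ _ M); try lra.
      + intros s Hs. destruct (Hin s Hs) as [? [? ?]]. apply cdiff_ccont; auto.
      + intros s Hs. destruct (Hin s Hs) as [Hsz [_ Hsd]]. unfold Q.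
        rewrite (Hloc s) by lra.
        replace ((F z + phi s * (s - z) - F z) / (s - z))%C with (phi s) by (field; auto).
        apply Hb. lra.
    - replace (2 * (fst z + eta - (fst z - eta) + (snd z + eta - (snd z - eta))) * M) with (8 * M * eta) by ring.
      apply Rle_trans with (8 * M * (e / (8 * M))); [apply Rmult_le_compat_l; lra|right; field; lra]. }
  rewrite (Rect_ext _ (fun s => Q s + F z * / (s - z))%C); try lra.
  2:{ intros s Hs. destruct (HS s Hs) as [Hsz _]. unfold Q. field. auto. }
  rewrite (Rect_plus Q (fun s => F z * / (s - z))%C); try lra.
  2:{ intros s Hs. destruct (HS s Hs). apply cdiff_ccont; auto. }
  2:{ intros s Hs. destruct (HS s Hs). apply ccont_mult; [apply ccont_const|]. apply cdiff_ccont; auto. }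
  rewrite (Rect_mult (F z) (fun s => / (s - z))%C); try lra.
  2:{ intros s Hs. destruct (HS s Hs). apply cdiff_ccont; auto. }
  rewrite HQ0, (Rect_puncture (fun s => / (s - z))%C x0 x1 y0 y1 rho z) by (try lra; auto).
  rewrite Rect_winding_square by auto. unfold inv_2pi_i. field.
  split; [apply Ci_neq_0|]. apply pair_neq_re; simpl. pose proof PI_RGT_0. lra.
Qed.

Lemma Cmod_ge_fst (z : C) : Rabs (fst z) <= Cmod z.
Proof. eapply Rle_trans; [|apply Rmax_Cmod]. apply Rmax_l. Qed.

Lemma Cmod_ge_snd (z : C) : Rabs (snd z) <= Cmod z.
Proof. eapply Rle_trans; [|apply Rmax_Cmod]. apply Rmax_r. Qed.

Lemma Cmod_sides_ge (r : R) (s : C) : 0 < r -> on_sides (- r) r (- r) r s -> r <= Cmod s.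
Proof.
  intros Hr [[_ H]|[_ H]].
  - eapply Rle_trans; [|apply Cmod_ge_snd]. destruct H as [-> | ->]; [rewrite Rabs_Ropp|]; rewrite Rabs_pos_eq; lra.
  - eapply Rle_trans; [|apply Cmod_ge_fst]. destruct H as [-> | ->]; [rewrite Rabs_Ropp|]; rewrite Rabs_pos_eq; lra.
Qed.

Lemma Cmod_rect_le (r : R) (s : C) : 0 < r -> in_rect (- r) r (- r) r s -> Cmod s < 2 * r.
Proof.
  intros Hr [H1 H2]. eapply Rle_lt_trans; [apply Cmod_2Rmax|].
  assert (Rmax (Rabs (fst s)) (Rabs (snd s)) <= r) by (apply Rmax_lub; apply Rabs_le; auto).
  assert (Hs : sqrt 2 < 2). { rewrite <- (sqrt_Rsqr 2) at 2 by lra. apply sqrt_lt_1; unfold Rsqr; lra. }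
  assert (0 <= sqrt 2) by apply sqrt_pos.
  assert (0 <= Rmax (Rabs (fst s)) (Rabs (snd s))). { eapply Rle_trans; [apply Rabs_pos|apply Rmax_l]. }
  nra.
Qed.

(** * Estimates stable under limits and integrals *)

Definition holo_disc (F : C -> C) (R0 M : R) : Prop :=
  forall z, Cmod z < R0 -> cdiff F z /\ Cmod (F z) <= M.

Lemma Cmod_minus_ge (s z : C) : Cmod s - Cmod z <= Cmod (s - z).
Proof.
  assert (Cmod s <= Cmod (s - z) + Cmod z); [|lra].
  replace s with ((s - z) + z)%C at 1 by ring. apply Cmod_triangle.
Qed.

Lemma Cmod_minus_sym (s z : C) : Cmod (s - z) = Cmod (z - s).
Proof. replace (s - z)%C with (- (z - s))%C by ring. apply Cmod_opp. Qed.

(** All values of [F] are represented over one square of perimeter 4 R0, so a combination of values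
    costs only the supremum of the same combination of Cauchy kernels. The Lipschitz and slope
    estimates are two choices of coefficients for which the kernels cancel. *)
Lemma cauchy_combo_bound (F : C -> C) (R0 M : R) (c1 c2 c3 z1 z2 : C) (k : R) :
  0 < R0 -> holo_disc F R0 M -> Cmod z1 < R0 / 4 -> Cmod z2 < R0 / 4 ->
  (forall s, R0 / 2 <= Cmod s -> R0 / 4 <= Cmod (s - z1) -> R0 / 4 <= Cmod (s - z2) ->
     Cmod (c1 / (s - z1) + c2 / (s - z2) + c3 / s) <= k) ->
  Cmod (c1 * F z1 + c2 * F z2 + c3 * F 0%C) <= 4 * R0 * (M * k).
Proof.
  intros HR HF H1 H2 Hk. set (r := R0 / 2). assert (Hr : 0 < r) by (unfold r; lra).
  assert (Hin : forall s, in_rect (- r) r (- r) r s -> cdiff F s /\ Cmod (F s) <= M).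
  { intros s Hs. apply HF. pose proof (Cmod_rect_le r s Hr Hs). unfold r in *. lra. }
  assert (Hsd : forall s, on_sides (- r) r (- r) r s -> cdiff F s /\ Cmod (F s) <= M).
  { intros s Hs. apply Hin. apply on_sides_in_rect; auto; lra. }
  assert (HC : forall z, Cmod z < R0 / 4 -> (inv_2pi_i * Rect (fun s => F s / (s - z)) (- r) r (- r) r)%C = F z).
  { intros z Hz. pose proof (Cmod_ge_fst z) as G1. pose proof (Cmod_ge_snd z) as G2.
    assert (A1 : Rabs (fst z) < r) by (unfold r; lra). assert (A2 : Rabs (snd z) < r) by (unfold r; lra).
    apply Rabs_lt_between in A1. apply Rabs_lt_between in A2.
    apply cauchy_formula; [lra|lra|]. intros s Hs. apply Hin, Hs. }
  assert (Hge : forall s z, on_sides (- r) r (- r) r s -> Cmod z < R0 / 4 -> R0 / 4 <= Cmod (s - z)).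
  { intros s z Hs Hz. pose proof (Cmod_sides_ge r s Hr Hs). pose proof (Cmod_minus_ge s z). unfold r in *. lra. }
  assert (Hne : forall s z, on_sides (- r) r (- r) r s -> Cmod z < R0 / 4 -> (s - z)%C <> 0%C).
  { intros s z Hs Hz. apply Cmod_gt_0. specialize (Hge s z Hs Hz). lra. }
  assert (H0 : Cmod 0%C < R0 / 4) by (rewrite Cmod_0; lra).
  assert (Hcc : forall z, Cmod z < R0 / 4 -> forall s, on_sides (- r) r (- r) r s -> ccont (fun s => F s / (s - z))%C s).
  { intros z Hz s Hs. apply cdiff_ccont. apply cdiff_div; [apply Hsd, Hs| |apply Hne; auto].
    apply cdiff_minus; auto using cdiff_id, cdiff_const. }
  rewrite <- (HC z1), <- (HC z2), <- (HC 0%C) by auto.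
  set (K := fun s => (c1 * (F s / (s - z1)) + (c2 * (F s / (s - z2)) + c3 * (F s / (s - 0))))%C).
  assert (E : (c1 * (inv_2pi_i * Rect (fun s => F s / (s - z1)) (- r) r (- r) r) + c2 * (inv_2pi_i * Rect (fun s => F s / (s - z2)) (- r) r (- r) r)
     + c3 * (inv_2pi_i * Rect (fun s => F s / (s - 0)) (- r) r (- r) r))%C = (inv_2pi_i * Rect K (- r) r (- r) r)%C).
  { unfold K. rewrite Rect_plus; try lra.
    2:{ intros s Hs. apply ccont_mult; [apply ccont_const|apply Hcc; auto]. }
    2:{ intros s Hs. apply ccont_plus; apply ccont_mult; try apply ccont_const; apply Hcc; auto. }
    rewrite Rect_plus; try lra.
    2:{ intros s Hs. apply ccont_mult; [apply ccont_const|apply Hcc; auto]. }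
    2:{ intros s Hs. apply ccont_mult; [apply ccont_const|apply Hcc; auto]. }
    rewrite !Rect_mult; try lra; try (apply Hcc; auto). ring. }
  rewrite E, Cmod_mult.
  assert (HB : Cmod (Rect K (- r) r (- r) r) <= 2 * ((r - - r) + (r - - r)) * (M * k)).
  { apply Rect_bound; try lra.
    - intros s Hs. unfold K. repeat apply ccont_plus; apply ccont_mult; try apply ccont_const; apply Hcc; auto.
    - intros s Hs. unfold K.
      pose proof (Cmod_sides_ge r s Hr Hs) as Hsr.
      assert (Hs0 : s <> 0%C) by (apply Cmod_gt_0; lra).
      pose proof (Hne s z1 Hs H1). pose proof (Hne s z2 Hs H2).
      replace (c1 * (F s / (s - z1)) + (c2 * (F s / (s - z2)) + c3 * (F s / (s - 0))))%C
        with (F s * (c1 / (s - z1) + c2 / (s - z2) + c3 / s))%C by (field; auto).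
      rewrite Cmod_mult. apply Rmult_le_compat; try apply Cmod_ge_0; [apply Hsd; auto|].
      apply Hk; auto. }
  replace (2 * (r - - r + (r - - r))) with (4 * R0) in HB by (unfold r; field).
  pose proof inv_2pi_i_small. pose proof (Cmod_ge_0 inv_2pi_i). pose proof (Cmod_ge_0 (Rect K (- r) r (- r) r)). nra.
Qed.

Lemma inv_le (a b : R) : 0 < a -> a <= b -> / b <= / a.
Proof. intros. apply Rinv_le_contravar; auto. Qed.

Lemma holo_lipschitz (F : C -> C) (R0 M : R) (z : C) :
  0 < R0 -> holo_disc F R0 M -> Cmod z < R0 / 4 ->
  Cmod (F z - F 0%C) <= 32 * M / R0 * Cmod z.
Proof.
  intros HR HF Hz.
  replace (F z - F 0%C)%C with (1 * F z + 0 * F z + -(1) * F 0%C)%C by ring.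
  replace (32 * M / R0 * Cmod z) with (4 * R0 * (M * (8 / (R0 * R0) * Cmod z))) by (field; lra).
  apply (cauchy_combo_bound F R0 M); auto.
  intros s H1 H2 _.
  assert (s <> 0%C) by (apply Cmod_gt_0; lra). assert ((s - z)%C <> 0%C) by (apply Cmod_gt_0; lra).
  replace (1 / (s - z) + 0 / (s - z) + - (1) / s)%C with (z * (/ s * / (s - z)))%C by (field; auto).
  rewrite !Cmod_mult, !Cmod_inv by auto. rewrite (Rmult_comm (Cmod z)).
  apply Rmult_le_compat_r; [apply Cmod_ge_0|].
  replace (8 / (R0 * R0)) with (/ (R0 / 2) * / (R0 / 4)) by (field; lra).
  apply Rmult_le_compat; try (left; apply Rinv_0_lt_compat; lra); apply inv_le; lra.
Qed.

(** Lipschitz continuity of the quotient (F z - F 0) / z, with denominators cleared. Only finitely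
    many values of [F] occur, so the estimate survives pointwise limits and integration, and it
    still implies differentiability at 0. *)
Definition slope_estimate (F : C -> C) (R0 K : R) : Prop := forall z z', Cmod z < R0 / 4 -> Cmod z' < R0 / 4 ->
  Cmod (z' * (F z - F 0%C) - z * (F z' - F 0%C)) <= K * (Cmod z * Cmod z' * Cmod (z - z')).

Lemma holo_slope_estimate (F : C -> C) (R0 M : R) : 0 < R0 -> holo_disc F R0 M -> slope_estimate F R0 (128 * M / (R0 * R0)).
Proof.
  intros HR HF z z' Hz Hz'.
  replace (z' * (F z - F 0%C) - z * (F z' - F 0%C))%C with (z' * F z + (- z) * F z' + (z - z') * F 0%C)%C by ring.
  replace (128 * M / (R0 * R0) * (Cmod z * Cmod z' * Cmod (z - z'))) with
    (4 * R0 * (M * (Cmod z * Cmod z' * Cmod (z - z') * (32 / (R0 * R0 * R0))))) by (field; lra).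
  apply (cauchy_combo_bound F R0 M); auto.
  intros s H1 H2 H3.
  assert (s <> 0%C) by (apply Cmod_gt_0; lra). assert ((s - z)%C <> 0%C) by (apply Cmod_gt_0; lra).
  assert ((s - z')%C <> 0%C) by (apply Cmod_gt_0; lra).
  replace (z' / (s - z) + - z / (s - z') + (z - z') / s)%C with (z * z' * (z - z') * (/ s * / (s - z) * / (s - z')))%C by (field; auto).
  rewrite !Cmod_mult, !Cmod_inv by auto.
  apply Rmult_le_compat_l; [repeat apply Rmult_le_pos; apply Cmod_ge_0|].
  replace (32 / (R0 * R0 * R0)) with (/ (R0 / 2) * / (R0 / 4) * / (R0 / 4)) by (field; lra).
  assert (forall a, 0 < a -> 0 <= / a) by (intros; left; apply Rinv_0_lt_compat; auto).
  repeat apply Rmult_le_compat; try apply Rmult_le_pos; try (apply H5; lra); try (apply inv_le; lra);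
  try (left; apply Rinv_0_lt_compat; lra).
Qed.

(** The quotients along a sequence tending to 0 are bounded, an ultrafilter on the integers supplies
    a limit [l], and the Lipschitz bound compares every other quotient with it. *)
Lemma slope_estimate_derivative (F : C -> C) (R0 K : R) : 0 < R0 -> 0 <= K -> slope_estimate F R0 K ->
  exists l, forall z, Cmod z < R0 / 4 -> Cmod (F z - F 0%C - z * l) <= K * (Cmod z * Cmod z).
Proof.
  intros HR HK HS.
  destruct (ultrafilter_extends (fun A : nat -> Prop => exists N, A = (fun n => (N <= n)%nat))) as [U [HU HUt]].
  { exists (fun n => (0 <= n)%nat), 0%nat. reflexivity. }
  { intros A [N ->]. exists N. lia. }
  { intros A B [N ->] [N' ->]. exists (fun n => (Nat.max N N' <= n)%nat). split; [eexists; reflexivity|]. intros i Hi. lia. }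
  set (t := fun n : nat => R0 / 8 * / INR (S n)).
  assert (Ht0 : forall n, 0 < t n <= R0 / 8).
  { intros n. assert (1 <= INR (S n)) by (rewrite S_INR; pose proof (pos_INR n); lra).
    assert (0 < / INR (S n)) by (apply Rinv_0_lt_compat; lra).
    assert (/ INR (S n) <= / 1) by (apply inv_le; lra). rewrite Rinv_1 in H1. unfold t. split; [apply Rmult_lt_0_compat; lra|nra]. }
  assert (HtC : forall n, Cmod (t n) = t n) by (intros n; rewrite Cmod_R, Rabs_pos_eq; [auto|apply Rlt_le, Ht0]).
  assert (Htn : forall n, RtoC (t n) <> 0%C) by (intros n; apply Cmod_gt_0; rewrite HtC; apply Ht0).
  set (q := fun z : C => ((F z - F 0%C) / z)%C).
  assert (Hq : forall z z' : C, z <> 0%C -> z' <> 0%C -> Cmod z < R0 / 4 -> Cmod z' < R0 / 4 -> Cmod (q z - q z') <= K * Cmod (z - z')).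
  { intros z z' Hz Hz' L L'. specialize (HS z z' L L'). unfold q.
    replace ((F z - F 0%C) / z - (F z' - F 0%C) / z')%C with ((z' * (F z - F 0%C) - z * (F z' - F 0%C)) * / (z * z'))%C by (field; split; [exact Hz'|exact Hz]).
    rewrite Cmod_mult, Cmod_inv, Cmod_mult by (apply Cmult_neq_0; auto).
    apply Cmod_gt_0 in Hz. apply Cmod_gt_0 in Hz'.
    replace (K * Cmod (z - z')) with (K * (Cmod z * Cmod z' * Cmod (z - z')) * / (Cmod z * Cmod z')) by (field; lra).
    apply Rmult_le_compat_r; auto. left. apply Rinv_0_lt_compat. nra. }
  destruct (ulim_exists HU (fun n => q (t n)) (Cmod (q (t 0%nat)) + K * (R0 / 4))) as [l Hl].
  { apply (ultra_all HU). intros n. replace (q (t n)) with (q (t 0%nat) + (q (t n) - q (t 0%nat)))%C by ring.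
    eapply Rle_trans; [apply Cmod_triangle|]. apply Rplus_le_compat_l.
    eapply Rle_trans; [apply Hq; auto; rewrite HtC; pose proof (Ht0 n); pose proof (Ht0 0%nat); lra|].
    apply Rmult_le_compat_l; auto. unfold Cminus. eapply Rle_trans; [apply Cmod_triangle|].
    rewrite Cmod_opp, !HtC. pose proof (Ht0 n). pose proof (Ht0 0%nat). lra. }
  exists l. intros z Hz.
  destruct (Ceq_dec z 0%C) as [->|Hz0].
  { replace (F 0%C - F 0%C - 0 * l)%C with (RtoC 0) by ring. rewrite Cmod_0. lra. }
  assert (Hlim : Cmod (q z - l) <= K * Cmod z).
  { apply le_epsilon. intros e He.
    assert (He2 : 0 < e / (K + 1)) by (apply Rdiv_lt_0_compat; lra).
    apply (is_ulim_le HU (fun n => q z - q (t n))%C).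
    2:{ apply (is_ulim_minus HU); [apply (is_ulim_const HU)|exact Hl]. }
    assert (Hlt : exists N, t N < e / (K + 1)).
    { destruct (archimed_cor1 (e / (K + 1) / (R0 / 8))) as [N [HN HN0]].
      { apply Rdiv_lt_0_compat; lra. }
      exists N. unfold t. apply Rlt_trans with (R0 / 8 * / INR N).
      - apply Rmult_lt_compat_l; [lra|]. apply Rinv_lt_contravar; [apply Rmult_lt_0_compat; apply lt_0_INR; lia|apply lt_INR; lia].
      - replace (e / (K + 1)) with (R0 / 8 * (e / (K + 1) / (R0 / 8))) by (field; lra). apply Rmult_lt_compat_l; lra. }
    destruct Hlt as [N HN]. apply (ultra_mp HU (fun n => (N <= n)%nat)); [apply HUt; eexists; reflexivity|].
    intros n Hn.
    assert (Hmon : t n <= t N).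
    { unfold t. apply Rmult_le_compat_l; [lra|]. apply inv_le; [apply lt_0_INR; lia|apply le_INR; lia]. }
    eapply Rle_trans; [apply Hq; auto; rewrite HtC; specialize (Ht0 n); lra|].
    apply Rle_trans with (K * (Cmod z + t n)).
    - apply Rmult_le_compat_l; auto. unfold Cminus. eapply Rle_trans; [apply Cmod_triangle|]. rewrite Cmod_opp, HtC. lra.
    - assert (K * t n <= e); [|lra]. apply Rle_trans with ((K + 1) * (e / (K + 1))); [|right; field; lra].
      specialize (Ht0 n). apply Rmult_le_compat; lra. }
  replace (F z - F 0%C - z * l)%C with (z * (q z - l))%C by (unfold q; field; auto).
  rewrite Cmod_mult. pose proof (Cmod_ge_0 z). nra.
Qed.

Lemma little_o_cdiff (G : C -> C) (l : C) :
  (forall e, 0 < e -> exists d, 0 < d /\ forall z, Cmod z < d -> Cmod (G z - G 0%C - z * l) <= e * Cmod z) -> cdiff G 0%C.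
Proof.
  intros H. exists (fun z => if Ceq_dec z 0%C then l else ((G z - G 0%C) / z)%C). split.
  - intros e He. destruct (H (e / 2) ltac:(lra)) as [d [Hd H']]. exists d. split; auto.
    intros z Hz. replace (z - 0)%C with z in Hz by ring.
    destruct (Ceq_dec 0%C 0%C) as [_|n]; [|congruence].
    destruct (Ceq_dec z 0%C) as [_|Hz0].
    { replace (l - l)%C with (RtoC 0) by ring. rewrite Cmod_0. auto. }
    specialize (H' z Hz).
    replace ((G z - G 0%C) / z - l)%C with ((G z - G 0%C - z * l) * / z)%C by (field; auto).
    rewrite Cmod_mult, Cmod_inv by auto. apply Cmod_gt_0 in Hz0.
    apply Rle_lt_trans with (e / 2 * Cmod z * / Cmod z).
    { apply Rmult_le_compat_r; auto. left. apply Rinv_0_lt_compat; auto. }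
    replace (e / 2 * Cmod z * / Cmod z) with (e / 2) by (field; lra). lra.
  - exists 1. split; [lra|]. intros z _. destruct (Ceq_dec z 0%C) as [->|Hz]; [ring|field; auto].
Qed.

Lemma quadratic_cdiff (F : C -> C) (l : C) (r K : R) : 0 < r -> 0 <= K ->
  (forall z, Cmod z < r -> Cmod (F z - F 0%C - z * l) <= K * (Cmod z * Cmod z)) -> cdiff F 0%C.
Proof.
  intros Hr HK H. apply (little_o_cdiff F l). intros e He.
  assert (Hq : 0 < e / (K + 1)) by (apply Rdiv_lt_0_compat; lra).
  exists (Rmin r (e / (K + 1))). split; [apply Rmin_pos; auto|]. intros z Hz.
  pose proof (Rmin_l r (e / (K + 1))). pose proof (Rmin_r r (e / (K + 1))). pose proof (Cmod_ge_0 z).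
  eapply Rle_trans; [apply H; lra|]. rewrite <- Rmult_assoc. apply Rmult_le_compat_r; auto.
  apply Rle_trans with ((K + 1) * (e / (K + 1))); [|right; field; lra].
  apply Rmult_le_compat; lra.
Qed.

Lemma slope_estimate_cdiff (F : C -> C) (R0 K : R) : 0 < R0 -> 0 <= K -> slope_estimate F R0 K -> cdiff F 0%C.
Proof.
  intros HR HK HS. destruct (slope_estimate_derivative F R0 K HR HK HS) as [l Hl].
  apply (quadratic_cdiff F l (R0 / 4) K); auto. lra.
Qed.

(** This replaces the theorems of Weierstrass and Montel: the slope constant depends only on [R0]
    and [M], so pointwise convergence along the ultrafilter is enough. *)
Lemma cdiff_ulim {I : Type} {U : (I -> Prop) -> Prop} (HU : ultrafilter U) (F : I -> C -> C) (G : C -> C) (R0 M : R) :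
  0 < R0 -> 0 <= M -> U (fun i => holo_disc (F i) R0 M) ->
  (forall z, Cmod z < R0 -> is_ulim (U := U) (fun i => F i z) (G z)) -> cdiff G 0%C.
Proof.
  intros HR HM HF HG. apply (slope_estimate_cdiff G R0 (128 * M / (R0 * R0))); auto.
  { apply Rmult_le_pos; [lra|]. left. apply Rinv_0_lt_compat. nra. }
  intros z z' Hz Hz'.
  apply (is_ulim_le HU (fun i => z' * (F i z - F i 0%C) - z * (F i z' - F i 0%C))%C).
  - apply (ultra_mp HU _ _ HF). intros i Hi. apply (holo_slope_estimate (F i) R0 M HR Hi); auto.
  - assert (Cmod 0 < R0) by (rewrite Cmod_0; auto).
    apply (is_ulim_minus HU); apply (is_ulim_mult HU); try apply (is_ulim_const HU);
      apply (is_ulim_minus HU); apply HG; auto; lra.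
Qed.

(** Differentiation under the integral sign, obtained by integrating the slope estimate instead of
    the derivative. *)
Lemma cdiff_integral (f : R -> C -> C) (G : C -> C) (a b R0 M : R) :
  a <= b -> 0 < R0 -> 0 <= M -> (forall t, a <= t <= b -> holo_disc (f t) R0 M) ->
  (forall z, Cmod z < R0 -> isCI (fun t => f t z) a b (G z)) -> cdiff G 0%C.
Proof.
  intros Hab HR HM HF HG.
  assert (Hk : 0 <= 128 * M / (R0 * R0)) by (apply Rmult_le_pos; [lra|left; apply Rinv_0_lt_compat; nra]).
  apply (slope_estimate_cdiff G R0 ((b - a) * (128 * M / (R0 * R0)))); auto.
  { apply Rmult_le_pos; lra. }
  intros z z' Hz Hz'. rewrite Rmult_assoc.
  assert (H0 : Cmod 0 < R0) by (rewrite Cmod_0; auto).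
  assert (I0 := HG 0%C H0). assert (I1 := HG z ltac:(lra)). assert (I2 := HG z' ltac:(lra)).
  assert (I3 := isCI_plus _ _ _ _ _ _ (isCI_plus _ _ _ _ _ _ (isCI_mult z' _ _ _ _ I1) (isCI_mult (- z) _ _ _ _ I2)) (isCI_mult (z - z')%C _ _ _ _ I0)).
  replace (z' * (G z - G 0%C) - z * (G z' - G 0%C))%C with (z' * G z + - z * G z' + (z - z') * G 0%C)%C by ring.
  eapply isCI_bound; [apply Hab| |apply I3].
  intros t Ht. cbn beta.
  replace (z' * f t z + - z * f t z' + (z - z') * f t 0%C)%C with (z' * (f t z - f t 0%C) - z * (f t z' - f t 0%C))%C by ring.
  apply (holo_slope_estimate (f t) R0 M HR (HF t Ht)); auto.
Qed.

(** * Functions holomorphic along complex lines *)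

Definition line {K : Type} (v : K -> C) (z : C) (u : K -> C) : K -> C := fun k => (v k + z * u k)%C.

Definition unit_ball {K : Type} (op : (K -> Prop) -> Prop) (v : K -> C) : Prop :=
  continuousC op v /\ exists r, r < 1 /\ forall k, Cmod (v k) <= r.

(** Gateaux holomorphy, tested at the centre of each line; [ghol_line] moves the centre. Functions
    are defined on all of [K -> C] with the domain as a predicate, so arguments carry no continuity
    proofs. *)
Definition ghol {K : Type} (op : (K -> Prop) -> Prop) (Om : (K -> C) -> Prop) (F : (K -> C) -> C) : Prop :=
  forall v u : K -> C, Om v -> continuousC op u -> cdiff (fun z => F (line v z u)) 0%C.

Definition bounded_on {K : Type} (Om : (K -> C) -> Prop) (F : (K -> C) -> C) (M : R) : Prop :=
  forall v, Om v -> Cmod (F v) <= M.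

Definition has_radius {K : Type} (op : (K -> Prop) -> Prop) (Om : (K -> C) -> Prop) (v : K -> C) (r : R) : Prop :=
  0 < r /\ forall h : K -> C, continuousC op h -> (forall k, Cmod (h k) <= r) -> Om (fun k => (v k + h k)%C).

Definition gopen {K : Type} (op : (K -> Prop) -> Prop) (Om : (K -> C) -> Prop) : Prop :=
  forall v, Om v -> exists r, has_radius op Om v r.

Definition restrict {K : Type} {op : (K -> Prop) -> Prop} (F : (K -> C) -> C) : Bset op -> C :=
  fun b => F (proj1_sig (proj1_sig b)).

(** The value 0 off the ball is a filler: every later use evaluates inside the ball. *)
Definition extend {K : Type} {op : (K -> Prop) -> Prop} (f : Bset op -> C) (v : K -> C) : C :=
  match excluded_middle_informative (exists b : Bset op, proj1_sig (proj1_sig b) = v) with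
  | left H => f (proj1_sig (constructive_indefinite_description _ H))
  | right _ => 0%C
  end.

Lemma line_0 {K : Type} (v u : K -> C) : line v 0%C u = v.
Proof. apply functional_extensionality. intros k. unfold line. ring. Qed.

Lemma line_line {K : Type} (v u : K -> C) (z w : C) : line (line v z u) w u = line v (z + w) u.
Proof. apply functional_extensionality. intros k. unfold line. ring. Qed.

Section Space.
Context {K : Type} {op : (K -> Prop) -> Prop} (Htop : is_topology op).

Lemma op_and (A B : K -> Prop) : op A -> op B -> op (fun x => A x /\ B x).
Proof. apply Htop. Qed.

Lemma cont_const (c : C) : continuousC op (fun _ => c).
Proof.
  intros k e He. exists (fun _ => True). split; [apply Htop|]. split; auto. intros k' _.
  change (Cmod (c - c)%C < e). replace (c - c)%C with (RtoC 0) by ring. rewrite Cmod_0. auto.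
Qed.

Lemma cont_plus (u v : K -> C) : continuousC op u -> continuousC op v -> continuousC op (fun k => (u k + v k)%C).
Proof.
  intros Hu Hv k e He. destruct (Hu k (e/2) ltac:(lra)) as [A [HA [Ak HA']]]. destruct (Hv k (e/2) ltac:(lra)) as [B [HB [Bk HB']]].
  exists (fun x => A x /\ B x). split; [apply op_and; auto|]. split; auto. intros k' [a b].
  specialize (HA' k' a). specialize (HB' k' b).
  change (Cmod ((u k' + v k') - (u k + v k))%C < e). change (Cmod (u k' - u k)%C < e/2) in HA'. change (Cmod (v k' - v k)%C < e/2) in HB'.
  replace (u k' + v k' - (u k + v k))%C with ((u k' - u k) + (v k' - v k))%C by ring.
  eapply Rle_lt_trans; [apply Cmod_triangle|]. lra.
Qed.

Lemma cont_scal (c : C) (u : K -> C) : continuousC op u -> continuousC op (fun k => (c * u k)%C).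
Proof.
  intros Hu k e He. pose proof (Cmod_ge_0 c).
  destruct (Hu k (e/(Cmod c + 1))) as [A [HA [Ak HA']]]; [apply Rdiv_lt_0_compat; lra|].
  exists A. split; auto. split; auto. intros k' a. specialize (HA' k' a).
  change (Cmod ((c * u k') - (c * u k))%C < e). change (Cmod (u k' - u k)%C < e/(Cmod c + 1)) in HA'.
  replace (c * u k' - c * u k)%C with (c * (u k' - u k))%C by ring. rewrite Cmod_mult.
  pose proof (Cmod_ge_0 (u k' - u k)).
  apply Rle_lt_trans with ((Cmod c + 1) * Cmod (u k' - u k)); [nra|].
  replace e with ((Cmod c + 1) * (e / (Cmod c + 1))) by (field; lra). apply Rmult_lt_compat_l; lra.
Qed.

Lemma cont_bounded (Hcpt : compact_space op) (u : K -> C) : continuousC op u -> exists M, 0 < M /\ forall k, Cmod (u k) <= M.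
Proof.
  intros Hu.
  destruct (Hcpt (fun A => op A /\ exists M, forall k, A k -> Cmod (u k) <= M)) as [l [Hl Hcov]].
  - intros A [HA _]. exact HA.
  - intros k. destruct (Hu k 1 ltac:(lra)) as [A [HA [Ak HA']]]. exists A. split; auto. split; auto.
    exists (Cmod (u k) + 1). intros k' a. specialize (HA' k' a). change (Cmod (u k' - u k)%C < 1) in HA'.
    replace (u k') with (u k + (u k' - u k))%C by ring. eapply Rle_trans; [apply Cmod_triangle|]. lra.
  - assert (H : exists M, 0 < M /\ forall A, In A l -> forall k, A k -> Cmod (u k) <= M).
    { clear Hcov. induction l as [|A l IH].
      - exists 1. split; [lra|]. intros A [].
      - destruct IH as [M [HM H]]; [intros; apply Hl; right; auto|].
        destruct (Hl A (or_introl eq_refl)) as [_ [M' H']].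
        exists (Rmax M M'). split; [eapply Rlt_le_trans; [apply HM|apply Rmax_l]|].
        intros B [<-|HB] k Hk; [eapply Rle_trans; [apply H', Hk|apply Rmax_r]|eapply Rle_trans; [apply (H B HB), Hk|apply Rmax_l]]. }
    destruct H as [M [HM H]]. exists M. split; auto. intros k. destruct (Hcov k) as [A [HA Ak]]. apply (H A HA), Ak.
Qed.

Lemma gopen_ball : gopen op (unit_ball op).
Proof.
  intros v [Hv [r [Hr Hk]]]. exists ((1 - r) / 2). split; [lra|]. intros h Hh Hb. split.
  - apply cont_plus; auto.
  - exists ((1 + r) / 2). split; [lra|]. intros k. eapply Rle_trans; [apply Cmod_triangle|].
    specialize (Hk k). specialize (Hb k). lra.
Qed.

Lemma line_radius (Om : (K -> C) -> Prop) (v h : K -> C) (r m : R) (z : C) :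
  has_radius op Om v r -> continuousC op h -> 0 < m -> (forall k, Cmod (h k) <= m) -> Cmod z <= r / m -> Om (line v z h).
Proof.
  intros [Hr H] Hh Hm Hb Hz. apply (H (fun k => (z * h k)%C)); [apply cont_scal; auto|].
  intros k. rewrite Cmod_mult. replace r with (r / m * m) by (field; lra).
  apply Rmult_le_compat; try apply Cmod_ge_0; auto.
Qed.

Lemma ghol_line (Om : (K -> C) -> Prop) (F : (K -> C) -> C) (v u : K -> C) (z : C) :
  ghol op Om F -> continuousC op u -> Om (line v z u) -> cdiff (fun z => F (line v z u)) z.
Proof.
  intros HF Hu Hz.
  assert (H := HF _ u Hz Hu).
  assert (E : (fun w => F (line v w u)) = (fun w => (fun s => F (line (line v z u) s u)) (- z + w * 1)%C)).
  { apply functional_extensionality. intros w. rewrite line_line. do 2 f_equal. ring. }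
  rewrite E. apply (cdiff_affine (fun s => F (line (line v z u) s u))). replace (- z + z * 1)%C with (RtoC 0) by ring. exact H.
Qed.

Lemma ghol_holo_disc (Om : (K -> C) -> Prop) (F : (K -> C) -> C) (v h : K -> C) (r m M : R) :
  ghol op Om F -> bounded_on Om F M -> has_radius op Om v r ->
  continuousC op h -> 0 < m -> (forall k, Cmod (h k) <= m) ->
  holo_disc (fun z => F (line v z h)) (r / m) M.
Proof.
  intros HF HM Hr Hh Hm Hb z Hz.
  assert (Om (line v z h)) by (apply (line_radius Om v h r m); auto; lra).
  split; [apply (ghol_line Om); auto|apply HM; auto].
Qed.

Lemma ghol_lipschitz (Om : (K -> C) -> Prop) (F : (K -> C) -> C) (v h : K -> C) (r m M : R) :
  ghol op Om F -> bounded_on Om F M -> has_radius op Om v r ->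
  continuousC op h -> 0 < m -> (forall k, Cmod (h k) <= m) -> m < r / 4 ->
  Cmod (F (fun k => (v k + h k)%C) - F v) <= 32 * M / r * m.
Proof.
  intros HF HM Hr Hh Hm Hb Hmr.
  pose proof (proj1 Hr) as Hr0.
  assert (Hd := ghol_holo_disc Om F v h r m M HF HM Hr Hh Hm Hb).
  (* [v + h] is the point z = 1 of the line, and m < r / 4 puts it into the disc of the Lipschitz
     estimate. *)
  assert (H1 : Cmod 1%C < r / m / 4).
  { rewrite Cmod_1. apply Rmult_lt_reg_r with m; auto. replace (r / m / 4 * m) with (r / 4) by (field; lra). lra. }
  assert (L := holo_lipschitz _ (r / m) M 1%C ltac:(apply Rdiv_lt_0_compat; auto) Hd H1).
  cbn beta in L. rewrite line_0, Cmod_1 in L.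
  replace (line v 1 h) with (fun k => (v k + h k)%C) in L by (apply functional_extensionality; intros k; unfold line; ring).
  eapply Rle_trans; [apply L|]. right. field. lra.
Qed.

Lemma bounded_on_nonneg (Om : (K -> C) -> Prop) (F : (K -> C) -> C) (v : K -> C) (M : R) :
  bounded_on Om F M -> Om v -> 0 <= M.
Proof. intros H Hv. eapply Rle_trans; [apply Cmod_ge_0|apply (H v Hv)]. Qed.

(** * Linearity of the Gateaux derivative of a bounded function *)

Definition quadratic_deriv (G : C -> C) (l : C) : Prop :=
  exists A r, 0 < r /\ 0 <= A /\ forall z, Cmod z < r -> Cmod (G z - G 0%C - z * l) <= A * (Cmod z * Cmod z).

Lemma quadratic_deriv_unique (G : C -> C) (l m : C) : quadratic_deriv G l -> quadratic_deriv G m -> l = m.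
Proof.
  intros [A [r [Hr [HA H]]]] [B [s [Hs [HB H']]]].
  assert (E : (l - m)%C = 0%C).
  { apply Cmod_eq_0. apply Rle_antisym; [|apply Cmod_ge_0]. apply le_epsilon. intros e He. rewrite Rplus_0_l.
    set (t := Rmin (Rmin r s / 2) (e / (A + B + 1))).
    assert (Ht : 0 < t). { unfold t. repeat apply Rmin_pos; try lra. - pose proof (Rmin_pos r s Hr Hs). lra. - apply Rdiv_lt_0_compat; lra. }
    assert (Ht1 : t <= Rmin r s / 2) by apply Rmin_l. assert (Ht2 : t <= e / (A + B + 1)) by apply Rmin_r.
    pose proof (Rmin_l r s). pose proof (Rmin_r r s). pose proof (Rmin_pos r s Hr Hs).
    assert (Ct : Cmod t = t) by (rewrite Cmod_R; apply Rabs_pos_eq; lra).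
    specialize (H t ltac:(lra)). specialize (H' t ltac:(lra)). rewrite Ct in *.
    assert (T : Cmod (t * (l - m)) <= (A + B) * (t * t)).
    { replace (t * (l - m))%C with (- (G t - G 0%C - t * l) + (G t - G 0%C - t * m))%C by ring.
      eapply Rle_trans; [apply Cmod_triangle|]. rewrite Cmod_opp. lra. }
    rewrite Cmod_mult, Ct in T. apply Rmult_le_reg_l with t; auto.
    apply Rle_trans with (t * ((A + B + 1) * t)); [nra|].
    apply Rmult_le_compat_l; [lra|].
    replace e with ((A + B + 1) * (e / (A + B + 1))) by (field; lra). apply Rmult_le_compat_l; lra. }
  replace l with ((l - m) + m)%C by ring. rewrite E. ring.
Qed.

Definition gderiv (F : (K -> C) -> C) (v h : K -> C) : C :=
  epsilon (inhabits (RtoC 0)) (fun l => quadratic_deriv (fun z => F (line v z h)) l).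

Section Derivative.
Context (Hcpt : compact_space op) (Om : (K -> C) -> Prop) (F : (K -> C) -> C) (v : K -> C) (r M : R)
  (HF : ghol op Om F) (HM : bounded_on Om F M) (Hv : Om v) (Hr : has_radius op Om v r).

(** The constant scales as m^2 and is otherwise independent of the direction; this uniformity is
    what upgrades Gateaux to Frechet differentiability. *)
Lemma gderiv_estimate (h : K -> C) (m : R) (z : C) :
  continuousC op h -> 0 < m -> (forall k, Cmod (h k) <= m) -> Cmod z < r / m / 4 ->
  Cmod (F (line v z h) - F v - z * gderiv F v h) <= 128 * M / (r * r) * (m * m) * (Cmod z * Cmod z).
Proof.
  intros Hh Hm Hb Hz. pose proof (proj1 Hr) as Hr0. assert (HM0 := bounded_on_nonneg Om F v M HM Hv).
  assert (Hrm : 0 < r / m) by (apply Rdiv_lt_0_compat; auto).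
  assert (Hd := ghol_holo_disc Om F v h r m M HF HM Hr Hh Hm Hb).
  assert (HK : 0 <= 128 * M / (r / m * (r / m))).
  { apply Rmult_le_pos; [lra|]. left. apply Rinv_0_lt_compat. nra. }
  destruct (slope_estimate_derivative _ (r / m) _ Hrm HK (holo_slope_estimate _ _ _ Hrm Hd)) as [l Hl].
  assert (Q : quadratic_deriv (fun z => F (line v z h)) l).
  { exists (128 * M / (r / m * (r / m))), (r / m / 4). split; [lra|]. split; auto. }
  assert (E : gderiv F v h = l).
  { apply (quadratic_deriv_unique (fun z => F (line v z h))); auto. unfold gderiv. apply epsilon_spec. exists l. exact Q. }
  rewrite E. specialize (Hl z Hz). cbn beta in Hl. rewrite line_0 in Hl.
  eapply Rle_trans; [apply Hl|]. right. field. lra.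
Qed.

Lemma gderiv_unique (h : K -> C) (l : C) : continuousC op h -> quadratic_deriv (fun z => F (line v z h)) l -> gderiv F v h = l.
Proof.
  intros Hh Q. apply (quadratic_deriv_unique (fun z => F (line v z h))); auto.
  unfold gderiv. apply epsilon_spec. exists l. exact Q.
Qed.

Lemma gderiv_quadratic (h : K -> C) : continuousC op h -> quadratic_deriv (fun z => F (line v z h)) (gderiv F v h).
Proof.
  intros Hh. pose proof (proj1 Hr) as Hr0. assert (HM0 := bounded_on_nonneg Om F v M HM Hv).
  destruct (cont_bounded Hcpt h Hh) as [m [Hm Hb]].
  exists (128 * M / (r * r) * (m * m)), (r / m / 4).
  assert (0 < r / m) by (apply Rdiv_lt_0_compat; auto).
  split; [lra|]. split.
  - apply Rmult_le_pos; [|nra]. apply Rmult_le_pos; [lra|]. left. apply Rinv_0_lt_compat. nra.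
  - intros z Hz. rewrite line_0. apply gderiv_estimate; auto.
Qed.

Lemma gderiv_scal (c : C) (h g : K -> C) : continuousC op h -> (forall k, g k = (c * h k)%C) ->
  gderiv F v g = (c * gderiv F v h)%C.
Proof.
  intros Hh Hg. replace g with (fun k => (c * h k)%C) by (apply functional_extensionality; auto).
  apply gderiv_unique; [apply cont_scal; auto|].
  destruct (gderiv_quadratic h Hh) as [A [s [Hs [HA H]]]].
  pose proof (Cmod_ge_0 c).
  exists (A * (Cmod c * Cmod c)), (s / (Cmod c + 1)). split; [apply Rdiv_lt_0_compat; lra|].
  split; [apply Rmult_le_pos; auto; nra|].
  intros z Hz.
  assert (Hzc : Cmod (z * c) < s).
  { rewrite Cmod_mult. apply Rmult_lt_compat_r with (r := Cmod c + 1) in Hz; [|lra].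
    replace (s / (Cmod c + 1) * (Cmod c + 1)) with s in Hz by (field; lra). pose proof (Cmod_ge_0 z). nra. }
  specialize (H _ Hzc). rewrite line_0 in *.
  replace (line v z (fun k => (c * h k)%C)) with (line v (z * c) h) by (apply functional_extensionality; intros k; unfold line; ring).
  rewrite Cmod_mult in H. replace (z * (c * gderiv F v h))%C with (z * c * gderiv F v h)%C by ring.
  eapply Rle_trans; [apply H|]. right. ring.
Qed.

(* The mixed difference [F(v+zh+zg) - F(v+zh) - F(v+zg) + F(v)] is the increment between [0] and [z] of
   [D s = F(v+sg+zh) - F(v+sg)], a holomorphic function of [s] of size [O(z)], hence it is [O(z^2)]. *)
Lemma gderiv_plus (h g s : K -> C) : continuousC op h -> continuousC op g -> (forall k, s k = (h k + g k)%C) ->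
  gderiv F v s = (gderiv F v h + gderiv F v g)%C.
Proof.
  intros Hh Hg Hs. replace s with (fun k => (h k + g k)%C) by (apply functional_extensionality; auto). clear s Hs.
  apply gderiv_unique; [apply cont_plus; auto|].
  destruct (gderiv_quadratic h Hh) as [A1 [s1 [Hs1 [HA1 H1]]]].
  destruct (gderiv_quadratic g Hg) as [A2 [s2 [Hs2 [HA2 H2]]]].
  destruct (cont_bounded Hcpt h Hh) as [m1 [Hm1 Hb1]]. destruct (cont_bounded Hcpt g Hg) as [m2 [Hm2 Hb2]].
  set (m := m1 + m2). assert (Hm : 0 < m) by (unfold m; lra).
  assert (Hb1' : forall k, Cmod (h k) <= m) by (intros k; specialize (Hb1 k); unfold m; lra).
  assert (Hb2' : forall k, Cmod (g k) <= m) by (intros k; specialize (Hb2 k); unfold m; lra).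
  pose proof (proj1 Hr) as Hr0. assert (HM0 := bounded_on_nonneg Om F v M HM Hv).
  set (rho := r / (2 * m)). assert (Hrho : 0 < rho) by (apply Rdiv_lt_0_compat; lra).
  assert (Hrad : forall s, Cmod s < rho -> has_radius op Om (line v s g) (r / 2)).
  { intros s Hsr. split; [lra|]. intros f Hf Hfb.
    replace (fun k => (line v s g k + f k)%C) with (fun k => (v k + (s * g k + f k))%C)
      by (apply functional_extensionality; intros k; unfold line; ring).
    apply Hr. { apply cont_plus; auto. apply cont_scal; auto. }
    intros k. eapply Rle_trans; [apply Cmod_triangle|]. rewrite Cmod_mult.
    assert (Cmod s * Cmod (g k) <= rho * m) by (apply Rmult_le_compat; try apply Cmod_ge_0; auto; lra).
    replace (rho * m) with (r / 2) in * by (unfold rho; field; lra). specialize (Hfb k). lra. }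
  set (Lp := 32 * M / (r / 2) * m). assert (HLp : 0 <= Lp).
  { apply Rmult_le_pos; [|lra]. apply Rmult_le_pos; [lra|]. left. apply Rinv_0_lt_compat; lra. }
  set (B := 32 * Lp / rho). assert (HB : 0 <= B).
  { apply Rmult_le_pos; [lra|]. left. apply Rinv_0_lt_compat; lra. }
  exists (A1 + A2 + B), (Rmin (Rmin s1 s2) (rho / 4)).
  split; [repeat apply Rmin_pos; lra|]. split; [lra|]. intros z Hz.
  pose proof (Rmin_l (Rmin s1 s2) (rho / 4)) as R1. pose proof (Rmin_r (Rmin s1 s2) (rho / 4)) as R2.
  pose proof (Rmin_l s1 s2) as R3. pose proof (Rmin_r s1 s2) as R4.
  specialize (H1 z ltac:(lra)). specialize (H2 z ltac:(lra)). rewrite line_0 in *.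
  set (D := fun s => (F (line (line v s g) z h) - F (line v s g))%C).
  assert (HD : Cmod (D z - D 0%C) <= B * (Cmod z * Cmod z)).
  { destruct (Ceq_dec z 0%C) as [->|Hz0].
    { replace (D 0%C - D 0%C)%C with (RtoC 0) by ring. rewrite Cmod_0. lra. }
    apply Cmod_gt_0 in Hz0.
    assert (HDd : holo_disc D rho (Lp * Cmod z)).
    { intros s Hsr. specialize (Hrad s Hsr). split.
      - apply cdiff_minus; [|apply (ghol_line Om); auto; apply (line_radius Om v g r m); auto; unfold rho in Hsr].
        + replace (fun w => F (line (line v w g) z h)) with (fun w => F (line (line v z h) w g))
            by (apply functional_extensionality; intros w; f_equal; apply functional_extensionality; intros k; unfold line; ring).
          apply (ghol_line Om); auto.
          replace (line (line v z h) s g) with (line (line v s g) z h) by (apply functional_extensionality; intros k; unfold line; ring).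
          apply (line_radius Om _ h (r / 2) m); auto.
          replace (r / 2 / m) with rho by (unfold rho; field; lra). lra.
        + left. eapply Rlt_le_trans; [apply Hsr|].
          replace (r / m) with (2 * (r / (2 * m))) by (field; lra). fold rho. lra.
      - unfold D. replace (Lp * Cmod z) with (32 * M / (r / 2) * (m * Cmod z)) by (unfold Lp; ring).
        apply (ghol_lipschitz Om F (line v s g) (fun k => (z * h k)%C) (r / 2) (m * Cmod z) M); auto.
        + apply cont_scal; auto.
        + nra.
        + intros k. rewrite Cmod_mult, (Rmult_comm m). apply Rmult_le_compat_l; auto. apply Cmod_ge_0.
        + apply Rlt_le_trans with (m * (rho / 4)); [apply Rmult_lt_compat_l; lra|]. unfold rho. right. field. lra. }
    assert (HDl := holo_lipschitz D rho (Lp * Cmod z) z Hrho HDd ltac:(lra)).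
    eapply Rle_trans; [apply HDl|]. right. unfold B. field. lra. }
  unfold D in HD. rewrite line_0 in HD.
  replace (line v z (fun k => (h k + g k)%C)) with (line (line v z g) z h) by (apply functional_extensionality; intros k; unfold line; ring).
  replace (F (line (line v z g) z h) - F v - z * (gderiv F v h + gderiv F v g))%C with
    ((F (line v z h) - F v - z * gderiv F v h) + (F (line v z g) - F v - z * gderiv F v g) +
     (F (line (line v z g) z h) - F (line v z g) - (F (line v z h) - F v)))%C by ring.
  eapply Rle_trans; [apply Cmod_triangle|].
  eapply Rle_trans; [apply Rplus_le_compat_r, Cmod_triangle|]. lra.
Qed.
End Derivative.
End Space.

(** * Translation between [in_Hinf] and bounded functions holomorphic along lines *)

Section Hinf.
Context {K : Type} {op : (K -> Prop) -> Prop} (Htop : is_topology op) (Hcpt : compact_space op).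

Lemma ball_elt (b : Bset op) : unit_ball op (proj1_sig (proj1_sig b)).
Proof. destruct b as [[v Hv] Hb]. split; auto. Qed.

Lemma elt_of_ball (v : K -> C) : unit_ball op v -> exists b : Bset op, proj1_sig (proj1_sig b) = v.
Proof. intros [Hv Hb]. exists (exist _ (exist _ v Hv) Hb). reflexivity. Qed.

Lemma elt_ext (b b' : Bset op) : proj1_sig (proj1_sig b) = proj1_sig (proj1_sig b') -> b = b'.
Proof.
  destruct b as [[v Hv] Hb], b' as [[v' Hv'] Hb']. simpl. intros ->.
  assert (E : Hv = Hv') by apply proof_irrelevance. subst. f_equal. apply proof_irrelevance.
Qed.

Lemma extend_elt (f : Bset op -> C) (b : Bset op) : extend f (proj1_sig (proj1_sig b)) = f b.
Proof.
  unfold extend. destruct (excluded_middle_informative _) as [H|H].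
  - f_equal. apply elt_ext. apply (proj2_sig (constructive_indefinite_description _ H)).
  - exfalso. apply H. exists b. reflexivity.
Qed.

Lemma restrict_extend (f : Bset op -> C) : restrict (extend f) = f.
Proof. apply functional_extensionality. intros b. apply extend_elt. Qed.

Lemma Hinf_extend (f : Bset op -> C) : in_Hinf f ->
  ghol op (unit_ball op) (extend f) /\ exists M, bounded_on (unit_ball op) (extend f) M.
Proof.
  intros [Hf [M HM]]. split.
  2:{ exists M. intros v Hv. destruct (elt_of_ball v Hv) as [b <-]. rewrite extend_elt. apply HM. }
  intros v u Hv Hu. destruct (elt_of_ball v Hv) as [b Hb].
  destruct (Hf b) as [L [[_ Lmul] [_ HL]]].
  destruct (cont_bounded Hcpt u Hu) as [m [Hm Hub]].
  destruct (gopen_ball Htop v Hv) as [r Hr].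
  apply (little_o_cdiff _ (L (exist _ u Hu))). intros e He.
  (* The increment z u has norm at most m |z|, hence the tolerance e / m. *)
  destruct (HL (e / m)) as [d [Hd H]]; [apply Rdiv_lt_0_compat; auto|].
  exists (Rmin (r / m) (d / m)). pose proof (proj1 Hr).
  split; [apply Rmin_pos; apply Rdiv_lt_0_compat; auto|].
  intros z Hz. pose proof (Rmin_l (r / m) (d / m)). pose proof (Rmin_r (r / m) (d / m)).
  assert (Hline : unit_ball op (line v z u)) by (apply (line_radius (op := op) (unit_ball op) v u r m); auto; lra).
  destruct (elt_of_ball _ Hline) as [b' Hb'].
  set (h := exist (continuousC op) (fun k => (z * u k)%C) (cont_scal z u Hu) : CK op).
  assert (Hzm : forall k, Cmod (z * u k) <= Cmod z * m).
  { intros k. rewrite Cmod_mult. apply Rmult_le_compat_l; auto. apply Cmod_ge_0. }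
  specialize (H b' h). rewrite line_0, <- Hb', <- Hb, !extend_elt.
  replace (e * Cmod z) with (e / m * (Cmod z * m)) by (field; lra).
  replace (z * L (exist _ u Hu))%C with (L h) by (apply Lmul; reflexivity).
  apply H.
  - intros k. rewrite Hb, Hb'. reflexivity.
  - intros k. eapply Rle_trans; [apply Hzm|]. replace d with (d / m * m) by (field; lra).
    apply Rmult_le_compat_r; lra.
  - exact Hzm.
Qed.

(* On the empty space every norm bound is vacuous, so no function at all satisfies [holomorphic_on_B]. *)
Lemma Hinf_inhabited (f : Bset op -> C) : in_Hinf f -> exists k : K, True.
Proof.
  intros [Hf _]. apply NNPP. intros Hn.
  assert (Hk : forall k : K, False) by (intros k; apply Hn; exists k; exact I).
  destruct (elt_of_ball (fun _ => 0%C)) as [b _].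
  { split; [apply cont_const; auto|]. exists 0. split; [lra|]. intros k; destruct (Hk k). }
  destruct (Hf b) as [L [_ [_ HL]]]. destruct (HL 1 ltac:(lra)) as [d [_ H]].
  set (h0 := exist (continuousC op) (fun _ => RtoC 0) (cont_const Htop (RtoC 0)) : CK op).
  assert (Hneg := H b h0 (fun k => match Hk k with end) (fun k => match Hk k with end) (-1) (fun k => match Hk k with end)).
  pose proof (Cmod_ge_0 (Csub (Csub (f b) (f b)) (L h0))) as P.
  change Defs.Cmod with Cmod in Hneg. lra.
Qed.

(** The Gateaux derivative is linear and its remainder is uniform over directions, hence it is a
    Frechet derivative. The point [k0] makes every bound in [normle] nonnegative. *)
Lemma Hinf_restrict (k0 : K) (F : (K -> C) -> C) (M : R) :
  ghol op (unit_ball op) F -> bounded_on (unit_ball op) F M -> in_Hinf (op := op) (restrict F).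
Proof.
  intros HF HM. split; [|exists M; intros b; apply HM, ball_elt].
  intros b. set (v := proj1_sig (proj1_sig b)). assert (Hv : unit_ball op v) by apply ball_elt.
  destruct (gopen_ball Htop v Hv) as [r Hr]. pose proof (proj1 Hr) as Hr0.
  assert (HM0 := bounded_on_nonneg (unit_ball op) F v M HM Hv).
  assert (Hest := fun h m z => gderiv_estimate (unit_ball op) F v r M HF HM Hv Hr h m z).
  set (A := 128 * M / (r * r)) in *.
  assert (HA : 0 <= A). { apply Rmult_le_pos; [lra|]. left. apply Rinv_0_lt_compat. nra. }
  exists (fun h => gderiv F v (proj1_sig h)). split; [split|split].
  - intros x y z Hz. apply (gderiv_plus Htop Hcpt (unit_ball op) F v r M); auto; apply proj2_sig.
  - intros c x z Hz. apply (gderiv_scal Hcpt (unit_ball op) F v r M); auto; apply proj2_sig.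
  (* For a direction of norm at most 1, the step r / 8 bounds the derivative: the increment of [F]
     is at most 2 M and the remainder is controlled by [A]. *)
  - exists ((2 * M + A * (r / 8 * (r / 8))) / (r / 8)). intros x Hx.
    assert (Ct : Cmod (r / 8)%R = r / 8) by (rewrite Cmod_R; apply Rabs_pos_eq; lra).
    assert (E := Hest (proj1_sig x) 1 (r / 8)%R (proj2_sig x) ltac:(lra) Hx ltac:(rewrite Ct; lra)).
    rewrite Ct in E.
    assert (Hl : unit_ball op (line v (r / 8)%R (proj1_sig x))).
    { apply (line_radius (op := op) (unit_ball op) v _ r 1); auto; [apply proj2_sig|lra|rewrite Ct; lra]. }
    apply HM in Hl. pose proof (HM v Hv) as Hl0.
    assert (T : Cmod ((r / 8)%R * gderiv F v (proj1_sig x)) <= 2 * M + A * (r / 8 * (r / 8))).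
    { replace ((r / 8)%R * gderiv F v (proj1_sig x))%C with
       (F (line v (r / 8)%R (proj1_sig x)) + - F v + - (F (line v (r / 8)%R (proj1_sig x)) - F v - (r / 8)%R * gderiv F v (proj1_sig x)))%C by ring.
      eapply Rle_trans; [apply Cmod_triangle|]. rewrite Cmod_opp.
      pose proof (Cmod_triangle (F (line v (r / 8)%R (proj1_sig x))) (- F v)) as T2. rewrite Cmod_opp in T2. lra. }
    rewrite Cmod_mult, Ct in T. change Defs.Cmod with Cmod.
    apply Rmult_le_reg_l with (r / 8); [lra|]. replace (r / 8 * ((2 * M + A * (r / 8 * (r / 8))) / (r / 8))) with (2 * M + A * (r / 8 * (r / 8))) by (field; lra).
    exact T.
  - intros e He. set (d := Rmin (r / 8) (e / (A + 1))).
    assert (Hd : 0 < d) by (apply Rmin_pos; [lra|apply Rdiv_lt_0_compat; lra]).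
    assert (Hd1 : d <= r / 8) by apply Rmin_l. assert (Hd2 : d <= e / (A + 1)) by apply Rmin_r.
    exists d. split; auto. intros b' h Hb' Hhd m Hhm.
    assert (Hm : 0 <= m) by (eapply Rle_trans; [apply Cmod_ge_0|apply (Hhm k0)]).
    assert (Eb : proj1_sig (proj1_sig b') = line v 1%C (proj1_sig h)).
    { apply functional_extensionality. intros k. rewrite Hb'. unfold line. apply (eq_trans (y := (v k + proj1_sig h k)%C)); [reflexivity|]. change (@eq C (v k + proj1_sig h k)%C (v k + 1 * proj1_sig h k)%C). ring. }
    unfold restrict. rewrite Eb. fold v.
    change (Cmod (F (line v 1 (proj1_sig h)) - F v - gderiv F v (proj1_sig h))%C <= e * m).
    assert (Hall : forall m', 0 < m' -> m' <= d -> normle h m' ->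
       Cmod (F (line v 1 (proj1_sig h)) - F v - gderiv F v (proj1_sig h))%C <= e * m').
    { intros m' Hm' Hm'd Hn.
      assert (H1 : Cmod 1%C < r / m' / 4).
      { rewrite Cmod_1. apply Rmult_lt_reg_r with m'; auto. replace (r / m' / 4 * m') with (r / 4) by (field; lra). lra. }
      assert (E := Hest (proj1_sig h) m' 1%C (proj2_sig h) Hm' Hn H1). rewrite Cmod_1 in E.
      replace (1 * gderiv F v (proj1_sig h))%C with (gderiv F v (proj1_sig h)) in E by ring.
      eapply Rle_trans; [apply E|]. replace (A * (m' * m') * (1 * 1)) with (A * m' * m') by ring.
      apply Rmult_le_compat_r; [lra|].
      apply Rle_trans with ((A + 1) * d); [nra|].
      replace e with ((A + 1) * (e / (A + 1))) by (field; lra). apply Rmult_le_compat_l; lra. }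
    apply le_epsilon. intros e' He'.
    assert (He'e : 0 < e' / e) by (apply Rdiv_lt_0_compat; auto).
    replace (e * m + e') with (e * (m + e' / e)) by (field; lra).
    apply Rle_trans with (e * Rmin d (m + e' / e)).
    + apply Hall; [apply Rmin_pos; lra|apply Rmin_l|].
      intros k. apply Rmin_glb; [apply Hhd|]. specialize (Hhm k). change Defs.Cmod with Cmod in *. lra.
    + apply Rmult_le_compat_l; [lra|apply Rmin_r].
Qed.
End Hinf.

(** * Scattered compact spaces *)

Definition clopen {K : Type} (op : (K -> Prop) -> Prop) (U : K -> Prop) : Prop := op U /\ op (fun x => ~ U x).

Definition clopen_base {K : Type} (op : (K -> Prop) -> Prop) (t : K) : Prop :=
  forall U, op U -> U t -> exists V, clopen op V /\ V t /\ forall x, V x -> U x.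

(** Letting the first matching set decide amounts to making the labelled cover disjoint. For a cover
    the default [t] is never reached. *)
Fixpoint first_center {K : Type} (L : list ((K -> Prop) * K)) (t : K) : K :=
  match L with
  | nil => t
  | (V, p) :: L' => if excluded_middle_informative (V t) then p else first_center L' t
  end.

Definition cut {K : Type} (U : K -> Prop) (v : K -> C) : K -> C :=
  fun k => if excluded_middle_informative (U k) then v k else 0%C.

Definition comb {K : Type} (l : list (C * K)) (v : K -> C) : C :=
  fold_right (fun p s => (fst p * v (snd p) + s)%C) 0%C l.

Section Topology.
Context {K : Type} {op : (K -> Prop) -> Prop} (Htop : is_topology op).

Lemma op_ext (U V : K -> Prop) : (forall x, U x <-> V x) -> op U -> op V.
Proof.
  intros H HU. replace V with U; auto. apply functional_extensionality. intros x.
  apply propositional_extensionality. auto.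
Qed.

Lemma op_exists (F : (K -> Prop) -> Prop) : (forall U, F U -> op U) -> op (fun x => exists U, F U /\ U x).
Proof. apply Htop. Qed.

Lemma op_or (A B : K -> Prop) : op A -> op B -> op (fun x => A x \/ B x).
Proof.
  intros HA HB. apply (op_ext (fun x => exists U, (U = A \/ U = B) /\ U x)).
  - intros x. split.
    + intros [U [[-> | ->] H]]; auto.
    + intros [H|H]; eauto.
  - apply op_exists. intros U [-> | ->]; auto.
Qed.

Lemma op_local (U : K -> Prop) :
  (forall x, U x -> exists V, op V /\ V x /\ forall y, V y -> U y) -> op U.
Proof.
  intros H. apply (op_ext (fun x => exists V, (op V /\ forall y, V y -> U y) /\ V x)).
  - intros x. split.
    + intros [V [[_ HV] Vx]]. auto.
    + intros Ux. destruct (H x Ux) as [V [HV [Vx HVU]]]. eauto.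
  - apply op_exists. intros V [HV _]. exact HV.
Qed.

Lemma clopen_empty : clopen op (fun _ => False).
Proof. split; [apply Htop|]. apply (op_ext (fun _ => True)); [tauto|apply Htop]. Qed.

Lemma clopen_diff (A B : K -> Prop) : clopen op A -> clopen op B -> clopen op (fun x => A x /\ ~ B x).
Proof.
  intros [HA HA'] [HB HB']. split; [apply op_and; auto|].
  apply (op_ext (fun x => ~ A x \/ B x)); [intros x; destruct (classic (A x)), (classic (B x)); tauto|apply op_or; auto].
Qed.

Lemma clopen_and (A B : K -> Prop) : clopen op A -> clopen op B -> clopen op (fun x => A x /\ B x).
Proof.
  intros [HA HA'] [HB HB']. split; [apply op_and; auto|].
  apply (op_ext (fun x => ~ A x \/ ~ B x)); [intros x; destruct (classic (A x)), (classic (B x)); tauto|apply op_or; auto].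
Qed.

Lemma clopen_or (A B : K -> Prop) : clopen op A -> clopen op B -> clopen op (fun x => A x \/ B x).
Proof.
  intros [HA HA'] [HB HB']. split; [apply op_or; auto|].
  apply (op_ext (fun x => ~ A x /\ ~ B x)); [intros x; tauto|apply op_and; auto].
Qed.

Lemma clopen_union_list (l : list (K -> Prop)) : (forall A, In A l -> clopen op A) ->
  clopen op (fun x => exists A, In A l /\ A x).
Proof.
  induction l as [|A l IH]; intros H.
  - destruct clopen_empty as [H1 H2]. split; [apply (op_ext (fun _ => False))|apply (op_ext (fun _ => ~ False))]; auto;
      intros x; simpl; firstorder.
  - destruct (clopen_or A _ (H A (or_introl eq_refl)) (IH (fun B HB => H B (or_intror HB)))) as [H1 H2].
    split; [revert H1|revert H2]; apply op_ext; intros x; simpl; split.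
    + intros [HA|[B [HB Bx]]]; eauto.
    + intros [B [[<-|HB] Bx]]; eauto.
    + intros Hn [B [[<-|HB] Bx]]; apply Hn; eauto.
    + intros Hn [HA|[B [HB Bx]]]; apply Hn; eauto.
Qed.

Context (Hcpt : compact_space op).

Lemma compact_pairs (P : (K -> Prop) -> K -> Prop) :
  (forall t, exists V p, op V /\ V t /\ P V p) ->
  exists L, (forall V p, In (V, p) L -> P V p /\ op V) /\ forall t, exists V p, In (V, p) L /\ V t.
Proof.
  intros H. destruct (Hcpt (fun V => op V /\ exists p, P V p)) as [l [Hl Hc]].
  - intros U [HU _]. exact HU.
  - intros t. destruct (H t) as [V [p [HV [Vt HP]]]]. eauto.
  - assert (E : exists L, (forall V p, In (V, p) L -> P V p /\ op V) /\ forall V, In V l -> exists p, In (V, p) L).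
    { clear Hc. induction l as [|V l IH].
      - exists nil. split; [intros ? ? []|intros ? []].
      - destruct IH as [L [H1 H2]]; [intros; apply Hl; right; auto|].
        destruct (Hl V (or_introl eq_refl)) as [HV [p Hp]].
        exists ((V, p) :: L). split.
        + intros V' p' [E|HI]; [injection E; intros; subst; auto|auto].
        + intros V' [<-|HI]; [exists p; left; auto|]. destruct (H2 V' HI) as [q Hq]. exists q. right; auto. }
    destruct E as [L [H1 H2]]. exists L. split; auto.
    intros t. destruct (Hc t) as [V [HV Vt]]. destruct (H2 V HV) as [p Hp]. eauto.
Qed.

Lemma compact_closed_cover (A : K -> Prop) (P : (K -> Prop) -> Prop) : op (fun x => ~ A x) ->
  (forall t, A t -> exists V, op V /\ V t /\ P V) ->
  exists l, (forall V, In V l -> P V) /\ forall t, A t -> exists V, In V l /\ V t.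
Proof.
  intros HA H. destruct (Hcpt (fun V => op V /\ (P V \/ V = (fun x => ~ A x)))) as [l [Hl Hc]].
  - intros U [HU _]. exact HU.
  - intros t. destruct (classic (A t)) as [At|At].
    + destruct (H t At) as [V [HV [Vt HP]]]. eauto.
    + exists (fun x => ~ A x). auto.
  - assert (E : exists l', (forall V, In V l' -> P V) /\ forall t, A t -> forall V, In V l -> V t -> In V l').
    { clear Hc. induction l as [|V l IH].
      - exists nil. split; [intros ? []|intros ? ? ? []].
      - destruct IH as [L [H1 H2]]; [intros; apply Hl; right; auto|].
        destruct (Hl V (or_introl eq_refl)) as [HV [Hp|Hp]].
        + exists (V :: L). split.
          * intros V' [<-|HI]; auto.
          * intros t At V' [<-|HI] Vt; [left; auto|right; eauto].
        + exists L. split; auto. intros t At V' [<-|HI] Vt; [|eauto]. subst V. contradiction. }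
    destruct E as [l' [H1 H2]]. exists l'. split; auto.
    intros t At. destruct (Hc t) as [V [HV Vt]]. eauto.
Qed.

Context (Hhaus : hausdorff op).

Lemma op_neq (t : K) : op (fun x => x <> t).
Proof.
  apply op_local. intros x Hx. destruct (Hhaus x t Hx) as [U [V [HU [HV [Ux [Vt H]]]]]].
  exists U. split; auto. split; auto. intros y Uy ->. apply (H t). auto.
Qed.

(** [O] stands for the complement of the closure of [W]. Finitely many open sets, each separated
    from [t], cover what [U] leaves out; [O] is their union and [W] the intersection of the matching
    neighbourhoods of [t]. *)
Lemma regular (t : K) (U : K -> Prop) : op U -> U t ->
  exists W O, op W /\ op O /\ W t /\ (forall x, W x -> O x -> False) /\ forall x, U x \/ O x.
Proof.
  intros HU Ut.
  destruct (Hcpt (fun V => op V /\ (V = U \/ exists W, op W /\ W t /\ forall x, W x -> V x -> False))) as [l [Hl Hc]].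
  - intros V [HV _]. exact HV.
  - intros x. destruct (classic (x = t)) as [->|Hx]; [exists U; auto|].
    destruct (Hhaus x t Hx) as [A [B [HA [HB [Ax [Bt H]]]]]]. exists A. split; auto. split; auto.
    right. exists B. split; auto. split; auto. intros y By Ay. apply (H y). auto.
  - assert (E : exists W O, op W /\ op O /\ W t /\ (forall x, W x -> O x -> False) /\
       forall x, (exists V, In V l /\ V x) -> U x \/ O x).
    { clear Hc. induction l as [|V l IH].
      - exists (fun _ => True), (fun _ => False). repeat split; try apply Htop; auto. intros x [V [[] _]].
      - destruct IH as [W [O [HW [HO [Wt [HWO H]]]]]]; [intros; apply Hl; right; auto|].
        destruct (Hl V (or_introl eq_refl)) as [HV [->|[W' [HW' [Wt' HWV]]]]].
        + exists W, O. repeat split; auto. intros x [V [[<-|HI] Vx]]; eauto.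
        + exists (fun x => W x /\ W' x), (fun x => O x \/ V x).
          repeat split; auto; [apply op_and; auto|apply op_or; auto| |].
          * intros x [Wx Wx'] [Ox|Vx]; eauto.
          * intros x [V' [[<-|HI] Vx]]; auto. destruct (H x); eauto. }
    destruct E as [W [O [H1 [H2 [H3 [H4 H5]]]]]]. exists W, O. auto 10.
Qed.

Context (Hdisp : dispersed op).

(* The points without a clopen base form a closed set; at an isolated point [t] of it, the boundary of a small
   neighbourhood of [t] can be covered by clopen sets, and removing them makes the neighbourhood clopen. *)
Lemma zero_dimensional (t : K) : clopen_base op t.
Proof.
  set (A := fun t => ~ exists U, op U /\ U t /\ forall y, U y -> clopen_base op y).
  assert (HA : perfect_set op A).
  { split.
    - apply op_local. intros x Hx. apply NNPP in Hx. destruct Hx as [U [HU [Ux H]]].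
      exists U. split; auto. split; auto. intros y Uy Hn. apply Hn. eauto.
    - intros x Ax [_ [U [HU [Ux Hiso]]]].
      assert (Hoth : forall y, U y -> y <> x -> clopen_base op y).
      { intros y Uy Hyx. apply NNPP. intros Hn. apply Hyx. apply Hiso; auto.
        intros [U' [HU' [U'y H']]]. apply Hn, H'. auto. }
      apply Ax. exists U. split; auto. split; auto. intros y Uy.
      destruct (classic (y = x)) as [->|Hyx]; [|auto].
      intros N HN Nx.
      destruct (regular x (fun y => U y /\ N y) (op_and Htop _ _ HU HN) (conj Ux Nx)) as [W [O [HW [HO [Wx [HWO HUO]]]]]].
      destruct (compact_closed_cover (fun y => ~ W y /\ ~ O y) (fun V => clopen op V /\ ~ V x)) as [l [Hl Hc]].
      + apply (op_ext (fun y => W y \/ O y)); [intros y; tauto|apply op_or; auto].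
      + intros y [HyW HyO]. destruct (HUO y) as [[Uy' Ny]|]; [|contradiction].
        assert (Hyx : y <> x) by (intros ->; auto).
        destruct (Hoth y Uy' Hyx (fun z => z <> x) (op_neq x) Hyx) as [V [HV [Vy HVx]]].
        exists V. split; [apply HV|]. split; auto. split; auto. intros Vx. apply (HVx x Vx eq_refl).
      + destruct (clopen_union_list l (fun V HV => proj1 (Hl V HV))) as [HS HS'].
        exists (fun y => W y /\ ~ (exists V, In V l /\ V y)). split; [split|split].
        * apply op_and; auto.
        * apply (op_ext (fun y => O y \/ exists V, In V l /\ V y)); [|apply op_or; auto].
          intros y. split.
          -- intros [Oy|Hy] [Wy Hn]; [eauto|auto].
          -- intros Hn. destruct (classic (O y)) as [|Oy]; auto. right.
             destruct (classic (W y)) as [Wy|Wy]; [|apply Hc; auto].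
             apply NNPP. intros Hn'. apply Hn. auto.
        * split; auto. intros [V [HV Vx]]. exact (proj2 (Hl V HV) Vx).
        * intros y [Wy _]. destruct (HUO y) as [[_ Ny]|Oy]; auto. exfalso; eauto. }
  apply NNPP. intros Hn. apply (Hdisp A HA t). intros [U [HU [Ut H]]]. apply Hn, H, Ut.
Qed.

Lemma small_clopen (t : K) (marks : list K) (xs : list (K -> C)) (e : R) : 0 < e ->
  (forall x, In x xs -> continuousC op x) ->
  exists V, clopen op V /\ V t /\ (forall x s, In x xs -> V s -> Cmod (x t - x s) <= e) /\
    (forall m, In m marks -> V m -> m = t).
Proof.
  intros He Hxs.
  assert (H1 : exists N, op N /\ N t /\ forall x s, In x xs -> N s -> Cmod (x t - x s) <= e).
  { induction xs as [|x xs IH].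
    - exists (fun _ => True). repeat split; try apply Htop. intros x s [].
    - destruct IH as [N [HN [Nt H]]]; [intros; apply Hxs; right; auto|].
      destruct (Hxs x (or_introl eq_refl) t e He) as [N' [HN' [Nt' H']]].
      exists (fun y => N y /\ N' y). split; [apply op_and; auto|]. split; auto.
      intros x' s [<-|HI] [Ns Ns']; auto.
      rewrite Cmod_minus_sym. left. apply H', Ns'. }
  assert (H2 : exists N, op N /\ N t /\ forall m, In m marks -> N m -> m = t).
  { clear H1. induction marks as [|m marks IH].
    - exists (fun _ => True). repeat split; try apply Htop. intros m [].
    - destruct IH as [N [HN [Nt H]]].
      destruct (classic (m = t)) as [->|Hm].
      + exists N. repeat split; auto. intros m [<-|HI]; auto.
      + exists (fun y => N y /\ y <> m). split; [apply op_and; auto; apply op_neq|]. split; auto.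
        intros m' [<-|HI] [Nm Hmm]; auto. contradiction. }
  destruct H1 as [N1 [HN1 [Nt1 H1]]]. destruct H2 as [N2 [HN2 [Nt2 H2]]].
  destruct (zero_dimensional t (fun y => N1 y /\ N2 y) (op_and Htop _ _ HN1 HN2) (conj Nt1 Nt2)) as [V [HV [Vt H]]].
  exists V. split; auto. split; auto. split.
  - intros x s Hx Vs. apply H1; auto. apply H; auto.
  - intros m Hm Vm. apply H2; auto. apply H; auto.
Qed.

(** Take a finite cover by clopen sets on which the functions oscillate little and whose only
    possible mark is their centre. Sending a point to the centre of the first set containing it
    fixes the marks, and clopenness makes the map locally constant. *)
Lemma finite_retraction (marks : list K) (xs : list (K -> C)) (e : R) : 0 < e ->
  (forall x, In x xs -> continuousC op x) ->
  exists pi : K -> K, (forall m, In m marks -> pi m = m) /\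
    (forall x t, In x xs -> Cmod (x (pi t) - x t) <= e) /\
    (forall t, exists O, op O /\ O t /\ forall s, O s -> pi s = pi t).
Proof.
  intros He Hxs.
  destruct (compact_pairs (fun V p => clopen op V /\ V p /\ (forall x s, In x xs -> V s -> Cmod (x p - x s) <= e) /\
    (forall m, In m marks -> V m -> m = p))) as [L [HL Hc]].
  { intros t. destruct (small_clopen t marks xs e He Hxs) as [V HV]. exists V, t.
    split; [apply HV|]. split; [apply HV|exact HV]. }
  assert (Hfind : forall t, exists V, In (V, first_center L t) L /\ V t).
  { intros t. specialize (Hc t). clear HL. induction L as [|[V p] L IH].
    - destruct Hc as [V [p [[] _]]].
    - simpl. destruct (excluded_middle_informative (V t)) as [Vt|Vt].
      + exists V. auto.
      + destruct IH as [V' [HV' Vt']]; [|exists V'; auto].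
        destruct Hc as [V' [p' [[E|HI] Vt']]]; [|eauto]. injection E; intros; subst; contradiction. }
  exists (first_center L). split; [|split].
  - intros m Hm. destruct (Hfind m) as [V [HI Vm]]. destruct (HL _ _ HI) as [[_ [_ [_ H]]] _]. symmetry. apply H; auto.
  - intros x t Hx. destruct (Hfind t) as [V [HI Vt]]. destruct (HL _ _ HI) as [[_ [_ [H _]]] _]. apply H; auto.
  - assert (HLc : forall V p, In (V, p) L -> clopen op V) by (intros V p HI; apply (HL V p HI)).
    intros t. specialize (Hc t). clear Hfind HL. induction L as [|[V p] L IH].
    + destruct Hc as [V [p [[] _]]].
    + simpl. destruct (excluded_middle_informative (V t)) as [Vt|Vt].
      * exists V. split; [apply (HLc V p); left; auto|]. split; auto. intros s Vs.
        destruct (excluded_middle_informative (V s)); [auto|contradiction].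
      * destruct IH as [O [HO [Ot H]]].
        { destruct Hc as [V' [p' [[E|HI] Vt']]]; [|eauto]. injection E; intros; subst; contradiction. }
        { intros; apply (HLc V0 p0); right; auto. }
        exists (fun s => O s /\ ~ V s). split; [apply op_and; auto; apply (HLc V p); left; auto|]. split; auto.
        intros s [Os Vs]. destruct (excluded_middle_informative (V s)); [contradiction|auto].
Qed.

(** [v] is arbitrary here, which is what allows its value at a single point to be altered before
    composing. *)
Lemma cont_locally_constant_comp (pi : K -> K) (v : K -> C) :
  (forall t, exists O, op O /\ O t /\ forall s, O s -> pi s = pi t) -> continuousC op (fun t => v (pi t)).
Proof.
  intros H t e He. destruct (H t) as [O [HO [Ot Hc]]]. exists O. split; auto. split; auto. intros s Os.
  rewrite (Hc s Os). change (Cmod (v (pi t) - v (pi t))%C < e).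
  replace (v (pi t) - v (pi t))%C with (RtoC 0) by ring. rewrite Cmod_0. auto.
Qed.

Lemma cont_cut (U : K -> Prop) (v : K -> C) : clopen op U -> continuousC op v -> continuousC op (cut U v).
Proof.
  intros [HU HU'] Hv t e He. destruct (Hv t e He) as [O [HO [Ot H]]]. unfold cut.
  destruct (excluded_middle_informative (U t)) as [Ut|Ut].
  - exists (fun s => O s /\ U s). split; [apply op_and; auto|]. split; auto. intros s [Os Us].
    destruct (excluded_middle_informative (U s)); [auto|contradiction].
  - exists (fun s => ~ U s). split; auto. split; auto. intros s Us.
    destruct (excluded_middle_informative (U s)); [contradiction|].
    change (Cmod (0 - 0)%C < e). replace (0 - 0)%C with (RtoC 0) by ring. rewrite Cmod_0. auto.
Qed.
End Topology.

(** * Functionals on C(K) *)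

Lemma comb_app {K : Type} (l l' : list (C * K)) (v : K -> C) : comb (l ++ l') v = (comb l v + comb l' v)%C.
Proof. induction l as [|p l IH]; simpl; [ring|]. rewrite IH. ring. Qed.

Lemma cut_or {K : Type} (A B : K -> Prop) (v : K -> C) : (forall x, A x -> B x -> False) ->
  cut (fun x => A x \/ B x) v = fun k => (cut A v k + cut B v k)%C.
Proof.
  intros H. apply functional_extensionality. intros k. unfold cut.
  destruct (excluded_middle_informative (A k \/ B k)), (excluded_middle_informative (A k)),
    (excluded_middle_informative (B k)); try tauto; try ring. exfalso; eauto.
Qed.

Lemma cut_bound {K : Type} (A : K -> Prop) (v : K -> C) (s : R) : (forall k, Cmod (v k) <= s) ->
  forall k, Cmod (cut A v k) <= s.
Proof.
  intros H k. unfold cut. destruct (excluded_middle_informative (A k)); auto.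
  rewrite Cmod_0. eapply Rle_trans; [apply Cmod_ge_0|apply (H k)].
Qed.

Lemma cut_sub {K : Type} (A B : K -> Prop) (v : K -> C) : (forall x, B x -> A x) -> cut A (cut B v) = cut B v.
Proof.
  intros H. apply functional_extensionality. intros k. unfold cut.
  destruct (excluded_middle_informative (A k)), (excluded_middle_informative (B k)); auto. exfalso; auto.
Qed.

Section Functional.
Context {K : Type} {op : (K -> Prop) -> Prop} (Htop : is_topology op) (Hcpt : compact_space op)
  (Hhaus : hausdorff op) (Hdisp : dispersed op).
Context (phi : CK op -> C) (M : R) (Hlin : linearX phi) (HM : opnormle phi M).

(** Extension by 0 to discontinuous functions, so that [phi] can be applied to explicit expressions
    and rewritten under. *)
Definition total (v : K -> C) : C :=
  match excluded_middle_informative (continuousC op v) with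
  | left H => phi (exist _ v H)
  | right _ => 0%C
  end.

Lemma total_elt (x : CK op) : total (proj1_sig x) = phi x.
Proof.
  unfold total. destruct (excluded_middle_informative _) as [H|H].
  - f_equal. destruct x as [v Hv]. simpl in *. f_equal. apply proof_irrelevance.
  - exfalso. apply H, proj2_sig.
Qed.

Lemma total_plus (u v : K -> C) : continuousC op u -> continuousC op v ->
  total (fun k => (u k + v k)%C) = (total u + total v)%C.
Proof.
  intros Hu Hv.
  change (total (proj1_sig (exist (continuousC op) _ (cont_plus Htop u v Hu Hv))) =
    (total (proj1_sig (exist (continuousC op) u Hu)) + total (proj1_sig (exist (continuousC op) v Hv)))%C).
  rewrite !total_elt. apply (proj1 Hlin). reflexivity.
Qed.

Lemma total_scal (c : C) (u : K -> C) : continuousC op u -> total (fun k => (c * u k)%C) = (c * total u)%C.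
Proof.
  intros Hu.
  change (total (proj1_sig (exist (continuousC op) _ (cont_scal c u Hu))) =
    (c * total (proj1_sig (exist (continuousC op) u Hu)))%C).
  rewrite !total_elt. apply (proj2 Hlin). reflexivity.
Qed.

Lemma total_bound (v : K -> C) (s : R) : 0 < s -> continuousC op v -> (forall k, Cmod (v k) <= s) -> Cmod (total v) <= M * s.
Proof.
  intros Hs Hv Hb.
  assert (Hsc : Cmod (RtoC (/ s)) = / s) by (rewrite Cmod_R; apply Rabs_pos_eq; left; apply Rinv_0_lt_compat; auto).
  assert (H : Cmod (total (fun k => (RtoC (/ s) * v k)%C)) <= M).
  { change (Cmod (total (proj1_sig (exist (continuousC op) _ (cont_scal (RtoC (/ s)) v Hv)))) <= M).
    rewrite total_elt. apply HM. intros k. simpl. change (Cmod (RtoC (/ s) * v k)%C <= 1).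
    rewrite Cmod_mult, Hsc. apply Rmult_le_reg_l with s; auto. rewrite <- Rmult_assoc, Rinv_r, Rmult_1_l, Rmult_1_r by lra. apply Hb. }
  rewrite total_scal, Cmod_mult, Hsc in H by auto.
  apply Rmult_le_reg_l with (/ s); [apply Rinv_0_lt_compat; auto|].
  replace (/ s * (M * s)) with M by (field; lra). exact H.
Qed.

Lemma total_zero : total (fun _ => RtoC 0) = 0%C.
Proof.
  replace (fun _ : K => RtoC 0) with (fun _ : K => (RtoC 0 * RtoC 0)%C) by (apply functional_extensionality; intros; ring).
  rewrite (total_scal (RtoC 0) (fun _ => RtoC 0)) by (apply cont_const; auto). ring.
Qed.

Lemma total_norm_nonneg : 0 <= M.
Proof.
  assert (H : Cmod (total (fun _ => RtoC 0)) <= M * 1).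
  { apply total_bound; [lra|apply cont_const; auto|]. intros k. rewrite Cmod_0. lra. }
  pose proof (Cmod_ge_0 (total (fun _ => RtoC 0))). lra.
Qed.

(** In terms of measures: the part of [phi] carried by [U] is a norm limit of finite combinations of
    point masses. *)
Definition approximable (U : K -> Prop) : Prop := clopen op U /\
  forall e, 0 < e -> exists l, forall v : K -> C, continuousC op v -> (forall k, Cmod (v k) <= 1) ->
    Cmod (total (cut U v) - comb l v) <= e.

(** Testing on [cut V v] kills the terms of the combination at points outside [V]. *)
Lemma approximable_sub (U V : K -> Prop) : approximable U -> clopen op V -> (forall x, V x -> U x) -> approximable V.
Proof.
  intros [HU H] HV Hsub. split; auto. intros e He. destruct (H e He) as [l Hl].
  exists (map (fun p => (if excluded_middle_informative (V (snd p)) then fst p else RtoC 0, snd p)) l).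
  intros v Hv Hb.
  specialize (Hl (cut V v) (cont_cut Htop V v HV Hv) (cut_bound V v 1 Hb)).
  rewrite cut_sub in Hl by auto.
  replace (comb (map _ l) v) with (comb l (cut V v)); auto.
  clear. induction l as [|[c k] l IH]; simpl; auto. rewrite IH. unfold cut.
  destruct (excluded_middle_informative (V k)); ring.
Qed.

Lemma approximable_disjoint_or (U V : K -> Prop) : approximable U -> approximable V -> (forall x, U x -> V x -> False) -> approximable (fun x => U x \/ V x).
Proof.
  intros [HU H] [HV H'] Hd. split; [apply clopen_or; auto|]. intros e He.
  destruct (H (e / 2) ltac:(lra)) as [l Hl]. destruct (H' (e / 2) ltac:(lra)) as [l' Hl'].
  exists (l ++ l'). intros v Hv Hb. rewrite cut_or by auto.
  rewrite total_plus by (apply cont_cut; auto). rewrite comb_app.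
  specialize (Hl v Hv Hb). specialize (Hl' v Hv Hb).
  replace (total (cut U v) + total (cut V v) - (comb l v + comb l' v))%C with
    ((total (cut U v) - comb l v) + (total (cut V v) - comb l' v))%C by ring.
  eapply Rle_trans; [apply Cmod_triangle|]. lra.
Qed.

Lemma approximable_empty : approximable (fun _ => False).
Proof.
  split; [apply clopen_empty; auto|]. intros e He. exists nil. intros v _ _. simpl.
  replace (cut (fun _ => False) v) with (fun _ : K => RtoC 0).
  - rewrite total_zero. replace (0 - 0)%C with (RtoC 0) by ring. rewrite Cmod_0. lra.
  - apply functional_extensionality. intros k. unfold cut. destruct (excluded_middle_informative False); tauto.
Qed.

Lemma set_ext (U V : K -> Prop) : (forall x, U x <-> V x) -> U = V.
Proof. intros H. apply functional_extensionality. intros x. apply propositional_extensionality. auto. Qed.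

Lemma approximable_union (l : list (K -> Prop)) : (forall A, In A l -> approximable A) -> approximable (fun x => exists A, In A l /\ A x).
Proof.
  induction l as [|A l IH]; intros H.
  - rewrite (set_ext _ (fun _ => False)); [apply approximable_empty|]. intros x; simpl; firstorder.
  - assert (HA := H A (or_introl eq_refl)). assert (Hl := IH (fun B HB => H B (or_intror HB))).
    rewrite (set_ext _ (fun x => A x \/ ((exists B, In B l /\ B x) /\ ~ A x))).
    + apply approximable_disjoint_or; auto; [|tauto].
      apply (approximable_sub (fun x => exists B, In B l /\ B x)); auto; [|tauto].
      apply clopen_diff; auto; [apply Hl|apply HA].
    + intros x; simpl; split.
      * intros [B [[<-|HB] Bx]]; destruct (classic (A x)); eauto.
      * intros [HA'|[[B [HB Bx]] _]]; eauto.
Qed.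

(* Otherwise one finds arbitrarily many disjointly supported functions of norm one on which [phi] is at least [e];
   rotated to make [phi] positive and added up, they contradict the boundedness of [phi]. *)
Lemma concentration (t : K) (W0 : K -> Prop) (e : R) : 0 < e -> clopen op W0 -> W0 t ->
  exists W, clopen op W /\ W t /\ (forall x, W x -> W0 x) /\
    forall (v : K -> C) V, clopen op V -> V t -> continuousC op v -> (forall k, Cmod (v k) <= 1) ->
      (forall k, ~ W k \/ V k -> v k = RtoC 0) -> Cmod (total v) <= e.
Proof.
  intros He HW0 Wt0. apply NNPP. intros Hn.
  assert (Hstep : forall W, clopen op W -> W t -> (forall x, W x -> W0 x) ->
    exists (v : K -> C) V, clopen op V /\ V t /\ (forall x, V x -> W x) /\ continuousC op v /\ (forall k, Cmod (v k) <= 1) /\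
      (forall k, ~ W k \/ V k -> v k = RtoC 0) /\ e < Cmod (total v)).
  { intros W HW Wt HWW. apply NNPP. intros Hn'. apply Hn. exists W. repeat split; try apply HW; auto.
    intros v V HV Vt Hv Hb Hz. apply Rnot_lt_le. intros Hlt. apply Hn'.
    exists v, (fun x => V x /\ W x). split; [apply clopen_and; auto|]. split; auto. split; [tauto|]. split; auto.
    split; auto. split; auto. intros k Hk. apply Hz. tauto. }
  assert (Hind : forall n W, clopen op W -> W t -> (forall x, W x -> W0 x) ->
    exists (v : K -> C) V, clopen op V /\ V t /\ (forall x, V x -> W x) /\ continuousC op v /\ (forall k, Cmod (v k) <= 1) /\
      (forall k, ~ W k \/ V k -> v k = RtoC 0) /\ INR n * e <= fst (total v)).
  { induction n as [|n IH]; intros W HW Wt HWW.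
    - exists (fun _ => RtoC 0), W. repeat split; auto; try apply HW; [apply cont_const; auto|intros; rewrite Cmod_0; lra|].
      rewrite total_zero. simpl. lra.
    - destruct (IH W HW Wt HWW) as [v [V [HV [Vt [HVW [Hv [Hb [Hz Hphi]]]]]]]].
      destruct (Hstep V HV Vt (fun x Vx => HWW x (HVW x Vx))) as [u [V' [HV' [Vt' [HVV [Hu [Hub [Huz Huphi]]]]]]]].
      set (m := Cmod (total u)) in *.
      set (c := (Cconj (total u) * RtoC (/ m))%C).
      assert (Hm : 0 < m) by lra.
      assert (Hc1 : Cmod c = 1).
      { unfold c. rewrite Cmod_mult, Cmod_conj, Cmod_R, Rabs_pos_eq by (left; apply Rinv_0_lt_compat; auto).
        fold m. field. lra. }
      assert (Hcm : (c * total u)%C = RtoC m).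
      { unfold c. replace (Cconj (total u) * RtoC (/ m) * total u)%C with ((total u * Cconj (total u)) * RtoC (/ m))%C by ring.
        rewrite <- Cmod2_conj. fold m. rewrite <- RtoC_mult. f_equal. field. lra. }
      exists (fun k => (v k + c * u k)%C), V'.
      split; auto. split; auto. split; [auto|].
      split; [apply cont_plus; auto; apply cont_scal; auto|].
      split; [|split].
      + intros k. destruct (classic (V k)) as [Vk|Vk].
        * rewrite (Hz k) by auto. replace (0 + c * u k)%C with (c * u k)%C by ring. rewrite Cmod_mult, Hc1, Rmult_1_l. auto.
        * rewrite (Huz k) by auto. replace (v k + c * 0)%C with (v k) by ring. auto.
      + intros k Hk. rewrite (Hz k), (Huz k); [ring| |].
        * destruct Hk as [Hk|Hk]; auto.
        * destruct Hk as [Hk|Hk]; auto.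
      + rewrite total_plus by (auto; apply cont_scal; auto). rewrite total_scal by auto. rewrite Hcm, S_INR. simpl. lra. }
  destruct (archimed_cor1 (e / (M + 1))) as [N [HN HN0]].
  { apply Rdiv_lt_0_compat; auto. pose proof total_norm_nonneg. lra. }
  destruct (Hind N W0 HW0 Wt0 (fun x H => H)) as [v [V [_ [_ [_ [Hv [Hb [_ Hphi]]]]]]]].
  assert (B := total_bound v 1 ltac:(lra) Hv Hb).
  pose proof (Cmod_ge_fst (total v)). pose proof (Rle_abs (fst (total v))).
  pose proof total_norm_nonneg.
  assert (HNp : 0 < INR N) by (apply lt_0_INR; auto).
  assert (M + 1 < INR N * e); [|lra].
  apply Rmult_lt_compat_l with (r := INR N * (M + 1)) in HN; [|apply Rmult_lt_0_compat; lra].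
  replace (INR N * (M + 1) * / INR N) with (M + 1) in HN by (field; lra).
  replace (INR N * (M + 1) * (e / (M + 1))) with (INR N * e) in HN by (field; lra). exact HN.
Qed.

(** [concentration] gives a neighbourhood [W] of [t] on which [phi] has almost no mass away from
    [t]. The compact rest of [W0] is covered by sets that are already approximable. *)
Lemma approximable_near_isolated (t : K) (U : K -> Prop) : op U -> U t ->
  (forall y, U y -> y <> t -> exists V, approximable V /\ V y) -> exists W, approximable W /\ W t.
Proof.
  intros HU Ut Hoth.
  destruct (zero_dimensional Htop Hcpt Hhaus Hdisp t U HU Ut) as [W0 [HW0 [Wt0 HW0U]]].
  exists W0. split; auto. split; auto. intros e He.
  destruct (concentration t W0 (e / 8) ltac:(lra) HW0 Wt0) as [W [HW [Wt [HWW Hsmall]]]].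
  assert (Hrest : approximable (fun x => W0 x /\ ~ W x)).
  { destruct (clopen_diff Htop W0 W HW0 HW) as [Hd1 Hd2].
    destruct (compact_closed_cover Hcpt (fun x => W0 x /\ ~ W x) approximable Hd2) as [l [Hl Hc]].
    - intros y [Wy0 Wy]. destruct (Hoth y) as [V [HV Vy]]; [auto|intros ->; auto|].
      exists V. split; [apply HV|]. auto.
    - apply (approximable_sub _ _ (approximable_union l Hl)); [apply clopen_diff; auto|]. exact Hc. }
  destruct (proj2 Hrest (e / 2) ltac:(lra)) as [l Hl].
  (* On [W], [phi] is replaced by the point mass at [t] with coefficient [total one]; the error is
     the value of [phi] on a function vanishing at [t]. *)
  set (one := cut W (fun _ => RtoC 1)).
  assert (Hone : continuousC op one) by (apply cont_cut; auto; apply cont_const; auto).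
  exists ((total one, t) :: l). intros v Hv Hb. simpl.
  assert (HcW : continuousC op (cut W v)) by (apply cont_cut; auto).
  assert (Hsplit : cut W0 v = fun k => (cut W v k + cut (fun x => W0 x /\ ~ W x) v k)%C).
  { rewrite <- cut_or by tauto. f_equal. apply set_ext. intros x. destruct (classic (W x)) as [Wx|Wx]; [pose proof (HWW x Wx)|]; tauto. }
  rewrite Hsplit, total_plus by (auto; apply cont_cut; auto; apply Hrest).
  specialize (Hl v Hv Hb).
  assert (HWe : Cmod (total (cut W v) - total one * v t) <= e / 2).
  { set (w := fun k => (cut W v k + (- v t) * one k)%C).
    assert (Hw : continuousC op w) by (apply cont_plus; auto; apply cont_scal; auto).
    assert (Ew : (total (cut W v) - total one * v t)%C = total w).
    { unfold w. rewrite total_plus by (auto; apply cont_scal; auto). rewrite total_scal by auto. ring. }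
    rewrite Ew.
    pose proof total_norm_nonneg as HM0.
    set (d := e / (8 * (M + 1))). assert (Hd : 0 < d) by (apply Rdiv_lt_0_compat; lra).
    destruct (Hv t d Hd) as [O [HO [Ot HOd]]].
    destruct (zero_dimensional Htop Hcpt Hhaus Hdisp t (fun x => O x /\ W x) (op_and Htop _ _ HO (proj1 HW)) (conj Ot Wt)) as [V [HV [Vt HVO]]].
    assert (Hw2 : forall k, Cmod (w k) <= 2).
    { intros k. unfold w, one, cut. destruct (excluded_middle_informative (W k)).
      - eapply Rle_trans; [apply Cmod_triangle|]. rewrite Cmod_mult, Cmod_opp, Cmod_1. pose proof (Hb k). pose proof (Hb t). lra.
      - replace (0 + - v t * 0)%C with (RtoC 0) by ring. rewrite Cmod_0. lra. }
    (* On [V] continuity at [t] makes [w] small. On the rest of [W] the concentration bound applies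
       to w / 2, which has norm at most 1. *)
    assert (Ew2 : w = fun k => (cut V w k + 2 * (/ 2 * cut (fun x => W x /\ ~ V x) w k))%C).
    { apply functional_extensionality. intros k. unfold cut at 1 2.
      destruct (excluded_middle_informative (V k)) as [Vk|Vk]; destruct (excluded_middle_informative (W k /\ ~ V k)) as [Hk|Hk].
      - exfalso; tauto.
      - ring.
      - field; apply pair_neq_re; simpl; lra.
      - unfold w, one, cut. destruct (excluded_middle_informative (W k)); [exfalso; tauto|]. ring. }
    assert (Hcd : clopen op (fun x => W x /\ ~ V x)) by (apply clopen_diff; auto).
    assert (Hc1 : continuousC op (cut V w)) by (apply cont_cut; auto).
    assert (Hc2 : continuousC op (cut (fun x => W x /\ ~ V x) w)) by (apply cont_cut; auto).
    assert (Hc3 : continuousC op (fun k => (/ 2 * cut (fun x => W x /\ ~ V x) w k)%C)) by (apply cont_scal; auto).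
    rewrite Ew2, total_plus by (auto; apply cont_scal; auto).
    rewrite (total_scal 2%C (fun k => (/ 2 * cut (fun x => W x /\ ~ V x) w k)%C)) by auto.
    assert (B1 : Cmod (total (cut V w)) <= M * d).
    { apply total_bound; auto. intros k. unfold cut at 1. destruct (excluded_middle_informative (V k)) as [Vk|Vk].
      - destruct (HVO k Vk) as [Ok Wk]. specialize (HOd k Ok). change (Cmod (v k - v t)%C < d) in HOd.
        unfold w, one, cut. destruct (excluded_middle_informative (W k)); [|contradiction].
        replace (v k + - v t * 1)%C with (v k - v t)%C by ring. lra.
      - rewrite Cmod_0. lra. }
    assert (Hh : Cmod (/ 2)%C = / 2).
    { rewrite Cmod_inv by (apply pair_neq_re; simpl; lra). rewrite Cmod_R, Rabs_pos_eq; lra. }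
    assert (B2 : Cmod (total (fun k => (/ 2 * cut (fun x => W x /\ ~ V x) w k)%C)) <= e / 8).
    { apply (Hsmall _ V); auto.
      - intros k. rewrite Cmod_mult, Hh. pose proof (cut_bound (fun x => W x /\ ~ V x) w 2 Hw2 k). lra.
      - intros k Hk. unfold cut. destruct (excluded_middle_informative (W k /\ ~ V k)); [tauto|ring]. }
    eapply Rle_trans; [apply Cmod_triangle|]. rewrite Cmod_mult.
    assert (H2 : Cmod 2%C = 2) by (rewrite Cmod_R; apply Rabs_pos_eq; lra). rewrite H2.
    assert (M * d <= e / 8); [|lra].
    apply Rle_trans with ((M + 1) * d); [nra|]. unfold d. right. field. lra. }
  replace (total (cut W v) + total (cut (fun x => W0 x /\ ~ W x) v) - (total one * v t + comb l v))%C with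
    ((total (cut W v) - total one * v t) + (total (cut (fun x => W0 x /\ ~ W x) v) - comb l v))%C by ring.
  eapply Rle_trans; [apply Cmod_triangle|]. lra.
Qed.

(** The points without an approximable neighbourhood form a perfect set, by
    [approximable_near_isolated], hence there are none; compactness then makes the whole space
    approximable. *)
Lemma functional_approx (e : R) : 0 < e ->
  exists l : list (C * K), forall x : CK op, normle x 1 -> Cmod (phi x - comb l (proj1_sig x)) <= e.
Proof.
  intros He.
  set (A := fun t => ~ exists U, approximable U /\ U t).
  assert (HA : perfect_set op A).
  { split.
    - apply (op_local Htop). intros x Hx. apply NNPP in Hx. destruct Hx as [U [HU Ux]].
      exists U. split; [apply HU|]. split; auto. intros y Uy Hn. apply Hn. eauto.
    - intros t At [_ [U [HU [Ut Hiso]]]]. apply At. apply (approximable_near_isolated t U); auto.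
      intros y Uy Hyt. apply NNPP. intros Hn. apply Hyt, Hiso; auto. }
  destruct (Hcpt approximable) as [l [Hl Hc]].
  - intros U HU. apply HU.
  - intros t. apply NNPP. exact (Hdisp A HA t).
  - destruct (approximable_union l Hl) as [_ Hg]. destruct (Hg e He) as [l' Hl'].
    exists l'. intros x Hx. specialize (Hl' (proj1_sig x) (proj2_sig x) Hx).
    replace (cut _ (proj1_sig x)) with (proj1_sig x) in Hl'.
    + rewrite total_elt in Hl'. exact Hl'.
    + apply functional_extensionality. intros k. unfold cut.
      destruct (excluded_middle_informative _) as [|n]; auto. exfalso. apply n, Hc.
Qed.
End Functional.

(** * Substituting one coordinate *)

(** The value is replaced on the whole fibre of [pi] over [k]. For a locally constant [pi] this
    fibre is clopen, so the result is continuous whatever [w] is. *)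
Definition subst_at {K : Type} (k : K) (pi : K -> K) (v : K -> C) (w : C) : K -> C :=
  fun t => if excluded_middle_informative (pi t = k) then w else v (pi t).

Definition admissible {K : Type} (op : (K -> Prop) -> Prop) (marks : list K) (pi : K -> K) : Prop :=
  (forall m, In m marks -> pi m = m) /\ (forall t, exists O, op O /\ O t /\ forall s, O s -> pi s = pi t).

Lemma subst_at_line {K : Type} (k : K) (pi : K -> K) (v u : K -> C) (w x z : C) :
  subst_at k pi (line v z u) (w + z * x) = line (subst_at k pi v w) z (subst_at k pi u x).
Proof.
  apply functional_extensionality. intros t. unfold subst_at, line.
  destruct (excluded_middle_informative (pi t = k)); reflexivity.
Qed.

Section Ghol.
Context {K : Type} {op : (K -> Prop) -> Prop} (Htop : is_topology op) (Hcpt : compact_space op).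

Lemma gopen_coord (k : K) (P : C -> Prop) :
  (forall z, P z -> exists d, 0 < d /\ forall w, Cmod (w - z) <= d -> P w) -> gopen op (fun v => P (v k)).
Proof.
  intros H v Hv. destruct (H _ Hv) as [d [Hd H']]. exists d. split; auto. intros h _ Hb. apply H'.
  replace (v k + h k - v k)%C with (h k) by ring. auto.
Qed.

Lemma gopen_and (Om Om' : (K -> C) -> Prop) : gopen op Om -> gopen op Om' -> gopen op (fun v => Om v /\ Om' v).
Proof.
  intros H H' v [Hv Hv']. destruct (H v Hv) as [r [Hr Hr']]. destruct (H' v Hv') as [s [Hs Hs']].
  exists (Rmin r s). split; [apply Rmin_pos; auto|]. intros h Hh Hb.
  pose proof (Rmin_l r s). pose proof (Rmin_r r s).
  split; [apply Hr'|apply Hs']; auto; intros k; specialize (Hb k); lra.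
Qed.

Lemma gopen_line (Om : (K -> C) -> Prop) (v u : K -> C) : gopen op Om -> Om v -> continuousC op u ->
  exists d, 0 < d /\ forall z, Cmod z < d -> Om (line v z u).
Proof.
  intros HO Hv Hu. destruct (HO v Hv) as [r Hr]. destruct (cont_bounded Hcpt u Hu) as [m [Hm Hb]].
  exists (r / m). split; [apply Rdiv_lt_0_compat; auto; apply Hr|]. intros z Hz.
  apply (line_radius (op := op) Om v u r m); auto. lra.
Qed.

(** The tool for gluing: functions below are defined by two formulas, each holomorphic on an open
    set, that agree on the overlap. *)
Lemma ghol_local (Om : (K -> C) -> Prop) (F : (K -> C) -> C) :
  (forall v, Om v -> exists Om' G, gopen op Om' /\ Om' v /\ ghol op Om' G /\ forall w, Om' w -> G w = F w) -> ghol op Om F.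
Proof.
  intros H v u Hv Hu. destruct (H v Hv) as [Om' [G [HO [Hv' [HG E]]]]].
  destruct (gopen_line Om' v u HO Hv' Hu) as [d [Hd Hl]].
  apply (cdiff_ext (fun z => G (line v z u)) _ 0%C d Hd); [|apply HG; auto].
  intros z Hz. apply E, Hl. replace (z - 0)%C with z in Hz by ring. auto.
Qed.

Lemma ghol_sub_domain (Om Om' : (K -> C) -> Prop) (F : (K -> C) -> C) :
  (forall v, Om' v -> Om v) -> ghol op Om F -> ghol op Om' F.
Proof. intros H HF v u Hv Hu. apply HF; auto. Qed.

Lemma ghol_const (Om : (K -> C) -> Prop) (c : C) : ghol op Om (fun _ => c).
Proof. intros v u _ _. apply cdiff_const. Qed.

Lemma ghol_eval (Om : (K -> C) -> Prop) (k : K) : ghol op Om (fun v => v k).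
Proof.
  intros v u _ _. unfold line. apply cdiff_plus; [apply cdiff_const|]. apply cdiff_mult; [apply cdiff_id|apply cdiff_const].
Qed.

Lemma ghol_plus (Om : (K -> C) -> Prop) (F G : (K -> C) -> C) : ghol op Om F -> ghol op Om G -> ghol op Om (fun v => F v + G v)%C.
Proof. intros HF HG v u Hv Hu. apply cdiff_plus; [apply HF|apply HG]; auto. Qed.

Lemma ghol_mult (Om : (K -> C) -> Prop) (F G : (K -> C) -> C) : ghol op Om F -> ghol op Om G -> ghol op Om (fun v => F v * G v)%C.
Proof. intros HF HG v u Hv Hu. apply cdiff_mult; [apply HF|apply HG]; auto. Qed.

Lemma ghol_minus (Om : (K -> C) -> Prop) (F G : (K -> C) -> C) : ghol op Om F -> ghol op Om G -> ghol op Om (fun v => F v - G v)%C.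
Proof. intros HF HG v u Hv Hu. apply cdiff_minus; [apply HF|apply HG]; auto. Qed.

Lemma ghol_div (Om : (K -> C) -> Prop) (F G : (K -> C) -> C) : ghol op Om F -> ghol op Om G ->
  (forall v, Om v -> G v <> 0%C) -> ghol op Om (fun v => F v / G v)%C.
Proof. intros HF HG Hn v u Hv Hu. apply cdiff_div; [apply HF|apply HG|rewrite line_0]; auto. Qed.

(** [S] is affine with linear part [S']. Phrased through [line], this covers substituting either a
    constant or a multiple of the coordinate itself. *)
Lemma ghol_comp_affine (Om Om' : (K -> C) -> Prop) (F : (K -> C) -> C) (S S' : (K -> C) -> K -> C) :
  (forall v z u, S (line v z u) = line (S v) z (S' u)) -> (forall u, continuousC op (S' u)) ->
  (forall v, Om' v -> Om (S v)) -> ghol op Om F -> ghol op Om' (fun v => F (S v)).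
Proof.
  intros HS HS' HO HF v u Hv Hu.
  apply (cdiff_ext (fun z => F (line (S v) z (S' u))) _ 0%C 1 ltac:(lra)); [intros z _; rewrite HS; auto|].
  apply HF; auto.
Qed.

(** Montel's theorem along an ultrafilter: uniform bounds give pointwise limits, and [cdiff_ulim]
    makes them holomorphic on each line. *)
Lemma ghol_ulim {I : Type} {U : (I -> Prop) -> Prop} (HU : ultrafilter U) (Om : (K -> C) -> Prop)
  (F : I -> (K -> C) -> C) (M : R) : gopen op Om -> 0 <= M ->
  U (fun i => ghol op Om (F i) /\ bounded_on Om (F i) M) ->
  ghol op Om (fun v => ulim U (fun i => F i v)) /\ bounded_on Om (fun v => ulim U (fun i => F i v)) M /\
  forall v, Om v -> is_ulim (U := U) (fun i => F i v) (ulim U (fun i => F i v)).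
Proof.
  intros HO HM HF.
  assert (Hlim : forall v, Om v -> is_ulim (U := U) (fun i => F i v) (ulim U (fun i => F i v))).
  { intros v Hv. apply (ulim_spec HU _ M). apply (ultra_mp HU _ _ HF). intros i [_ Hi]. apply Hi, Hv. }
  split; [|split]; auto.
  - intros v u Hv Hu. destruct (gopen_line Om v u HO Hv Hu) as [d [Hd Hl]].
    apply (cdiff_ulim HU (fun i z => F i (line v z u)) _ d M Hd HM).
    + apply (ultra_mp HU _ _ HF). intros i [Hi1 Hi2] z Hz. split; [|apply Hi2; auto].
      apply (ghol_line (op := op) Om); auto.
    + intros z Hz. apply Hlim; auto.
  - intros v Hv. apply (is_ulim_le HU (fun i => F i v)); auto. apply (ultra_mp HU _ _ HF). intros i [_ Hi]. apply Hi, Hv.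
Qed.

Lemma ghol_integral (Om : (K -> C) -> Prop) (q : R -> (K -> C) -> C) (J : (K -> C) -> C) (a b M : R) :
  gopen op Om -> a <= b -> 0 <= M ->
  (forall t, a <= t <= b -> ghol op Om (q t) /\ bounded_on Om (q t) M) ->
  (forall v, Om v -> isCI (fun t => q t v) a b (J v)) -> ghol op Om J.
Proof.
  intros HO Hab HM Hq HJ v u Hv Hu. destruct (gopen_line Om v u HO Hv Hu) as [d [Hd Hl]].
  apply (cdiff_integral (fun t z => q t (line v z u)) _ a b d M); auto.
  intros t Ht z Hz. destruct (Hq t Ht) as [H1 H2]. split; [|apply H2; auto]. apply (ghol_line (op := op) Om); auto.
Qed.

Lemma ghol_Hor (Om : (K -> C) -> Prop) (H : C -> (K -> C) -> C) (y a b M : R) : gopen op Om -> a <= b -> 0 <= M ->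
  (forall x, a <= x <= b -> ghol op Om (H (x, y)) /\ bounded_on Om (H (x, y)) M /\
     forall v, Om v -> ccont (fun s => H s v) (x, y)) ->
  ghol op Om (fun v => Hor (fun s => H s v) y a b).
Proof.
  intros HO Hab HM HH. apply (ghol_integral Om (fun x => H (x, y)) _ a b M); auto.
  - intros x Hx. destruct (HH x Hx) as [? [? ?]]; auto.
  - intros v Hv. apply (CI_correct (fun x => H (x, y) v)), (ex_Hor (fun s => H s v)); auto.
    intros x Hx. apply (HH x Hx); auto.
Qed.

Lemma ghol_Ver (Om : (K -> C) -> Prop) (H : C -> (K -> C) -> C) (x a b M : R) : gopen op Om -> a <= b -> 0 <= M ->
  (forall y, a <= y <= b -> ghol op Om (H (x, y)) /\ bounded_on Om (H (x, y)) M /\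
     forall v, Om v -> ccont (fun s => H s v) (x, y)) ->
  ghol op Om (fun v => Ver (fun s => H s v) x a b).
Proof.
  intros HO Hab HM HH. apply (ghol_integral Om (fun y => H (x, y)) _ a b M); auto.
  - intros y Hy. destruct (HH y Hy) as [? [? ?]]; auto.
  - intros v Hv. apply (CI_correct (fun y => H (x, y) v)), (ex_Ver (fun s => H s v)); auto.
    intros y Hy. apply (HH y Hy); auto.
Qed.

Lemma ghol_Rect (Om : (K -> C) -> Prop) (H : C -> (K -> C) -> C) (x0 x1 y0 y1 M : R) : gopen op Om ->
  x0 <= x1 -> y0 <= y1 -> 0 <= M ->
  (forall s, on_sides x0 x1 y0 y1 s -> ghol op Om (H s) /\ bounded_on Om (H s) M /\
     forall v, Om v -> ccont (fun s => H s v) s) ->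
  ghol op Om (fun v => Rect (fun s => H s v) x0 x1 y0 y1).
Proof.
  intros HO Hx Hy HM HH. unfold Rect.
  apply ghol_plus; [apply ghol_minus|apply ghol_mult; [apply ghol_const|apply ghol_minus]].
  - apply (ghol_Hor Om H _ _ _ M); auto. intros t Ht; apply HH; unfold on_sides; simpl; auto.
  - apply (ghol_Hor Om H _ _ _ M); auto. intros t Ht; apply HH; unfold on_sides; simpl; auto.
  - apply (ghol_Ver Om H _ _ _ M); auto. intros t Ht; apply HH; unfold on_sides; simpl; auto.
  - apply (ghol_Ver Om H _ _ _ M); auto. intros t Ht; apply HH; unfold on_sides; simpl; auto.
Qed.

Lemma subst_at_cont (k : K) (marks : list K) (pi : K -> K) (v : K -> C) (w : C) : admissible op marks pi -> continuousC op (subst_at k pi v w).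
Proof.
  intros [_ H]. exact (cont_locally_constant_comp pi (fun t => if excluded_middle_informative (t = k) then w else v t) H).
Qed.

Lemma subst_at_ball (k : K) (marks : list K) (pi : K -> K) (v : K -> C) (w : C) : admissible op marks pi ->
  unit_ball op v -> Cmod w < 1 -> unit_ball op (subst_at k pi v w).
Proof.
  intros Hpi [_ [r [Hr Hb]]] Hw. split; [apply (subst_at_cont k marks); auto|].
  exists (Rmax r (Cmod w)). split; [apply Rmax_lub_lt; auto|]. intros t. unfold subst_at.
  destruct (excluded_middle_informative (pi t = k)); [apply Rmax_r|].
  eapply Rle_trans; [apply Hb|apply Rmax_l].
Qed.

Lemma subst_at_self (k : K) (marks : list K) (pi : K -> K) (v : K -> C) (w : C) : admissible op marks pi -> In k marks ->
  subst_at k pi v w k = w.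
Proof.
  intros [H _] Hk. unfold subst_at. rewrite (H k Hk). destruct (excluded_middle_informative (k = k)); congruence.
Qed.

Lemma subst_at_other (k m : K) (marks : list K) (pi : K -> K) (v : K -> C) (w : C) : admissible op marks pi -> In m marks -> m <> k ->
  subst_at k pi v w m = v m.
Proof.
  intros [H _] Hm Hn. unfold subst_at. rewrite (H m Hm). destruct (excluded_middle_informative (m = k)); congruence.
Qed.

Lemma cdiff_subst_at (Om : (K -> C) -> Prop) (F : (K -> C) -> C) (k : K) (marks : list K) (pi : K -> K) (v : K -> C) (s : C) :
  admissible op marks pi -> ghol op Om F -> Om (subst_at k pi v s) -> cdiff (fun s => F (subst_at k pi v s)) s.
Proof.
  intros Hpi HF Hs.
  (* Varying [s] is moving along a line whose direction is the indicator function of the fibre of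
     [pi] over [k]. *)
  assert (H := HF _ (subst_at k pi (fun _ => RtoC 0) 1%C) Hs (subst_at_cont k marks pi _ _ Hpi)).
  set (G := fun z => F (line (subst_at k pi v s) z (subst_at k pi (fun _ => RtoC 0) 1%C))) in H.
  assert (E : (fun s => F (subst_at k pi v s)) = (fun w => G (- s + w * 1)%C)).
  { apply functional_extensionality. intros w. unfold G. f_equal. apply functional_extensionality. intros t.
    unfold line, subst_at. destruct (excluded_middle_informative (pi t = k)); ring. }
  rewrite E. apply (cdiff_affine G). replace (- s + s * 1)%C with (RtoC 0) by ring. exact H.
Qed.

Context (Hhaus : hausdorff op) (Hdisp : dispersed op).

(** An index is a retraction paired with a radius. Along the ultrafilter every continuous [x] is the
    uniform limit of its compositions with the retractions, and the radius tends to 1 from below;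
    the radius serves at boundary values, to pull the coordinate into the open disc. *)
Lemma retraction_ultrafilter (marks : list K) : exists U : ((K -> K) * R -> Prop) -> Prop, ultrafilter U /\
  forall x e, continuousC op x -> 0 < e -> U (fun i => admissible op marks (fst i) /\
    (forall t, Cmod (x (fst i t) - x t) <= e) /\ 0 < snd i /\ 1 - e < snd i < 1).
Proof.
  set (B := fun (xs : list (K -> C)) (e : R) (i : (K -> K) * R) => admissible op marks (fst i) /\
    (forall x t, In x xs -> Cmod (x (fst i t) - x t) <= e) /\ 0 < snd i /\ 1 - e < snd i < 1).
  destruct (ultrafilter_extends (fun A => exists xs e, 0 < e /\ (forall x, In x xs -> continuousC op x) /\ A = B xs e)) as [U [HU HB]].
  - exists (B nil 1), nil, 1. split; [lra|]. split; auto. intros x [].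
  - intros A [xs [e [He [Hxs ->]]]].
    destruct (finite_retraction Htop Hcpt Hhaus Hdisp marks xs e He Hxs) as [pi [H1 [H2 H3]]].
    exists (pi, 1 - Rmin e 1 / 2). unfold B, admissible; simpl.
    pose proof (Rmin_l e 1). pose proof (Rmin_r e 1). assert (0 < Rmin e 1) by (apply Rmin_pos; lra).
    repeat split; auto; lra.
  - intros A A' [xs [e [He [Hxs ->]]]] [xs' [e' [He' [Hxs' ->]]]].
    exists (B (xs ++ xs') (Rmin e e')). split.
    + exists (xs ++ xs'), (Rmin e e'). split; [apply Rmin_pos; auto|]. split; auto.
      intros x Hx. apply in_app_or in Hx. destruct Hx; auto.
    + pose proof (Rmin_l e e'). pose proof (Rmin_r e e').
      intros i [H1 [H2 H3]]. split; (split; [auto|]; split; [|lra]); intros x t Hx;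
        (eapply Rle_trans; [apply H2, in_or_app; auto|auto]).
  - exists U. split; auto. intros x e Hx He.
    apply (ultra_mp HU (B (x :: nil) e)).
    + apply HB. exists (x :: nil), e. split; auto. split; auto. intros y [<-|[]]; auto.
    + intros i [H1 [H2 H3]]. split; auto. split; [|lra]. intros t. apply H2. left; auto.
Qed.

(** The substituted function is within 2 e of [v] in norm: one e comes from the retraction, one from
    [w i] approaching [v k]. The Lipschitz bound on [F] does the rest. *)
Lemma subst_at_limit (Om : (K -> C) -> Prop) (F : (K -> C) -> C) (M : R) (k : K) (marks : list K)
  (U : ((K -> K) * R -> Prop) -> Prop) (w : (K -> K) * R -> C) (v : K -> C) :
  ultrafilter U ->
  (forall x e, continuousC op x -> 0 < e -> U (fun i => admissible op marks (fst i) /\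
    (forall t, Cmod (x (fst i t) - x t) <= e) /\ 0 < snd i /\ 1 - e < snd i < 1)) ->
  gopen op Om -> ghol op Om F -> bounded_on Om F M -> Om v -> continuousC op v ->
  (forall i e, 0 < snd i -> 1 - e < snd i < 1 -> Cmod (w i - v k) <= e) ->
  is_ulim (U := U) (fun i => F (subst_at k (fst i) v (w i))) (F v).
Proof.
  intros HU HB HO HF HM Hv Hc Hw eps Heps.
  destruct (HO v Hv) as [r Hr]. pose proof (proj1 Hr) as Hr0.
  assert (HM0 := bounded_on_nonneg Om F v M HM Hv).
  (* With this choice 2 e < r / 4 and the Lipschitz bound 64 M e / r is at most eps / 2; M + 1
     avoids a division by zero. *)
  set (e := Rmin (r / 16) (eps * r / (128 * (M + 1)))).
  assert (He : 0 < e) by (apply Rmin_pos; [lra|]; apply Rdiv_lt_0_compat; nra).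
  assert (He1 : e <= r / 16) by apply Rmin_l. assert (He2 : e <= eps * r / (128 * (M + 1))) by apply Rmin_r.
  apply (ultra_mp HU _ _ (HB v e Hc He)). intros i [Hpi [Hosc [Hs0 Hs]]].
  specialize (Hw i e Hs0 Hs).
  set (h := fun t => (subst_at k (fst i) v (w i) t - v t)%C).
  assert (E : subst_at k (fst i) v (w i) = fun t => (v t + h t)%C).
  { apply functional_extensionality. intros t. unfold h. ring. }
  rewrite E.
  eapply Rle_lt_trans; [apply (ghol_lipschitz (op := op) Om F v h r (2 * e) M); auto; try lra|].
  - unfold h. replace (fun t => (subst_at k (fst i) v (w i) t - v t)%C) with (fun t => (subst_at k (fst i) v (w i) t + (-(1)) * v t)%C)
      by (apply functional_extensionality; intros; ring).
    apply cont_plus; auto; [apply (subst_at_cont k marks); auto|apply cont_scal; auto].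
  - intros t. unfold h, subst_at. specialize (Hosc t). destruct (excluded_middle_informative (fst i t = k)) as [Ek|Ek].
    + rewrite Ek in Hosc. replace (w i - v t)%C with ((w i - v k) + (v k - v t))%C by ring.
      eapply Rle_trans; [apply Cmod_triangle|]. lra.
    + lra.
  - apply Rle_lt_trans with (32 * M / r * (2 * (eps * r / (128 * (M + 1))))).
    + apply Rmult_le_compat_l; [|lra]. apply Rmult_le_pos; [lra|left; apply Rinv_0_lt_compat; auto].
    + replace (32 * M / r * (2 * (eps * r / (128 * (M + 1))))) with (eps / 2 * (M / (M + 1))) by (field; lra).
      assert (M / (M + 1) <= 1). { apply Rmult_le_reg_r with (M + 1); [lra|]. replace (M / (M + 1) * (M + 1)) with M by (field; lra). lra. }
      assert (0 <= M / (M + 1)). { apply Rmult_le_pos; auto. left. apply Rinv_0_lt_compat. lra. }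
      nra.
Qed.

End Ghol.

Lemma sides_shift (a s : C) (h : R) :
  on_sides (fst a - h) (fst a + h) (snd a - h) (snd a + h) s -> on_sides (- h) h (- h) h (s - a)%C.
Proof. unfold on_sides. simpl. intros [[? [?|?]]|[? [?|?]]]; [left|left|right|right]; split; lra. Qed.

Lemma rect_shift (a s : C) (h : R) :
  in_rect (fst a - h) (fst a + h) (snd a - h) (snd a + h) s -> in_rect (- h) h (- h) h (s - a)%C.
Proof. unfold in_rect. simpl. lra. Qed.

Lemma sub_neq_0 (s z : C) : s <> z -> (s - z)%C <> 0%C.
Proof. intros H E. apply H. replace s with ((s - z) + z)%C by ring. rewrite E. ring. Qed.

Lemma Cmod_sub_neq (s z : C) : 0 < Cmod (s - z) -> s <> z.
Proof. intros H ->. replace (z - z)%C with (RtoC 0) in H by ring. rewrite Cmod_0 in H. lra. Qed.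

(** * Difference quotients at an interior point of the disc *)

Section Square.
Context (a : C) (Ha : Cmod a < 1).
(** The square of half-side [h] lies in the open disc of radius 2 h about [a], hence in the unit
    disc. *)
Let h := (1 - Cmod a) / 2.
Let Q (H : C -> C) : C := Rect H (fst a - h) (fst a + h) (snd a - h) (snd a + h).

Lemma square_half_pos : 0 < h.
Proof. unfold h. lra. Qed.

Lemma square_in_disc (s : C) : in_rect (fst a - h) (fst a + h) (snd a - h) (snd a + h) s -> Cmod s < 1.
Proof.
  intros Hs. apply rect_shift in Hs. apply (Cmod_rect_le h _ square_half_pos) in Hs.
  replace s with ((s - a) + a)%C by ring. eapply Rle_lt_trans; [apply Cmod_triangle|]. unfold h in *. lra.
Qed.

Lemma square_side_dist (s : C) : on_sides (fst a - h) (fst a + h) (snd a - h) (snd a + h) s -> h <= Cmod (s - a).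
Proof. intros Hs. apply sides_shift in Hs. apply (Cmod_sides_ge h _ square_half_pos Hs). Qed.

Lemma square_sides_in_disc (s : C) : on_sides (fst a - h) (fst a + h) (snd a - h) (snd a + h) s -> Cmod s < 1.
Proof.
  intros Hs. apply square_in_disc. pose proof square_half_pos. apply on_sides_in_rect; auto; lra.
Qed.

Lemma square_side_dist' (s z : C) (d : R) : Cmod (z - a) <= h - d ->
  on_sides (fst a - h) (fst a + h) (snd a - h) (snd a + h) s -> d <= Cmod (s - z).
Proof.
  intros Hz Hs. apply square_side_dist in Hs.
  assert (Cmod (s - a) <= Cmod (s - z) + Cmod (z - a)); [|lra].
  replace (s - a)%C with ((s - z) + (z - a))%C by ring. apply Cmod_triangle.
Qed.

(** Partial fractions turn the kernel into a difference of two Cauchy kernels divided by z - a. The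
    integral keeps its meaning at z = a, where the quotient does not. *)
Lemma square_quotient (G : C -> C) (z : C) : (forall s, Cmod s < 1 -> cdiff G s) ->
  Cmod (z - a) < h -> z <> a ->
  (inv_2pi_i * Q (fun s => G s / ((s - a) * (s - z))))%C = ((G z - G a) / (z - a))%C.
Proof.
  intros HG Hz Hza. pose proof square_half_pos as Hh.
  assert (Hzh : forall s, on_sides (fst a - h) (fst a + h) (snd a - h) (snd a + h) s -> s <> z).
  { intros s Hs. apply Cmod_sub_neq.
    assert (D := square_side_dist' s z (h - Cmod (z - a)) ltac:(lra) Hs). lra. }
  assert (Hah : forall s, on_sides (fst a - h) (fst a + h) (snd a - h) (snd a + h) s -> s <> a).
  { intros s Hs. apply Cmod_sub_neq. assert (D := square_side_dist s Hs). lra. }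
  assert (HC : forall w, (forall s, on_sides (fst a - h) (fst a + h) (snd a - h) (snd a + h) s -> s <> w) ->
     forall s, on_sides (fst a - h) (fst a + h) (snd a - h) (snd a + h) s -> ccont (fun s => G s / (s - w))%C s).
  { intros w Hw s Hs. apply cdiff_ccont, cdiff_div; [apply HG, square_sides_in_disc, Hs| |apply sub_neq_0; auto].
    apply cdiff_minus; auto using cdiff_id, cdiff_const. }
  unfold Q.
  rewrite (Rect_ext _ (fun s => / (z - a) * (G s / (s - z) + (-(1)) * (G s / (s - a))))%C); try lra.
  2:{ intros s Hs. pose proof (sub_neq_0 _ _ (Hzh s Hs)). pose proof (sub_neq_0 _ _ (Hah s Hs)). pose proof (sub_neq_0 _ _ Hza).
      field. auto. }
  rewrite Rect_mult; try lra.
  2:{ intros s Hs. apply ccont_plus; [apply HC; auto|]. apply ccont_mult; [apply ccont_const|apply HC; auto]. }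
  rewrite Rect_plus; try lra.
  2:{ apply HC; auto. }
  2:{ intros s Hs. apply ccont_mult; [apply ccont_const|apply HC; auto]. }
  rewrite Rect_mult; try lra.
  2:{ apply HC; auto. }
  assert (HR : forall w, Cmod (w - a) < h -> (inv_2pi_i * Rect (fun s => G s / (s - w)) (fst a - h) (fst a + h) (snd a - h) (snd a + h))%C = G w).
  { intros w Hw. pose proof (Cmod_ge_fst (w - a)) as G1. pose proof (Cmod_ge_snd (w - a)) as G2.
    assert (A1 : Rabs (fst (w - a)%C) < h) by lra. assert (A2 : Rabs (snd (w - a)%C) < h) by lra.
    apply Rabs_lt_between in A1. apply Rabs_lt_between in A2. simpl in A1, A2.
    apply cauchy_formula; [lra|lra|]. intros s Hs. apply HG, square_in_disc, Hs. }
  assert (H1 := HR z Hz). assert (H2 : Cmod (a - a) < h).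
  { replace (a - a)%C with (RtoC 0) by ring. rewrite Cmod_0. auto. }
  apply HR in H2.
  transitivity (/ (z - a) * (inv_2pi_i * Rect (fun s => (G s / (s - z))%C) (fst a - h) (fst a + h) (snd a - h) (snd a + h)
     - inv_2pi_i * Rect (fun s => (G s / (s - a))%C) (fst a - h) (fst a + h) (snd a - h) (snd a + h)))%C; [ring|].
  rewrite H1, H2. unfold Cdiv. ring.
Qed.

Lemma square_integral_bound (G : C -> C) (z : C) (M : R) : (forall s, Cmod s < 1 -> cdiff G s /\ Cmod (G s) <= M) ->
  Cmod (z - a) < h / 2 -> Cmod (inv_2pi_i * Q (fun s => G s / ((s - a) * (s - z)))%C) <= 16 * M / h.
Proof.
  intros HG Hz. pose proof square_half_pos as Hh. unfold Q.
  assert (Hd : forall s, on_sides (fst a - h) (fst a + h) (snd a - h) (snd a + h) s -> h <= Cmod (s - a) /\ h / 2 <= Cmod (s - z)).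
  { intros s Hs. split; [apply square_side_dist; auto|apply square_side_dist'; auto; lra]. }
  assert (HB : Cmod (Rect (fun s => G s / ((s - a) * (s - z)))%C (fst a - h) (fst a + h) (snd a - h) (snd a + h)) <=
     2 * ((fst a + h - (fst a - h)) + (snd a + h - (snd a - h))) * (M * (/ h * / (h / 2)))).
  { apply Rect_bound; try lra.
    - intros s Hs. destruct (Hd s Hs). apply cdiff_ccont, cdiff_div.
      + apply HG, square_sides_in_disc, Hs.
      + apply cdiff_mult; apply cdiff_minus; auto using cdiff_id, cdiff_const.
      + apply Cmult_neq_0; apply Cmod_gt_0; lra.
    - intros s Hs. destruct (Hd s Hs).
      rewrite Cmod_div by (apply Cmult_neq_0; apply Cmod_gt_0; lra).
      unfold Rdiv. apply Rmult_le_compat; try apply Cmod_ge_0.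
      + left. apply Rinv_0_lt_compat. rewrite Cmod_mult. apply Rmult_lt_0_compat; lra.
      + apply HG, square_sides_in_disc, Hs.
      + rewrite Cmod_mult, Rinv_mult. apply Rmult_le_compat; try (left; apply Rinv_0_lt_compat; lra); apply inv_le; lra. }
  replace (2 * (fst a + h - (fst a - h) + (snd a + h - (snd a - h))) * (M * (/ h * / (h / 2)))) with (16 * M / h) in HB by (field; lra).
  rewrite Cmod_mult. pose proof inv_2pi_i_small. pose proof (Cmod_ge_0 inv_2pi_i).
  pose proof (Cmod_ge_0 (Rect (fun s => G s / ((s - a) * (s - z)))%C (fst a - h) (fst a + h) (snd a - h) (snd a + h))). nra.
Qed.
End Square.

(** * Freezing a coordinate of modulus less than one *)

Section Interior.
Context {K : Type} {op : (K -> Prop) -> Prop} (Htop : is_topology op) (Hcpt : compact_space op).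

(** The quotient [q] is bounded where v k stays away from [a], the Cauchy integral [J] where it is
    near; they agree in between, so together they cross v k = a holomorphically. The bound does not
    involve [pi], as the limit over retractions requires. *)
Lemma interior_quotient (F : (K -> C) -> C) (M : R) (k : K) (marks : list K) (pi : K -> K) (a : C) :
  ghol op (unit_ball op) F -> bounded_on (unit_ball op) F M -> 0 <= M -> admissible op marks pi -> In k marks -> Cmod a < 1 ->
  exists g, ghol op (unit_ball op) g /\ bounded_on (unit_ball op) g (16 * M / ((1 - Cmod a) / 2)) /\
    forall v, unit_ball op v -> F (subst_at k pi v (v k)) = (F (subst_at k pi v a) + (v k - a) * g v)%C.
Proof.
  intros HF HM HM0 Hpi Hk Ha. set (h := (1 - Cmod a) / 2).
  assert (Hh : 0 < h) by (unfold h; lra).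
  assert (Hball : forall v, unit_ball op v -> Cmod (v k) < 1).
  { intros v [_ [r [Hr Hb]]]. eapply Rle_lt_trans; [apply Hb|auto]. }
  assert (HG : forall v, unit_ball op v -> forall s, Cmod s < 1 -> cdiff (fun s => F (subst_at k pi v s)) s /\ Cmod (F (subst_at k pi v s)) <= M).
  { intros v Hv s Hs. assert (unit_ball op (subst_at k pi v s)) by (apply (subst_at_ball k marks); auto).
    split; [apply (cdiff_subst_at (op := op) (unit_ball op) F k marks); auto|apply HM; auto]. }
  set (J := fun v : K -> C => (inv_2pi_i * Rect (fun s => F (subst_at k pi v s) / ((s - a) * (s - v k))) (fst a - h) (fst a + h) (snd a - h) (snd a + h))%C).
  set (q := fun v : K -> C => ((F (subst_at k pi v (v k)) - F (subst_at k pi v a)) / (v k - a))%C).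
  assert (Hsubc : forall s, Cmod s < 1 -> ghol op (unit_ball op) (fun v => F (subst_at k pi v s))).
  { intros s Hs. apply (ghol_comp_affine (unit_ball op) (unit_ball op) F (fun v => subst_at k pi v s) (fun u => subst_at k pi u 0%C)).
    - intros v z u. rewrite <- subst_at_line. f_equal. ring.
    - intros u. apply (subst_at_cont k marks); auto.
    - intros v Hv. apply (subst_at_ball k marks); auto.
    - exact HF. }
  assert (Hsubk : ghol op (unit_ball op) (fun v => F (subst_at k pi v (v k)))).
  { apply (ghol_comp_affine (unit_ball op) (unit_ball op) F (fun v => subst_at k pi v (v k)) (fun u => subst_at k pi u (u k))).
    - intros v z u. rewrite <- subst_at_line. reflexivity.
    - intros u. apply (subst_at_cont k marks); auto.
    - intros v Hv. apply (subst_at_ball k marks); auto.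
    - exact HF. }
  exists (fun v => if Rlt_dec (Cmod (v k - a)) (h / 2) then J v else q v).
  split; [|split].
  - apply (ghol_local Hcpt). intros v Hv.
    destruct (Rlt_dec (Cmod (v k - a)) (h / 2)) as [Hlt|Hge].
    + exists (fun w => unit_ball op w /\ Cmod (w k - a) < h / 2), J.
      assert (HO : gopen op (fun w => unit_ball op w /\ Cmod (w k - a) < h / 2)).
      { apply gopen_and; [apply gopen_ball; auto|]. apply (gopen_coord k (fun z => Cmod (z - a) < h / 2)).
        intros z Hz. exists ((h / 2 - Cmod (z - a)) / 2). split; [lra|]. intros w Hw.
        replace (w - a)%C with ((w - z) + (z - a))%C by ring. eapply Rle_lt_trans; [apply Cmod_triangle|]. lra. }
      split; [exact HO|]. split; [auto|]. split.
      * unfold J. apply ghol_mult; [apply ghol_const|].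
        apply (ghol_Rect Hcpt _ (fun s v => F (subst_at k pi v s) / ((s - a) * (s - v k)))%C _ _ _ _ (M * (/ h * / (h / 2)))); auto; try lra.
        { apply Rmult_le_pos; auto. apply Rmult_le_pos; left; apply Rinv_0_lt_compat; lra. }
        intros s Hs. assert (Hs1 := square_sides_in_disc a Ha s Hs). assert (D1 := square_side_dist a Ha s Hs). fold h in D1.
        assert (D2 : forall w, Cmod (w - a) < h / 2 -> h / 2 <= Cmod (s - w)).
        { intros w Hw. apply (square_side_dist' a Ha); auto. fold h. lra. }
        assert (Hn : forall w, Cmod (w - a) < h / 2 -> ((s - a) * (s - w))%C <> 0%C).
        { intros w Hw. specialize (D2 w Hw). apply Cmult_neq_0; apply Cmod_gt_0; lra. }
        split; [|split].
        -- apply ghol_div.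
           ++ apply (ghol_sub_domain (unit_ball op)); [tauto|auto].
           ++ apply ghol_mult; [apply ghol_const|]. apply ghol_minus; [apply ghol_const|apply ghol_eval].
           ++ intros w [_ Hw]. apply Hn; auto.
        -- intros w [Hwb Hw]. specialize (D2 _ Hw). rewrite Cmod_div by (apply Hn; auto).
           unfold Rdiv. apply Rmult_le_compat; try apply Cmod_ge_0.
           ++ left. apply Rinv_0_lt_compat. rewrite Cmod_mult. apply Rmult_lt_0_compat; lra.
           ++ apply HG; auto.
           ++ rewrite Cmod_mult, Rinv_mult. apply Rmult_le_compat; try (left; apply Rinv_0_lt_compat; lra); apply inv_le; lra.
        -- intros w [Hwb Hw]. apply cdiff_ccont. apply (cdiff_div (fun s => F (subst_at k pi w s)) (fun s => (s - a) * (s - w k))%C).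
           ++ apply HG; auto.
           ++ apply cdiff_mult; apply cdiff_minus; auto using cdiff_id, cdiff_const.
           ++ apply Hn; auto.
      * intros w [_ Hw]. destruct (Rlt_dec (Cmod (w k - a)) (h / 2)); [auto|lra].
    (* This open set reaches below the switching radius h / 2, so that it contains a neighbourhood
       of the circle where the definition changes; there [J] and [q] coincide. *)
    + exists (fun w => unit_ball op w /\ h / 4 < Cmod (w k - a)), q.
      assert (HO : gopen op (fun w => unit_ball op w /\ h / 4 < Cmod (w k - a))).
      { apply gopen_and; [apply gopen_ball; auto|]. apply (gopen_coord k (fun z => h / 4 < Cmod (z - a))).
        intros z Hz. exists ((Cmod (z - a) - h / 4) / 2). split; [lra|]. intros w Hw.
        assert (Cmod (z - a) <= Cmod (w - z) + Cmod (w - a)); [|lra].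
        replace (z - a)%C with (- (w - z) + (w - a))%C by ring. eapply Rle_trans; [apply Cmod_triangle|]. rewrite Cmod_opp. lra. }
      split; [exact HO|]. split; [split; auto; lra|]. split.
      * unfold q. apply ghol_div.
        -- apply (ghol_sub_domain (unit_ball op)); [tauto|]. apply ghol_minus; auto.
        -- apply ghol_minus; [apply ghol_eval|apply ghol_const].
        -- intros w [_ Hw]. apply Cmod_gt_0. lra.
      * intros w [Hwb Hw]. destruct (Rlt_dec (Cmod (w k - a)) (h / 2)) as [Hl|]; auto.
        symmetry. unfold J, q. apply (square_quotient a Ha (fun s => F (subst_at k pi w s)) (w k)).
        -- intros s Hs. apply HG; auto.
        -- fold h. lra.
        -- apply Cmod_sub_neq. lra.
  - intros v Hv. destruct (Rlt_dec (Cmod (v k - a)) (h / 2)) as [Hlt|Hge].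
    + apply (square_integral_bound a Ha (fun s => F (subst_at k pi v s)) (v k) M); auto.
    + unfold q. assert (Hn : (v k - a)%C <> 0%C) by (apply Cmod_gt_0; lra).
      rewrite Cmod_div by auto.
      assert (HN : Cmod (F (subst_at k pi v (v k)) - F (subst_at k pi v a)) <= 2 * M).
      { unfold Cminus. eapply Rle_trans; [apply Cmod_triangle|]. rewrite Cmod_opp.
        pose proof (proj2 (HG v Hv (v k) (Hball v Hv))). pose proof (proj2 (HG v Hv a Ha)). lra. }
      apply Rle_trans with (2 * M * / (h / 2)).
      * unfold Rdiv at 1. apply Rmult_le_compat; try apply Cmod_ge_0; auto.
        -- left. apply Rinv_0_lt_compat. lra.
        -- apply inv_le; lra.
      * replace (2 * M * / (h / 2)) with (4 * (M * / h)) by (field; lra).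
        replace (16 * M / h) with (16 * (M * / h)) by (field; lra).
        assert (0 <= M * / h) by (apply Rmult_le_pos; auto; left; apply Rinv_0_lt_compat; auto). lra.
  - intros v Hv. destruct (Ceq_dec (v k) a) as [E|Hn].
    + rewrite E. ring.
    + assert (Eq : (if Rlt_dec (Cmod (v k - a)) (h / 2) then J v else q v) = q v).
      { destruct (Rlt_dec (Cmod (v k - a)) (h / 2)) as [Hl|]; auto.
        apply (square_quotient a Ha (fun s => F (subst_at k pi v s)) (v k)); auto; [intros s Hs; apply HG; auto|fold h; lra]. }
      rewrite Eq. unfold q. field. apply sub_neq_0. auto.
Qed.

Context (Hhaus : hausdorff op) (Hdisp : dispersed op).

(** [F0 v] is a limit of values of [F] at points whose coordinate [k] equals [a] and whose other
    marked coordinates are those of [v]. Hence a lower bound for [F] under a constraint at [k]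
    becomes one for [F0] without it, which is the last clause. *)
Lemma interior_step (F : (K -> C) -> C) (M : R) (k : K) (marks : list K) (a : C) :
  ghol op (unit_ball op) F -> bounded_on (unit_ball op) F M -> 0 <= M -> In k marks -> Cmod a < 1 ->
  exists F0 g M', ghol op (unit_ball op) F0 /\ bounded_on (unit_ball op) F0 M /\
    ghol op (unit_ball op) g /\ bounded_on (unit_ball op) g M' /\
    (forall v, unit_ball op v -> F v = (F0 v + (v k - a) * g v)%C) /\
    (forall v d, unit_ball op v ->
      (forall w, unit_ball op w -> w k = a -> (forall m, In m marks -> m <> k -> w m = v m) -> d <= Cmod (F w)) -> d <= Cmod (F0 v)).
Proof.
  intros HF HM HM0 Hk Ha.
  destruct (retraction_ultrafilter Htop Hcpt Hhaus Hdisp marks) as [U [HU HB]].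
  set (B := 16 * M / ((1 - Cmod a) / 2)).
  assert (HB0 : 0 <= B). { apply Rmult_le_pos; [lra|]. left. apply Rinv_0_lt_compat. lra. }
  set (P := fun (pi : K -> K) (g : (K -> C) -> C) => ghol op (unit_ball op) g /\ bounded_on (unit_ball op) g B /\
    forall v, unit_ball op v -> F (subst_at k pi v (v k)) = (F (subst_at k pi v a) + (v k - a) * g v)%C).
  set (g := fun i : (K -> K) * R => epsilon (inhabits (fun _ => RtoC 0)) (P (fst i))).
  assert (Hadm : U (fun i => admissible op marks (fst i))).
  { apply (ultra_mp HU _ _ (HB (fun _ => RtoC 0) 1 (cont_const Htop (RtoC 0)) ltac:(lra))). intros i Hi. apply Hi. }
  assert (HP : forall i, admissible op marks (fst i) -> P (fst i) (g i)).
  { intros i Hi. unfold g. apply epsilon_spec. apply (interior_quotient F M k marks (fst i) a); auto. }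
  destruct (ghol_ulim Hcpt HU (unit_ball op) g B (gopen_ball Htop) HB0) as [Hg1 [Hg2 Hg3]].
  { apply (ultra_mp HU _ _ Hadm). intros i Hi. destruct (HP i Hi) as [? [? _]]. auto. }
  destruct (ghol_ulim Hcpt HU (unit_ball op) (fun i v => F (subst_at k (fst i) v a)) M (gopen_ball Htop) HM0) as [Hf1 [Hf2 Hf3]].
  { apply (ultra_mp HU _ _ Hadm). intros i Hi. split.
    - apply (ghol_comp_affine (unit_ball op) (unit_ball op) F (fun v => subst_at k (fst i) v a) (fun u => subst_at k (fst i) u 0%C)).
      + intros v z u. rewrite <- subst_at_line. f_equal. ring.
      + intros u. apply (subst_at_cont k marks); auto.
      + intros v Hv. apply (subst_at_ball k marks); auto.
      + exact HF.
    - intros v Hv. apply HM, (subst_at_ball k marks); auto. }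
  exists (fun v => ulim U (fun i => F (subst_at k (fst i) v a))), (fun v => ulim U (fun i => g i v)), B.
  split; auto. split; auto. split; auto. split; auto. split.
  - intros v Hv.
    apply (is_ulim_unique HU (fun i => F (subst_at k (fst i) v (v k)))).
    + apply (subst_at_limit Htop (unit_ball op) F M k marks U (fun _ => v k) v); auto using gopen_ball.
      * apply Hv.
      * intros i e _ He. replace (v k - v k)%C with (RtoC 0) by ring. rewrite Cmod_0. lra.
    + apply (is_ulim_ext HU (fun i => F (subst_at k (fst i) v a) + (v k - a) * g i v)%C).
      * apply (ultra_mp HU _ _ Hadm). intros i Hi. destruct (HP i Hi) as [_ [_ E]]. symmetry. apply E, Hv.
      * apply (is_ulim_plus HU); auto. apply (is_ulim_mult HU); auto. apply (is_ulim_const HU).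
  - intros v d Hv Hd. apply (is_ulim_ge HU (fun i => F (subst_at k (fst i) v a))); auto.
    apply (ultra_mp HU _ _ Hadm). intros i Hi. apply Hd.
    + apply (subst_at_ball k marks); auto.
    + apply (subst_at_self k marks (op := op)); auto.
    + intros m Hm Hmk. apply (subst_at_other k m marks (op := op)); auto.
Qed.
End Interior.

(** * The splitting operator at a boundary point *)

Lemma Hor_bound (F : C -> C) (y a b N : R) : a <= b ->
  (forall x, a <= x <= b -> ccont F (x, y) /\ Cmod (F (x, y)) <= N) -> Cmod (Hor F y a b) <= (b - a) * N.
Proof.
  intros Hab H. apply (isCI_bound (fun x => F (x, y)) a b); auto; [intros t Ht; apply H; auto|].
  apply (CI_correct (fun x => F (x, y))), ex_Hor; auto. intros x Hx. apply H; auto.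
Qed.

Lemma Ver_bound (F : C -> C) (x a b N : R) : a <= b ->
  (forall y, a <= y <= b -> ccont F (x, y) /\ Cmod (F (x, y)) <= N) -> Cmod (Ver F x a b) <= (b - a) * N.
Proof.
  intros Hab H. apply (isCI_bound (fun y => F (x, y)) a b); auto; [intros t Ht; apply H; auto|].
  apply (CI_correct (fun y => F (x, y))), ex_Ver; auto. intros y Hy. apply H; auto.
Qed.

Lemma Hor_minus (F G : C -> C) (y a b : R) : a <= b ->
  (forall x, a <= x <= b -> ccont F (x, y) /\ ccont G (x, y)) ->
  Hor (fun s => F s - G s)%C y a b = (Hor F y a b - Hor G y a b)%C.
Proof.
  intros Hab H. unfold Hor. apply isCI_unique.
  assert (A1 := CI_correct (fun x => F (x, y)) a b (ex_Hor F y a b Hab (fun x Hx => proj1 (H x Hx)))).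
  assert (A2 := CI_correct (fun x => G (x, y)) a b (ex_Hor G y a b Hab (fun x Hx => proj2 (H x Hx)))).
  assert (A3 := isCI_plus _ _ _ _ _ _ A1 (isCI_mult (-(1)) _ _ _ _ A2)).
  replace (CI (fun x => F (x, y)) a b - CI (fun x => G (x, y)) a b)%C with
    (CI (fun x => F (x, y)) a b + - (1) * CI (fun x => G (x, y)) a b)%C by ring.
  revert A3. apply isCI_ext; auto. intros t _. cbn beta. ring.
Qed.

Lemma Ver_minus (F G : C -> C) (x a b : R) : a <= b ->
  (forall y, a <= y <= b -> ccont F (x, y) /\ ccont G (x, y)) ->
  Ver (fun s => F s - G s)%C x a b = (Ver F x a b - Ver G x a b)%C.
Proof.
  intros Hab H. unfold Ver. apply isCI_unique.
  assert (A1 := CI_correct (fun y => F (x, y)) a b (ex_Ver F x a b Hab (fun y Hy => proj1 (H y Hy)))).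
  assert (A2 := CI_correct (fun y => G (x, y)) a b (ex_Ver G x a b Hab (fun y Hy => proj2 (H y Hy)))).
  assert (A3 := isCI_plus _ _ _ _ _ _ A1 (isCI_mult (-(1)) _ _ _ _ A2)).
  replace (CI (fun y => F (x, y)) a b - CI (fun y => G (x, y)) a b)%C with
    (CI (fun y => F (x, y)) a b + - (1) * CI (fun y => G (x, y)) a b)%C by ring.
  revert A3. apply isCI_ext; auto. intros t _. cbn beta. ring.
Qed.

Lemma Cmod_sqr_lt (z : C) : Cmod z < 1 -> fst z * fst z + snd z * snd z < 1.
Proof.
  intros H. pose proof (Cmod2_alt z) as E. unfold Re, Im in E. pose proof (Cmod_ge_0 z). simpl in E. nra.
Qed.

Lemma Cmod_le_sqr (z : C) : fst z * fst z + snd z * snd z <= 1 -> Cmod z <= 1.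
Proof.
  intros H. unfold Cmod. rewrite <- sqrt_1. apply sqrt_le_1_alt. simpl. lra.
Qed.

Section Contour.
(* The chord [Re = c], [c = (2 + c0) / 3], meets the unit circle at the corners [c - id] and [c + id] of a rectangle
   contained in the closed disc.  The weight [(w - c)^2 + d^2] vanishes at these two points, which makes the weighted
   Cauchy integrals along the two boundary paths joining them bounded. *)
Context (c0 : R) (Hc0 : 0 <= c0 < 1).
(** [rect_left] and [rect_right] cut the interval from c0 to 1 into thirds. The first third leaves
    room for shrinking the contour by a radius r < 1 without crossing the line Re = c0. *)
Definition rect_left : R := (1 + 2 * c0) / 3.
Definition rect_right : R := (2 + c0) / 3.
Definition rect_height : R := sqrt (1 - rect_right * rect_right).
Definition weight (w : C) : C := ((w - rect_right) * (w - rect_right) + rect_height * rect_height)%C.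

Definition on_left (s : C) : Prop :=
  (rect_left <= fst s <= rect_right /\ (snd s = - rect_height \/ snd s = rect_height)) \/ (fst s = rect_left /\ - rect_height <= snd s <= rect_height).
Definition on_right (s : C) : Prop := fst s = rect_right /\ - rect_height <= snd s <= rect_height.

(** Both paths run from the lower right corner to the upper right one, so that [Rect] is their
    difference. *)
Definition right_path (F : C -> C) : C := (Ci * Ver F rect_right (- rect_height) rect_height)%C.
Definition left_path (F : C -> C) : C := (- Hor F (- rect_height) rect_left rect_right + Ci * Ver F rect_left (- rect_height) rect_height + Hor F rect_height rect_left rect_right)%C.

Definition cauchy_kernel (G : C -> C) (z s : C) : C := (weight s * G s / (s - z))%C.

(** An additive splitting of weight times G. The integral along the right path is holomorphic left
    of the chord, where [G] may be undefined; Cauchy's formula inside the rectangle shows that the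
    second expression continues it to the right. *)
Definition glued (G : C -> C) (z : C) : C :=
  if Rlt_dec (fst z) rect_right then (inv_2pi_i * right_path (cauchy_kernel G z))%C else (weight z * G z + inv_2pi_i * left_path (cauchy_kernel G z))%C.

Lemma rect_bounds : 0 < rect_left /\ c0 < rect_left /\ rect_left < rect_right /\ rect_right < 1 /\ 0 < rect_height /\ rect_height <= 1 /\ rect_height * rect_height = 1 - rect_right * rect_right /\ rect_right - rect_left = (1 - c0) / 3.
Proof.
  unfold rect_left, rect_right. assert (H : 0 < 1 - rect_right * rect_right) by (unfold rect_right; nra).
  assert (0 < rect_height) by (apply sqrt_lt_R0; auto).
  assert (E : rect_height * rect_height = 1 - rect_right * rect_right) by (apply sqrt_sqrt; lra).
  unfold rect_right in *. repeat split; try lra; nra.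
Qed.

Lemma left_path_bound (F : C -> C) (N : R) : (forall s, on_left s -> ccont F s /\ Cmod (F s) <= N) -> Cmod (left_path F) <= 4 * N.
Proof.
  intros H. destruct rect_bounds as (B1 & B2 & B3 & B4 & B5 & B6 & B7 & B8).
  assert (HN : 0 <= N). { eapply Rle_trans; [apply Cmod_ge_0|apply (H (rect_left, 0))]. right; simpl; lra. }
  assert (H1 : Cmod (Hor F (- rect_height) rect_left rect_right) <= (rect_right - rect_left) * N). { apply Hor_bound; [lra|]. intros x Hx. apply H. left; simpl; auto. }
  assert (H2 : Cmod (Hor F rect_height rect_left rect_right) <= (rect_right - rect_left) * N). { apply Hor_bound; [lra|]. intros x Hx. apply H. left; simpl; auto. }
  assert (H3 : Cmod (Ver F rect_left (- rect_height) rect_height) <= (rect_height - - rect_height) * N). { apply Ver_bound; [lra|]. intros x Hx. apply H. right; simpl; auto. }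
  unfold left_path. eapply Rle_trans; [apply Cmod_triangle|]. eapply Rle_trans; [apply Rplus_le_compat_r, Cmod_triangle|].
  rewrite Cmod_opp, Cmod_mult, Cmod_Ci. nra.
Qed.

Lemma right_path_bound (F : C -> C) (N : R) : (forall s, on_right s -> ccont F s /\ Cmod (F s) <= N) -> Cmod (right_path F) <= 2 * N.
Proof.
  intros H. destruct rect_bounds as (B1 & B2 & B3 & B4 & B5 & B6 & B7 & B8).
  assert (HN : 0 <= N). { eapply Rle_trans; [apply Cmod_ge_0|apply (H (rect_right, 0))]. split; simpl; lra. }
  assert (H3 : Cmod (Ver F rect_right (- rect_height) rect_height) <= (rect_height - - rect_height) * N). { apply Ver_bound; [lra|]. intros x Hx. apply H. split; simpl; auto. }
  unfold right_path. rewrite Cmod_mult, Cmod_Ci. nra.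
Qed.

Lemma left_path_minus (F G : C -> C) : (forall s, on_left s -> ccont F s /\ ccont G s) ->
  left_path (fun s => F s - G s)%C = (left_path F - left_path G)%C.
Proof.
  intros H. destruct rect_bounds as (B1 & B2 & B3 & B4 & B5 & B6 & B7 & B8). unfold left_path.
  rewrite !Hor_minus, Ver_minus; try lra; [ring| | |]; intros t Ht; apply H; unfold on_left; simpl; auto.
Qed.

Lemma Rect_paths (F : C -> C) : Rect F rect_left rect_right (- rect_height) rect_height = (right_path F - left_path F)%C.
Proof. unfold Rect, right_path, left_path. ring. Qed.

Lemma contour_in_rect (s : C) : on_left s \/ on_right s -> in_rect rect_left rect_right (- rect_height) rect_height s.
Proof.
  destruct rect_bounds as (B1 & B2 & B3 & B4 & B5 & B6 & B7 & B8).
  unfold in_rect, on_left, on_right. intros [[[? [?|?]]|[? ?]]|[? ?]]; lra.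
Qed.

Lemma rect_in_disc (s : C) : in_rect rect_left rect_right (- rect_height) rect_height s -> Cmod s <= 1.
Proof.
  destruct rect_bounds as (B1 & B2 & B3 & B4 & B5 & B6 & B7 & B8). intros [H1 H2]. apply Cmod_le_sqr. nra.
Qed.

Lemma weight_bound (w : C) : Cmod w <= 1 -> Cmod (weight w) <= 5.
Proof.
  intros Hw. destruct rect_bounds as (B1 & B2 & B3 & B4 & B5 & B6 & B7 & B8). unfold weight.
  eapply Rle_trans; [apply Cmod_triangle|]. rewrite !Cmod_mult, Cmod_R, (Rabs_pos_eq rect_height) by lra.
  assert (Cmod (w - rect_right) <= 2).
  { unfold Cminus. eapply Rle_trans; [apply Cmod_triangle|]. rewrite Cmod_opp, Cmod_R, Rabs_pos_eq; lra. }
  pose proof (Cmod_ge_0 (w - rect_right)). nra.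
Qed.

(** On the chord the weight is the real number (d - |t|)(d + |t|), with d = [rect_height] and t the
    height of the point. *)
Lemma weight_right (s : C) : on_right s -> Cmod (weight s) <= 2 * (rect_height - Rabs (snd s)).
Proof.
  intros [H1 H2]. destruct rect_bounds as (B1 & B2 & B3 & B4 & B5 & B6 & B7 & B8). destruct s as [x t]. simpl in *. subst x.
  replace (weight (rect_right, t)) with (RtoC ((rect_height - Rabs t) * (rect_height + Rabs t))).
  - rewrite Cmod_R, Rabs_mult. assert (Rabs t <= rect_height) by (apply Rabs_le; lra). pose proof (Rabs_pos t).
    rewrite (Rabs_pos_eq (rect_height - Rabs t)), (Rabs_pos_eq (rect_height + Rabs t)) by lra. nra.
  - assert (Rabs t * Rabs t = t * t) by (rewrite <- Rabs_mult; apply Rabs_pos_eq; nra).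
    unfold weight, RtoC, Cminus, Cplus, Cmult, Copp; simpl; f_equal; [nra|ring].
Qed.

Lemma weight_horizontal (s : C) : rect_left <= fst s <= rect_right -> (snd s = - rect_height \/ snd s = rect_height) -> Cmod (weight s) <= 3 * (rect_right - fst s).
Proof.
  intros H1 H2. destruct rect_bounds as (B1 & B2 & B3 & B4 & B5 & B6 & B7 & B8). destruct s as [x t]. simpl in *.
  assert (E : weight (x, t) = (RtoC (x - rect_right) * ((x - rect_right)%R, (2 * t)%R))%C).
  { assert (t * t = rect_height * rect_height) by (destruct H2; subst; ring).
    unfold weight, RtoC, Cminus, Cplus, Cmult, Copp; simpl; f_equal; [nra|ring]. }
  rewrite E, Cmod_mult, Cmod_R.
  assert (Cmod (x - rect_right, 2 * t) <= 3).
  { eapply Rle_trans; [apply Cmod_le_abs|]. simpl. rewrite Rabs_mult, (Rabs_pos_eq 2) by lra.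
    assert (Rabs (x - rect_right) <= 1) by (apply Rabs_le; lra). assert (Rabs t <= 1) by (apply Rabs_le; destruct H2; subst; lra). lra. }
  rewrite <- Rabs_Ropp, Rabs_pos_eq by lra. pose proof (Cmod_ge_0 (x - rect_right, 2 * t)). nra.
Qed.

Definition slope : R := (rect_right - rect_left) / 2.
(** The points to the right of a wedge that joins the two corners and bulges left of the chord. Near
    a corner both paths may be close to [z]; the wedge decides which of them has distance comparable
    with the weight. *)
Definition inner (z : C) : Prop := Rabs (snd z) < rect_height /\ rect_right - fst z < slope * (rect_height - Rabs (snd z)).
(** The three terms serve, in order, the horizontal sides, the left side and the chord. *)
Definition distance_const : R := 6 + 10 / (rect_right - rect_left) + 2 * (1 + / slope).

Lemma slope_bounds : 0 < slope /\ slope <= 1 /\ slope <= (rect_right - rect_left) / 2 /\ 0 < / slope /\ 0 < 10 / (rect_right - rect_left).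
Proof.
  destruct rect_bounds as (B1 & B2 & B3 & B4 & B5 & B6 & B7 & B8). unfold slope.
  assert (0 < (rect_right - rect_left) / 2) by lra.
  repeat split; try lra; [apply Rinv_0_lt_compat; auto|apply Rdiv_lt_0_compat; lra].
Qed.

Lemma distance_const_nonneg : 0 <= distance_const.
Proof. destruct slope_bounds as (L1 & L2 & L3 & L4 & L5). unfold distance_const. lra. Qed.

Lemma right_inner (z : C) : Cmod z < 1 -> rect_right <= fst z -> inner z.
Proof.
  intros Hz Hx. destruct rect_bounds as (B1 & B2 & B3 & B4 & B5 & B6 & B7 & B8). destruct slope_bounds as (L1 & L2 & L3 & L4 & L5).
  apply Cmod_sqr_lt in Hz.
  assert (H : Rabs (snd z) < rect_height).
  { apply Rabs_def1; nra. }
  split; auto. assert (0 < slope * (rect_height - Rabs (snd z))) by (apply Rmult_lt_0_compat; lra). lra.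
Qed.

Lemma inner_fst (z : C) : inner z -> (rect_left + rect_right) / 2 < fst z.
Proof.
  intros [Hy Hx]. destruct rect_bounds as (B1 & B2 & B3 & B4 & B5 & B6 & B7 & B8). destruct slope_bounds as (L1 & L2 & L3 & L4 & L5).
  pose proof (Rabs_pos (snd z)).
  assert (slope * (rect_height - Rabs (snd z)) <= slope * 1) by (apply Rmult_le_compat_l; lra). lra.
Qed.

(** On a horizontal side the weight is at most 3 times the distance to the right corner, which the
    wedge bounds by twice |s - z|. On the left side |s - z| is at least half the width of the
    rectangle. *)
Lemma left_distance (z s : C) : inner z -> on_left s -> Cmod (weight s) <= distance_const * Cmod (s - z) /\ 0 < Cmod (s - z).
Proof.
  intros Hi Hs. assert (Hf := inner_fst z Hi). destruct Hi as [Hy Hx].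
  destruct rect_bounds as (B1 & B2 & B3 & B4 & B5 & B6 & B7 & B8). destruct slope_bounds as (L1 & L2 & L3 & L4 & L5).
  pose proof (Cmod_ge_fst (s - z)) as G1. pose proof (Cmod_ge_snd (s - z)) as G2. simpl in G1, G2.
  set (D := Cmod (s - z)) in *. pose proof (Rabs_pos (snd z)).
  assert (Hin := rect_in_disc s (contour_in_rect s (or_introl Hs))).
  destruct Hs as [[Hs1 Hs2]|[Hs1 Hs2]].
  - assert (HD : rect_height - Rabs (snd z) <= D).
    { eapply Rle_trans; [|apply G2]. destruct Hs2 as [-> | ->].
      - rewrite <- (Rabs_Ropp (- rect_height + - snd z)). eapply Rle_trans; [|apply Rle_abs]. pose proof (Rle_abs (- snd z)) as E. rewrite Rabs_Ropp in E. lra.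
      - eapply Rle_trans; [|apply Rle_abs]. pose proof (Rle_abs (snd z)). lra. }
    assert (HD2 : rect_right - fst s <= 2 * D).
    { assert (fst z - fst s <= D). { eapply Rle_trans; [|apply G1]. rewrite <- Rabs_Ropp. eapply Rle_trans; [|apply Rle_abs]. lra. }
      assert (slope * (rect_height - Rabs (snd z)) <= D) by nra. lra. }
    assert (Hm := weight_horizontal s Hs1 Hs2). split; [|lra]. unfold distance_const. nra.
  - assert (HD : (rect_right - rect_left) / 2 <= D).
    { eapply Rle_trans; [|apply G1]. rewrite Hs1, <- Rabs_Ropp. eapply Rle_trans; [|apply Rle_abs]. lra. }
    assert (Hm := weight_bound s Hin). split; [|lra].
    assert (E : 10 / (rect_right - rect_left) * ((rect_right - rect_left) / 2) = 5) by (field; lra).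
    assert (10 / (rect_right - rect_left) * ((rect_right - rect_left) / 2) <= 10 / (rect_right - rect_left) * D) by (apply Rmult_le_compat_l; lra).
    unfold distance_const. nra.
Qed.

Lemma right_distance (z s : C) : fst z < rect_right -> ~ inner z -> on_right s -> Cmod (weight s) <= distance_const * Cmod (s - z) /\ 0 < Cmod (s - z).
Proof.
  intros Hx Hn Hs. destruct rect_bounds as (B1 & B2 & B3 & B4 & B5 & B6 & B7 & B8). destruct slope_bounds as (L1 & L2 & L3 & L4 & L5).
  assert (Hm := weight_right s Hs).
  pose proof (Cmod_ge_fst (s - z)) as G1. pose proof (Cmod_ge_snd (s - z)) as G2. simpl in G1, G2.
  set (D := Cmod (s - z)) in *. destruct Hs as [Hs1 Hs2].
  assert (HD1 : rect_right - fst z <= D). { eapply Rle_trans; [|apply G1]. eapply Rle_trans; [|apply Rle_abs]. lra. }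
  assert (HD2 : Rabs (snd z) - Rabs (snd s) <= D).
  { eapply Rle_trans; [|apply G2]. rewrite <- (Rabs_Ropp (snd s + - snd z)). replace (- (snd s + - snd z)) with (snd z - snd s) by ring.
    apply Rabs_triang_inv. }
  assert (Hq : slope * (rect_height - Rabs (snd z)) <= D).
  { apply Rnot_lt_le. intros Hlt. apply Hn. assert (0 < slope * (rect_height - Rabs (snd z))) by lra.
    split; [|lra]. destruct (Rlt_dec (Rabs (snd z)) rect_height); auto. nra. }
  assert (Hq2 : rect_height - Rabs (snd z) <= / slope * D).
  { apply Rmult_le_reg_l with slope; auto. rewrite <- Rmult_assoc, Rinv_r, Rmult_1_l by lra. exact Hq. }
  split; [|lra]. unfold distance_const. nra.
Qed.

Context (G : C -> C) (M : R) (HM : 0 <= M)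
  (HG : forall s, Cmod s <= 1 -> rect_left <= fst s -> cdiff G s /\ Cmod (G s) <= M).

Lemma G_contour (s : C) : on_left s \/ on_right s -> cdiff G s /\ Cmod (G s) <= M /\ Cmod (weight s) <= 5.
Proof.
  intros H. apply contour_in_rect in H. assert (H1 := rect_in_disc s H).
  destruct (HG s H1) as [A1 A2]; [apply H|]. repeat split; auto. apply weight_bound; auto.
Qed.

Lemma cdiff_weight (s : C) : cdiff weight s.
Proof.
  unfold weight. apply cdiff_plus; [|apply cdiff_const]. apply cdiff_mult; apply cdiff_minus; auto using cdiff_id, cdiff_const.
Qed.

Lemma ccont_cauchy_kernel (z s : C) : on_left s \/ on_right s -> s <> z -> ccont (cauchy_kernel G z) s.
Proof.
  intros H Hn. destruct (G_contour s H) as [H1 _]. apply cdiff_ccont. unfold cauchy_kernel. apply cdiff_div.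
  - apply cdiff_mult; auto. apply cdiff_weight.
  - apply cdiff_minus; auto using cdiff_id, cdiff_const.
  - apply sub_neq_0; auto.
Qed.

Lemma cauchy_kernel_bound (z s : C) (A : R) : on_left s \/ on_right s -> Cmod (weight s) <= A * Cmod (s - z) -> 0 < Cmod (s - z) ->
  Cmod (cauchy_kernel G z s) <= A * M.
Proof.
  intros Hs H1 H2. destruct (G_contour s Hs) as [_ [H3 _]]. unfold cauchy_kernel.
  rewrite Cmod_div by (apply Cmod_gt_0; auto). rewrite Cmod_mult.
  apply Rmult_le_reg_r with (Cmod (s - z)); auto. unfold Rdiv. rewrite Rmult_assoc, Rinv_l, Rmult_1_r by lra.
  replace (A * M * Cmod (s - z)) with (A * Cmod (s - z) * M) by ring.
  apply Rmult_le_compat; auto; apply Cmod_ge_0.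
Qed.

Lemma glue (z : C) : rect_left < fst z < rect_right -> - rect_height < snd z < rect_height ->
  (inv_2pi_i * right_path (cauchy_kernel G z) = weight z * G z + inv_2pi_i * left_path (cauchy_kernel G z))%C.
Proof.
  intros Hx Hy.
  assert (H : (inv_2pi_i * Rect (cauchy_kernel G z) rect_left rect_right (- rect_height) rect_height)%C = (weight z * G z)%C).
  { unfold cauchy_kernel. apply (cauchy_formula (fun s => weight s * G s)%C); auto. intros s Hs.
    apply cdiff_mult; [apply cdiff_weight|]. apply HG; [apply rect_in_disc; auto|apply Hs]. }
  rewrite Rect_paths in H. rewrite <- H. ring.
Qed.

Lemma glued_inner (z : C) : Cmod z < 1 -> inner z -> glued G z = (weight z * G z + inv_2pi_i * left_path (cauchy_kernel G z))%C.
Proof.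
  intros Hz Hi. unfold glued. destruct (Rlt_dec (fst z) rect_right) as [Hlt|]; auto.
  destruct rect_bounds as (B1 & B2 & B3 & B4 & B5 & B6 & B7 & B8). destruct slope_bounds as (L1 & L2 & L3 & L4 & L5).
  assert (Hf := inner_fst z Hi). destruct Hi as [Hy Hx].
  apply glue; [|apply Rabs_lt_between; auto]. lra.
Qed.

Lemma inv_2pi_i_mult_bound (w : C) (N : R) : Cmod w <= N -> Cmod (inv_2pi_i * w) <= N.
Proof.
  intros H. rewrite Cmod_mult. pose proof inv_2pi_i_small. pose proof (Cmod_ge_0 inv_2pi_i). pose proof (Cmod_ge_0 w). nra.
Qed.

Lemma left_inner_bound (z : C) : inner z -> Cmod (left_path (cauchy_kernel G z)) <= 4 * (distance_const * M).
Proof.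
  intros Hi. apply left_path_bound. intros s Hs. destruct (left_distance z s Hi Hs) as [D1 D2].
  split; [apply ccont_cauchy_kernel; auto; apply Cmod_sub_neq; auto|apply cauchy_kernel_bound; auto].
Qed.

Lemma inner_region (z : C) : inner z -> rect_left <= fst z.
Proof.
  intros Hi. apply inner_fst in Hi. destruct rect_bounds as (B1 & B2 & B3 & B4 & B5 & B6 & B7 & B8). lra.
Qed.

(** For points of [inner] the left path has a bounded weighted kernel, and for the other points the
    right path has one; [glued_inner] allows the left formula even on the part of [inner] that lies
    left of the chord. *)
Lemma glued_bound (z : C) : Cmod z < 1 -> Cmod (glued G z) <= (5 + 4 * distance_const) * M.
Proof.
  intros Hz. pose proof distance_const_nonneg as Hg. assert (0 <= distance_const * M) by (apply Rmult_le_pos; auto).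
  destruct (classic (inner z)) as [Hi|Hi].
  - rewrite glued_inner by auto. eapply Rle_trans; [apply Cmod_triangle|].
    assert (H1 := inv_2pi_i_mult_bound _ _ (left_inner_bound z Hi)).
    assert (H2 : Cmod (weight z * G z) <= 5 * M).
    { rewrite Cmod_mult. apply Rmult_le_compat; try apply Cmod_ge_0; [apply weight_bound; lra|].
      apply HG; [lra|apply inner_region; auto]. }
    lra.
  - unfold glued. destruct (Rlt_dec (fst z) rect_right) as [Hlt|Hge]; [|exfalso; apply Hi, right_inner; auto; lra].
    assert (H1 : Cmod (right_path (cauchy_kernel G z)) <= 2 * (distance_const * M)).
    { apply right_path_bound. intros s Hs. destruct (right_distance z s Hlt Hi Hs) as [D1 D2].
      split; [apply ccont_cauchy_kernel; auto; apply Cmod_sub_neq; auto|apply cauchy_kernel_bound; auto]. }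
    apply inv_2pi_i_mult_bound in H1. nra.
Qed.

Lemma left_dist_1 (s : C) : on_left s -> 1 - rect_right <= Cmod (s - 1).
Proof.
  intros Hs. assert (H := contour_in_rect s (or_introl Hs)). destruct H as [H _].
  pose proof (Cmod_ge_fst (s - 1)) as G1. simpl in G1. eapply Rle_trans; [|apply G1].
  rewrite <- Rabs_Ropp. eapply Rle_trans; [|apply Rle_abs]. lra.
Qed.

Lemma left_path_1_bound : Cmod (left_path (cauchy_kernel G 1%C)) <= 4 * (5 / (1 - rect_right) * M).
Proof.
  destruct rect_bounds as (B1 & B2 & B3 & B4 & B5 & B6 & B7 & B8).
  apply left_path_bound. intros s Hs. assert (D := left_dist_1 s Hs).
  split; [apply ccont_cauchy_kernel; auto; apply Cmod_sub_neq; lra|].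
  apply cauchy_kernel_bound; auto; [|lra]. destruct (G_contour s (or_introl Hs)) as [_ [_ Hm]].
  apply Rle_trans with (5 / (1 - rect_right) * (1 - rect_right)).
  - replace (5 / (1 - rect_right) * (1 - rect_right)) with 5 by (field; lra). auto.
  - apply Rmult_le_compat_l; auto. apply Rmult_le_pos; [lra|]. left. apply Rinv_0_lt_compat. lra.
Qed.

(** Moving the pole of the kernel from [z] to 1 produces the factor (z - 1) / (s - 1), and the left
    path keeps distance 1 - rect_right from 1. *)
Lemma glued_near_1 (z : C) : Cmod z < 1 -> rect_right <= fst z ->
  Cmod (glued G z - weight z * G z - inv_2pi_i * left_path (cauchy_kernel G 1%C)) <= 4 * (distance_const / (1 - rect_right) * M) * Cmod (z - 1).
Proof.
  intros Hz Hx. destruct rect_bounds as (B1 & B2 & B3 & B4 & B5 & B6 & B7 & B8).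
  assert (Hi := right_inner z Hz Hx). rewrite glued_inner by auto.
  replace (weight z * G z + inv_2pi_i * left_path (cauchy_kernel G z) - weight z * G z - inv_2pi_i * left_path (cauchy_kernel G 1))%C with
    (inv_2pi_i * (left_path (cauchy_kernel G z) - left_path (cauchy_kernel G 1)))%C by ring.
  apply inv_2pi_i_mult_bound. rewrite <- left_path_minus.
  2:{ intros s Hs. assert (D := left_dist_1 s Hs). destruct (left_distance z s Hi Hs) as [D1 D2].
      split; apply ccont_cauchy_kernel; auto; apply Cmod_sub_neq; lra. }
  rewrite (Rmult_assoc 4). apply left_path_bound. intros s Hs.
  assert (D := left_dist_1 s Hs). destruct (left_distance z s Hi Hs) as [D1 D2].
  assert (N1 : s <> z) by (apply Cmod_sub_neq; auto). assert (N2 : s <> 1%C) by (apply Cmod_sub_neq; lra).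
  split.
  - replace (fun s0 => (cauchy_kernel G z s0 - cauchy_kernel G 1 s0)%C) with (fun s0 => (cauchy_kernel G z s0 + (-(1)) * cauchy_kernel G 1 s0)%C)
      by (apply functional_extensionality; intros; ring).
    apply ccont_plus; [apply ccont_cauchy_kernel; auto|]. apply ccont_mult; [apply ccont_const|apply ccont_cauchy_kernel; auto].
  - assert (E : (cauchy_kernel G z s - cauchy_kernel G 1 s)%C = (cauchy_kernel G z s * ((z - 1) / (s - 1)))%C).
    { unfold cauchy_kernel. field. split; apply sub_neq_0; auto. }
    rewrite E, Cmod_mult, Cmod_div by (apply sub_neq_0; auto).
    assert (HK := cauchy_kernel_bound z s distance_const (or_introl Hs) D1 D2).
    replace (distance_const / (1 - rect_right) * M * Cmod (z - 1)) with (distance_const * M * (Cmod (z - 1) * / (1 - rect_right))) by (unfold Rdiv; ring).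
    apply Rmult_le_compat; try apply Cmod_ge_0; auto.
    + apply Rmult_le_pos; [apply Cmod_ge_0|]. left. apply Rinv_0_lt_compat. lra.
    + apply Rmult_le_compat_l; [apply Cmod_ge_0|]. apply inv_le; lra.
Qed.

Lemma weight_1 : weight 1%C = RtoC (2 - 2 * rect_right).
Proof.
  destruct rect_bounds as (B1 & B2 & B3 & B4 & B5 & B6 & B7 & B8).
  unfold weight, RtoC, Cminus, Cplus, Cmult, Copp; simpl; f_equal; nra.
Qed.

Lemma weight_near_1 (z : C) : Cmod z < 1 -> Cmod (weight z - weight 1%C) <= 4 * Cmod (z - 1).
Proof.
  intros Hz. destruct rect_bounds as (B1 & B2 & B3 & B4 & B5 & B6 & B7 & B8).
  replace (weight z - weight 1%C)%C with ((z + (1 + - (2 * rect_right))) * (z - 1))%C by (unfold weight; ring).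
  rewrite Cmod_mult. apply Rmult_le_compat_r; [apply Cmod_ge_0|].
  eapply Rle_trans; [apply Cmod_triangle|]. eapply Rle_trans; [apply Rplus_le_compat_l, Cmod_triangle|].
  rewrite Cmod_1, Cmod_opp, Cmod_mult, !Cmod_R, !Rabs_pos_eq by lra. lra.
Qed.
End Contour.

(** Half-planes replace the discs |v j - a j| < d: rotation by the conjugate of a j moves a j to 1,
    and the cut is then a chord suited to the rectangle above. *)
Definition region {K : Type} (op : (K -> Prop) -> Prop) (c0 : R) (a : K -> C) (bd : list K) (v : K -> C) : Prop :=
  unit_ball op v /\ forall j, In j bd -> c0 < fst (Cconj (a j) * v j)%C.

Lemma conj_unit (a : C) : Cmod a = 1 -> (Cconj a * a)%C = 1%C.
Proof. intros H. rewrite Cmult_comm, <- Cmod2_conj, H. f_equal. ring. Qed.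

Ltac rect_facts c H := destruct (rect_bounds c H) as (B1 & B2 & B3 & B4 & B5 & B6 & B7 & B8).

(** * Freeing one coordinate of modulus one *)

Section Boundary.
Context {K : Type} {op : (K -> Prop) -> Prop} (Htop : is_topology op) (Hcpt : compact_space op).
Context (c0 : R) (Hc0 : 0 <= c0 < 1) (a : K -> C).

Lemma gopen_coord_open (k : K) (b : C) (P : C -> Prop) : Cmod b <= 1 ->
  (forall z, P z -> exists d, 0 < d /\ forall w, Cmod (w - z) <= d -> P w) -> gopen op (fun v => P (b * v k)%C).
Proof.
  intros Hb H. apply (gopen_coord k (fun z => P (b * z)%C)). intros z Hz. destruct (H _ Hz) as [d [Hd H']].
  exists d. split; auto. intros w Hw. apply H'. replace (b * w - b * z)%C with (b * (w - z))%C by ring.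
  rewrite Cmod_mult. pose proof (Cmod_ge_0 (w - z)). nra.
Qed.

Lemma fst_near (w z : C) (d : R) : Cmod (w - z) <= d -> Rabs (fst w - fst z) <= d.
Proof. intros H. eapply Rle_trans; [apply (Cmod_ge_fst (w - z))|auto]. Qed.

Lemma snd_near (w z : C) (d : R) : Cmod (w - z) <= d -> Rabs (snd w - snd z) <= d.
Proof. intros H. eapply Rle_trans; [apply (Cmod_ge_snd (w - z))|auto]. Qed.

Lemma open_fst_gt (c : R) (z : C) : c < fst z -> exists d, 0 < d /\ forall w, Cmod (w - z) <= d -> c < fst w.
Proof.
  intros H. exists ((fst z - c) / 2). split; [lra|]. intros w Hw. apply fst_near, Rabs_le_between in Hw. lra.
Qed.

Lemma open_fst_lt (c : R) (z : C) : fst z < c -> exists d, 0 < d /\ forall w, Cmod (w - z) <= d -> fst w < c.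
Proof.
  intros H. exists ((c - fst z) / 2). split; [lra|]. intros w Hw. apply fst_near, Rabs_le_between in Hw. lra.
Qed.

Lemma open_snd_lt (c : R) (z : C) : Rabs (snd z) < c -> exists d, 0 < d /\ forall w, Cmod (w - z) <= d -> Rabs (snd w) < c.
Proof.
  intros H. exists ((c - Rabs (snd z)) / 2). split; [lra|]. intros w Hw. apply snd_near in Hw.
  replace (snd w) with ((snd w - snd z) + snd z) by ring. eapply Rle_lt_trans; [apply Rabs_triang|]. lra.
Qed.

Lemma gopen_region (bd : list K) : (forall j, In j bd -> Cmod (a j) <= 1) -> gopen op (region op c0 a bd).
Proof.
  induction bd as [|j bd IH]; intros Ha.
  - intros v [Hv _]. destruct (gopen_ball Htop v Hv) as [r [Hr H]]. exists r. split; auto.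
    intros h Hh Hb. split; [apply H; auto|]. intros j [].
  - assert (H1 : gopen op (fun v => c0 < fst (Cconj (a j) * v j)%C)).
    { apply (gopen_coord_open j (Cconj (a j)) (fun z => c0 < fst z)); [|apply open_fst_gt].
      rewrite Cmod_conj. apply Ha. left; auto. }
    assert (H2 := IH (fun i Hi => Ha i (or_intror Hi))).
    intros v [Hv Hj].
    destruct (gopen_and _ _ H1 H2 v) as [r [Hr H]].
    { split; [apply Hj; left; auto|]. split; auto. intros i Hi. apply Hj. right; auto. }
    exists r. split; auto. intros h Hh Hb. destruct (H h Hh Hb) as [A1 [A2 A3]].
    split; auto. intros i [<-|Hi]; auto.
Qed.

Context (k : K) (bd : list K) (Hkbd : ~ In k bd) (Hak : Cmod (a k) = 1) (Habd : forall j, In j bd -> Cmod (a j) = 1).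
Context (G : (K -> C) -> C) (M : R) (HM0 : 0 <= M)
  (HG : ghol op (region op c0 a (k :: bd)) G) (HM : bounded_on (region op c0 a (k :: bd)) G M).

Definition coord (v : K -> C) : C := (Cconj (a k) * v k)%C.

Lemma coord_disc (v : K -> C) : unit_ball op v -> Cmod (coord v) < 1.
Proof.
  intros [_ [r [Hr Hb]]]. unfold coord. rewrite Cmod_mult, Cmod_conj, Hak, Rmult_1_l. eapply Rle_lt_trans; [apply Hb|auto].
Qed.

Lemma coord_dist (v : K -> C) : Cmod (coord v - 1) = Cmod (v k - a k).
Proof.
  replace (coord v - 1)%C with (Cconj (a k) * (v k - a k))%C.
  - rewrite Cmod_mult, Cmod_conj, Hak. ring.
  - unfold coord. rewrite <- (conj_unit (a k) Hak). ring.
Qed.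

Section OneRetraction.
Context (pi : K -> K) (r : R) (Hpi : admissible op (k :: bd) pi) (Hr : 0 < r < 1) (Hrc : c0 < r * rect_left c0).

(** [G] as a function of the rotated coordinate. The contour touches the unit circle at two corners,
    and the factor r < 1 keeps the substituted value inside the open ball. *)
Definition slice (v : K -> C) (s : C) : C := G (subst_at k pi v (r * (a k * s))%C).

Lemma slice_region (v : K -> C) (s : C) : region op c0 a bd v -> Cmod s <= 1 -> rect_left c0 <= fst s ->
  region op c0 a (k :: bd) (subst_at k pi v (r * (a k * s))%C).
Proof.
  intros [Hv Hj] Hs Hf.
  assert (Hr1 : Cmod (r * (a k * s)) < 1).
  { rewrite !Cmod_mult, Hak, Cmod_R, Rabs_pos_eq by lra. pose proof (Cmod_ge_0 s). nra. }
  split; [apply (subst_at_ball k (k :: bd)); auto|].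
  intros j [<-|Hjb].
  - rewrite (subst_at_self (op := op) k (k :: bd)) by (auto; left; auto).
    replace (Cconj (a k) * (r * (a k * s)))%C with ((Cconj (a k) * a k) * (r * s))%C by ring.
    rewrite (conj_unit (a k) Hak). simpl. pose proof (rect_bounds c0 Hc0). nra.
  - rewrite (subst_at_other (op := op) k j (k :: bd)); auto; [right; auto|intros ->; auto].
Qed.

Lemma slice_holo (v : K -> C) : region op c0 a bd v ->
  forall s, Cmod s <= 1 -> rect_left c0 <= fst s -> cdiff (slice v) s /\ Cmod (slice v s) <= M.
Proof.
  intros Hv s Hs Hf. assert (HR := slice_region v s Hv Hs Hf). split; [|apply HM; auto].
  apply (cdiff_ext (fun s => (fun w => G (subst_at k pi v w)) (0 + s * (r * a k))%C) _ s 1 ltac:(lra)).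
  { intros w _. unfold slice. do 2 f_equal. ring. }
  apply (cdiff_affine (fun w => G (subst_at k pi v w))).
  apply (cdiff_subst_at (op := op) (region op c0 a (k :: bd)) G k (k :: bd)); auto.
  replace (0 + s * (r * a k))%C with (r * (a k * s))%C by ring. exact HR.
Qed.

Lemma ghol_slice (Om : (K -> C) -> Prop) (s : C) : (forall v, Om v -> region op c0 a bd v) -> Cmod s <= 1 -> rect_left c0 <= fst s ->
  ghol op Om (fun v => slice v s).
Proof.
  intros HO Hs Hf.
  apply (ghol_comp_affine (region op c0 a (k :: bd)) Om G (fun v => subst_at k pi v (r * (a k * s))%C) (fun u => subst_at k pi u 0%C)); auto.
  - intros v z u. rewrite <- subst_at_line. f_equal. ring.
  - intros u. apply (subst_at_cont k (k :: bd)); auto.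
  - intros v Hv. apply slice_region; auto.
Qed.

Section Paths.
Context (Om : (K -> C) -> Prop) (zeta : (K -> C) -> C) (kap : R)
  (HO : gopen op Om) (HOr : forall v, Om v -> region op c0 a bd v) (Hz : ghol op Om zeta) (Hkap : 0 < kap).

Lemma ghol_cauchy_kernel (s : C) : on_left c0 s \/ on_right c0 s -> (forall v, Om v -> kap <= Cmod (s - zeta v)) ->
  ghol op Om (fun v => cauchy_kernel c0 (slice v) (zeta v) s) /\ bounded_on Om (fun v => cauchy_kernel c0 (slice v) (zeta v) s) (5 / kap * M) /\
  forall v, Om v -> ccont (fun s => cauchy_kernel c0 (slice v) (zeta v) s) s.
Proof.
  intros Hs Hd. assert (Hin := contour_in_rect c0 Hc0 s Hs). assert (Hs1 := rect_in_disc c0 Hc0 s Hin).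
  assert (Hf : rect_left c0 <= fst s) by apply Hin.
  split; [|split].
  - unfold cauchy_kernel. apply ghol_div.
    + apply ghol_mult; [apply ghol_const|]. apply ghol_slice; auto.
    + apply ghol_minus; [apply ghol_const|auto].
    + intros v Hv. apply Cmod_gt_0. specialize (Hd v Hv). lra.
  - intros v Hv. specialize (Hd v Hv). apply (cauchy_kernel_bound c0 Hc0 (slice v) M); auto; [apply slice_holo; auto| |lra].
    apply Rle_trans with 5; [apply weight_bound; auto|].
    apply Rle_trans with (5 / kap * kap); [right; field; lra|]. apply Rmult_le_compat_l; auto.
    apply Rmult_le_pos; [lra|]. left. apply Rinv_0_lt_compat; auto.
  - intros v Hv. specialize (Hd v Hv). apply (ccont_cauchy_kernel c0 Hc0 (slice v) M); auto; [apply slice_holo; auto|].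
    apply Cmod_sub_neq. lra.
Qed.

Lemma cauchy_kernel_const_nonneg : 0 <= 5 / kap * M.
Proof. apply Rmult_le_pos; auto. apply Rmult_le_pos; [lra|]. left. apply Rinv_0_lt_compat; auto. Qed.

Lemma ghol_left_path : (forall v s, Om v -> on_left c0 s -> kap <= Cmod (s - zeta v)) ->
  ghol op Om (fun v => left_path c0 (cauchy_kernel c0 (slice v) (zeta v))).
Proof.
  intros Hd. rect_facts c0 Hc0. pose proof cauchy_kernel_const_nonneg.
  unfold left_path. apply ghol_plus; [apply ghol_plus|].
  - replace (fun v => (- Hor (cauchy_kernel c0 (slice v) (zeta v)) (- rect_height c0) (rect_left c0) (rect_right c0))%C) with
      (fun v => (0 - Hor (cauchy_kernel c0 (slice v) (zeta v)) (- rect_height c0) (rect_left c0) (rect_right c0))%C)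
      by (apply functional_extensionality; intros; ring).
    apply ghol_minus; [apply ghol_const|].
    apply (ghol_Hor Hcpt Om (fun s v => cauchy_kernel c0 (slice v) (zeta v) s) _ _ _ (5 / kap * M)); auto; [lra|].
    intros x Hx. assert (Hl : on_left c0 (x, - rect_height c0)) by (left; simpl; auto). apply ghol_cauchy_kernel; auto.
  - apply ghol_mult; [apply ghol_const|].
    apply (ghol_Ver Hcpt Om (fun s v => cauchy_kernel c0 (slice v) (zeta v) s) _ _ _ (5 / kap * M)); auto; [lra|].
    intros y Hy. assert (Hl : on_left c0 (rect_left c0, y)) by (right; simpl; auto). apply ghol_cauchy_kernel; auto.
  - apply (ghol_Hor Hcpt Om (fun s v => cauchy_kernel c0 (slice v) (zeta v) s) _ _ _ (5 / kap * M)); auto; [lra|].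
    intros x Hx. assert (Hl : on_left c0 (x, rect_height c0)) by (left; simpl; auto). apply ghol_cauchy_kernel; auto.
Qed.

Lemma ghol_right_path : (forall v s, Om v -> on_right c0 s -> kap <= Cmod (s - zeta v)) ->
  ghol op Om (fun v => right_path c0 (cauchy_kernel c0 (slice v) (zeta v))).
Proof.
  intros Hd. rect_facts c0 Hc0. pose proof cauchy_kernel_const_nonneg.
  unfold right_path. apply ghol_mult; [apply ghol_const|].
  apply (ghol_Ver Hcpt Om (fun s v => cauchy_kernel c0 (slice v) (zeta v) s) _ _ _ (5 / kap * M)); auto; [lra|].
  intros y Hy. assert (Hl : on_right c0 (rect_right c0, y)) by (split; simpl; auto). apply ghol_cauchy_kernel; auto.
Qed.
End Paths.

Lemma ghol_coord (Om : (K -> C) -> Prop) : ghol op Om coord.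
Proof. unfold coord. apply ghol_mult; [apply ghol_const|apply ghol_eval]. Qed.

Lemma marks_le_1 (j : K) : In j bd -> Cmod (a j) <= 1.
Proof. intros Hj. rewrite Habd; auto. lra. Qed.

Lemma conj_le : Cmod (Cconj (a k)) <= 1.
Proof. rewrite Cmod_conj, Hak. lra. Qed.

(** Left of the chord the right path formula is holomorphic. At or beyond the chord the other
    formula is, on a neighbourhood reaching into the rectangle, where [glue] identifies the two. *)
Lemma ghol_glued : ghol op (region op c0 a bd) (fun v => glued c0 (slice v) (coord v)).
Proof.
  rect_facts c0 Hc0.
  apply (ghol_local Hcpt). intros v Hv. assert (Hdv := coord_disc v (proj1 Hv)).
  destruct (Rlt_dec (fst (coord v)) (rect_right c0)) as [Hlt|Hge].
  (* Stopping at the midpoint keeps a positive distance from the chord, so that the kernels are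
     uniformly bounded on [Om]. *)
  - set (t := (rect_right c0 + fst (coord v)) / 2).
    set (Om := fun w => region op c0 a bd w /\ fst (Cconj (a k) * w k)%C < t).
    assert (HO : gopen op Om).
    { apply gopen_and; [apply gopen_region, marks_le_1|].
      apply (gopen_coord_open k (Cconj (a k)) (fun z => fst z < t)); [apply conj_le|apply open_fst_lt]. }
    exists Om, (fun v => inv_2pi_i * right_path c0 (cauchy_kernel c0 (slice v) (coord v)))%C.
    split; [exact HO|]. split; [split; [exact Hv|change (fst (coord v) < t); unfold t; lra]|]. split.
    + apply ghol_mult; [apply ghol_const|]. apply (ghol_right_path Om coord (rect_right c0 - t)); auto.
      * intros w Hw; apply Hw.
      * apply ghol_coord.
      * unfold t; lra.
      * intros w s [_ Hw] [Hs _]. pose proof (Cmod_ge_fst (s - coord w)) as G1. simpl in G1.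
        eapply Rle_trans; [|apply G1]. eapply Rle_trans; [|apply Rle_abs]. change (fst (coord w) < t) in Hw. change (rect_right c0 - t <= fst s - fst (coord w)). lra.
    + intros w [_ Hw]. unfold glued. destruct (Rlt_dec (fst (coord w)) (rect_right c0)) as [|n]; auto.
      exfalso. apply n. change (fst (coord w) < t) in Hw. unfold t in Hw. lra.
  - assert (Hge' : rect_right c0 <= fst (coord v)) by lra.
    destruct (right_inner c0 Hc0 (coord v) Hdv Hge') as [Hsnd _].
    set (t := (rect_left c0 + rect_right c0) / 2). set (y := (rect_height c0 + Rabs (snd (coord v))) / 2).
    set (Om := fun w => region op c0 a bd w /\ (t < fst (Cconj (a k) * w k)%C /\ Rabs (snd (Cconj (a k) * w k)%C) < y)).
    assert (HO : gopen op Om).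
    { apply gopen_and; [apply gopen_region, marks_le_1|]. apply gopen_and.
      - apply (gopen_coord_open k (Cconj (a k)) (fun z => t < fst z)); [apply conj_le|apply open_fst_gt].
      - apply (gopen_coord_open k (Cconj (a k)) (fun z => Rabs (snd z) < y)); [apply conj_le|apply open_snd_lt]. }
    exists Om, (fun v => weight c0 (coord v) * slice v (coord v) + inv_2pi_i * left_path c0 (cauchy_kernel c0 (slice v) (coord v)))%C.
    split; [exact HO|]. split.
    { split; [exact Hv|]. change (t < fst (coord v) /\ Rabs (snd (coord v)) < y). unfold t, y. lra. }
    split.
    + apply ghol_plus; [apply ghol_mult|apply ghol_mult; [apply ghol_const|]].
      * unfold weight. apply ghol_plus; [|apply ghol_const]. apply ghol_mult; apply ghol_minus; try apply ghol_const; apply ghol_coord.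
      * apply (ghol_comp_affine (region op c0 a (k :: bd)) Om G (fun v => subst_at k pi v (r * (a k * coord v))%C)
          (fun u => subst_at k pi u (r * (a k * coord u))%C)); auto.
        -- intros w z u. rewrite <- subst_at_line. f_equal. unfold coord, line. ring.
        -- intros u. apply (subst_at_cont k (k :: bd)); auto.
        -- intros w [Hw [Hw1 _]]. apply slice_region; auto; [left; apply coord_disc, Hw|]. change (t < fst (coord w)) in Hw1. unfold t in Hw1. lra.
      * apply (ghol_left_path Om coord (Rmin (t - rect_left c0) (rect_height c0 - y))); auto.
        -- intros w Hw; apply Hw.
        -- apply ghol_coord.
        -- unfold t, y. apply Rmin_pos; lra.
        -- intros w s [_ [Hw1 Hw2]] Hs. fold (coord w) in Hw1, Hw2.
           pose proof (Cmod_ge_fst (s - coord w)) as G1. pose proof (Cmod_ge_snd (s - coord w)) as G2.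
           replace (fst (s - coord w)%C) with (fst s - fst (coord w)) in G1 by reflexivity.
           replace (snd (s - coord w)%C) with (snd s - snd (coord w)) in G2 by reflexivity.
           apply Rabs_lt_between in Hw2.
           destruct Hs as [[_ [Hs|Hs]]|[Hs _]]; rewrite Hs in *.
           ++ eapply Rle_trans; [apply Rmin_r|]. eapply Rle_trans; [|apply G2].
              rewrite <- Rabs_Ropp. eapply Rle_trans; [|apply Rle_abs]. lra.
           ++ eapply Rle_trans; [apply Rmin_r|]. eapply Rle_trans; [|apply G2]. eapply Rle_trans; [|apply Rle_abs]. lra.
           ++ eapply Rle_trans; [apply Rmin_l|]. eapply Rle_trans; [|apply G1].
              rewrite <- Rabs_Ropp. eapply Rle_trans; [|apply Rle_abs]. lra.
    + intros w [Hw [Hw1 Hw2]]. fold (coord w) in Hw1, Hw2. unfold glued.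
      destruct (Rlt_dec (fst (coord w)) (rect_right c0)) as [Hl|]; auto.
      symmetry. apply (glue c0 Hc0 (slice w) M); [apply slice_holo; auto|unfold t in *; lra|].
      apply Rabs_lt_between. unfold y in *. lra.
Qed.

(** Subtracting the left integral with its pole at 1 and dividing by the weight at 1 normalises
    [glued] so that it differs from the slice by O(|coord v - 1|). *)
Definition splitting (v : K -> C) : C :=
  ((glued c0 (slice v) (coord v) - inv_2pi_i * left_path c0 (cauchy_kernel c0 (slice v) 1%C)) / weight c0 1%C)%C.

Definition split_bound : R := ((5 + 4 * distance_const c0) * M + 4 * (5 / (1 - rect_right c0) * M)) / (2 - 2 * rect_right c0).

Lemma weight_1_mod : weight c0 1%C <> 0%C /\ Cmod (weight c0 1%C) = 2 - 2 * rect_right c0.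
Proof.
  rect_facts c0 Hc0.
  rewrite weight_1 by auto. rewrite Cmod_R, Rabs_pos_eq by lra. split; auto. apply pair_neq_re. simpl. lra.
Qed.

Lemma ghol_splitting : ghol op (region op c0 a bd) splitting.
Proof.
  rect_facts c0 Hc0.
  unfold splitting. apply ghol_div; [|apply ghol_const|intros; apply weight_1_mod].
  apply ghol_minus; [apply ghol_glued|]. apply ghol_mult; [apply ghol_const|].
  apply (ghol_left_path (region op c0 a bd) (fun _ => 1%C) (1 - rect_right c0)); auto.
  - apply gopen_region, marks_le_1.
  - apply ghol_const.
  - lra.
  - intros v s _ Hs. apply left_dist_1; auto.
Qed.

Lemma splitting_bound : bounded_on (region op c0 a bd) splitting split_bound.
Proof.
  rect_facts c0 Hc0. destruct weight_1_mod as [N1 N2].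
  intros v Hv. unfold splitting, split_bound. rewrite Cmod_div, N2 by auto.
  apply Rmult_le_compat_r; [left; apply Rinv_0_lt_compat; lra|].
  unfold Cminus. eapply Rle_trans; [apply Cmod_triangle|]. rewrite Cmod_opp. apply Rplus_le_compat.
  - apply (glued_bound c0 Hc0 (slice v) M); auto; [apply slice_holo; auto|apply coord_disc, Hv].
  - apply inv_2pi_i_mult_bound. apply (left_path_1_bound c0 Hc0 (slice v) M); auto. apply slice_holo; auto.
Qed.

Lemma splitting_near (v : K -> C) : region op c0 a bd v -> rect_right c0 <= fst (coord v) ->
  Cmod (splitting v - slice v (coord v)) <= (4 * (distance_const c0 / (1 - rect_right c0) * M) + 4 * M) / (2 - 2 * rect_right c0) * Cmod (coord v - 1).
Proof.
  rect_facts c0 Hc0. destruct weight_1_mod as [N1 N2].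
  intros Hv Hx. assert (Hz := coord_disc v (proj1 Hv)).
  assert (H1 := glued_near_1 c0 Hc0 (slice v) M (slice_holo v Hv) (coord v) Hz Hx).
  assert (H2 := weight_near_1 c0 Hc0 (coord v) Hz).
  assert (H3 : Cmod (slice v (coord v)) <= M) by (apply slice_holo; auto; lra).
  replace (splitting v - slice v (coord v))%C with
    (((glued c0 (slice v) (coord v) - weight c0 (coord v) * slice v (coord v) - inv_2pi_i * left_path c0 (cauchy_kernel c0 (slice v) 1%C))
      + (weight c0 (coord v) - weight c0 1%C) * slice v (coord v)) / weight c0 1%C)%C by (unfold splitting; field; auto).
  rewrite Cmod_div, N2 by auto.
  replace ((4 * (distance_const c0 / (1 - rect_right c0) * M) + 4 * M) / (2 - 2 * rect_right c0) * Cmod (coord v - 1)) with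
    ((4 * (distance_const c0 / (1 - rect_right c0) * M) * Cmod (coord v - 1) + 4 * Cmod (coord v - 1) * M) / (2 - 2 * rect_right c0)) by (unfold Rdiv; ring).
  apply Rmult_le_compat_r; [left; apply Rinv_0_lt_compat; lra|].
  eapply Rle_trans; [apply Cmod_triangle|]. apply Rplus_le_compat; auto.
  rewrite Cmod_mult. apply Rmult_le_compat; try apply Cmod_ge_0; auto.
Qed.
End OneRetraction.

Context (Hhaus : hausdorff op) (Hdisp : dispersed op).

(** The splittings have a common bound, so their limit over the retractions is holomorphic, while
    the slices converge to [G]; the error estimate passes to the limit. *)
Lemma boundary_step : exists h A B, 0 <= A /\ ghol op (region op c0 a bd) h /\ bounded_on (region op c0 a bd) h B /\
  forall v, region op c0 a (k :: bd) v -> Cmod (h v - G v) <= A * Cmod (v k - a k).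
Proof.
  rect_facts c0 Hc0. assert (Hg := distance_const_nonneg c0 Hc0).
  destruct (retraction_ultrafilter Htop Hcpt Hhaus Hdisp (k :: bd)) as [U [HU HB]].
  assert (Hi1 : 0 < / (2 - 2 * rect_right c0)) by (apply Rinv_0_lt_compat; lra).
  assert (Hi2 : 0 < / (1 - rect_right c0)) by (apply Rinv_0_lt_compat; lra).
  assert (HSB : 0 <= split_bound).
  { unfold split_bound, Rdiv. apply Rmult_le_pos; [|lra]. apply Rplus_le_le_0_compat; repeat apply Rmult_le_pos; lra. }
  set (A1 := (4 * (distance_const c0 / (1 - rect_right c0) * M) + 4 * M) / (2 - 2 * rect_right c0)).
  assert (HA1 : 0 <= A1).
  { unfold A1, Rdiv. apply Rmult_le_pos; [|lra]. apply Rplus_le_le_0_compat; repeat apply Rmult_le_pos; lra. }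
  set (A2 := (split_bound + M) / (1 - rect_right c0)).
  assert (HA2 : 0 <= A2) by (unfold A2, Rdiv; apply Rmult_le_pos; lra).
  (* The tolerance 1 - c0 / rect_left forces the radius above c0 / rect_left, that is, the shrunken
     contour stays where Re > c0. *)
  assert (Hgood : U (fun i => admissible op (k :: bd) (fst i) /\ 0 < snd i < 1 /\ c0 < snd i * rect_left c0)).
  { apply (ultra_mp HU _ _ (HB (fun _ => RtoC 0) (1 - c0 / rect_left c0) (cont_const Htop (RtoC 0))
      ltac:(assert (c0 / rect_left c0 < 1); [apply Rmult_lt_reg_r with (rect_left c0); auto; unfold Rdiv; rewrite Rmult_assoc, Rinv_l; lra|lra]))).
    intros i [Hi [_ [Hs0 Hs]]]. split; auto. split; [lra|].
    assert (Hc : c0 / rect_left c0 < snd i) by lra. apply Rmult_lt_compat_r with (r := rect_left c0) in Hc; auto.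
    replace (c0 / rect_left c0 * rect_left c0) with c0 in Hc by (field; lra). exact Hc. }
  destruct (ghol_ulim Hcpt HU (region op c0 a bd) (fun i v => splitting (fst i) (snd i) v) split_bound) as [Hh1 [Hh2 Hh3]]; auto.
  { apply gopen_region, marks_le_1. }
  { apply (ultra_mp HU _ _ Hgood). intros i [Hi [Hs Hc]]. split; [apply ghol_splitting; auto|apply splitting_bound; auto]. }
  exists (fun v => ulim U (fun i => splitting (fst i) (snd i) v)), (A1 + A2), split_bound.
  split; [lra|]. split; auto. split; auto.
  intros v Hv.
  assert (Hvb : region op c0 a bd v).
  { destruct Hv as [H1 H2]. split; auto. intros j Hj. apply H2. right; auto. }
  assert (Hak' : forall j, In j (k :: bd) -> Cmod (a j) <= 1).
  { intros j [<-|Hj]; [lra|apply marks_le_1; auto]. }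
  assert (Hlim : is_ulim (U := U) (fun i => slice (fst i) (snd i) v (coord v)) (G v)).
  { apply (subst_at_limit Htop (region op c0 a (k :: bd)) G M k (k :: bd) U (fun i => (snd i * (a k * coord v))%C) v); auto.
    - apply gopen_region; auto.
    - apply Hv.
    - intros i e Hs0 Hs.
      replace (snd i * (a k * coord v) - v k)%C with (RtoC (snd i - 1) * v k)%C.
      + rewrite Cmod_mult, Cmod_R, <- Rabs_Ropp, Rabs_pos_eq by lra.
        destruct Hv as [[_ [q [Hq Hb]]] _]. specialize (Hb k). pose proof (Cmod_ge_0 (v k)). nra.
      + unfold coord. replace (snd i * (a k * (Cconj (a k) * v k)))%C with (snd i * ((Cconj (a k) * a k) * v k))%C by ring.
        rewrite (conj_unit (a k) Hak), RtoC_minus. ring. }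
  assert (Hdist := coord_dist v).
  pose proof (Cmod_ge_0 (v k - a k)) as Hp.
  destruct (Rle_dec (rect_right c0) (fst (coord v))) as [Hx|Hx].
  - apply Rle_trans with (A1 * Cmod (v k - a k)); [|nra].
    apply (is_ulim_le HU (fun i => splitting (fst i) (snd i) v - slice (fst i) (snd i) v (coord v))%C).
    2:{ apply (is_ulim_minus HU); auto. }
    apply (ultra_mp HU _ _ Hgood). intros i [Hi [Hs Hc]]. rewrite <- Hdist. apply splitting_near; auto.
  - apply Rle_trans with (A2 * Cmod (v k - a k)); [|nra].
    (* Left of the chord v k is at a fixed distance from a k, so the supremum bounds alone give the
       estimate. *)
    assert (Hfar : 1 - rect_right c0 <= Cmod (v k - a k)).
    { rewrite <- Hdist. pose proof (Cmod_ge_fst (coord v - 1)) as G1.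
      replace (fst (coord v - 1)%C) with (fst (coord v) - 1) in G1 by reflexivity.
      eapply Rle_trans; [|apply G1]. rewrite <- Rabs_Ropp. eapply Rle_trans; [|apply Rle_abs]. lra. }
    apply Rle_trans with (A2 * (1 - rect_right c0)).
    + unfold A2. replace ((split_bound + M) / (1 - rect_right c0) * (1 - rect_right c0)) with (split_bound + M) by (field; lra).
      unfold Cminus. eapply Rle_trans; [apply Cmod_triangle|]. rewrite Cmod_opp. apply Rplus_le_compat; [apply Hh2; auto|apply HM; auto].
    + apply Rmult_le_compat_l; auto.
Qed.
End Boundary.

(** * Fibres and cluster values *)

Definition sumdist {K : Type} (a : K -> C) (bd : list K) (v : K -> C) : R :=
  fold_right (fun j s => Cmod (v j - a j) + s) 0 bd.

Definition peak {K : Type} (a : K -> C) (bd : list K) (v : K -> C) : C :=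
  fold_right (fun j s => ((/ 2 + / 2 * (Cconj (a j) * v j)) * s)%C) 1%C bd.

Lemma Cmod_half : Cmod (/ 2)%C = / 2.
Proof. rewrite Cmod_inv by (apply pair_neq_re; simpl; lra). rewrite Cmod_R, Rabs_pos_eq; lra. Qed.

Lemma sqr_le (x y : R) : 0 <= y -> x * x <= y * y -> x <= y.
Proof. intros. nra. Qed.

Lemma Cmod_sqr (z : C) : Cmod z * Cmod z = fst z * fst z + snd z * snd z.
Proof. pose proof (Cmod2_alt z) as E. unfold Re, Im in E. simpl in E. lra. Qed.

(** In the unit disc |z - 1|^2 < 2 - 2 Re z, so a cut by a half-plane controls the distance to 1. *)
Lemma near_of_fst (z : C) (c e : R) : Cmod z < 1 -> c < fst z -> 0 < e -> 1 - e * e / 2 <= c -> Cmod (z - 1) < e.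
Proof.
  intros Hz Hc He Hce. apply Cmod_sqr_lt in Hz.
  pose proof (Cmod_sqr (z - 1)) as E. simpl in E. pose proof (Cmod_ge_0 (z - 1)). nra.
Qed.

Lemma half_factor_le (z : C) (c : R) : Cmod z < 1 -> fst z <= c -> c <= 1 -> -1 <= c -> Cmod (/ 2 + / 2 * z) <= sqrt ((1 + c) / 2).
Proof.
  intros Hz Hc Hc1 Hc2. apply Cmod_sqr_lt in Hz.
  replace (/ 2 + / 2 * z)%C with (/ 2 * (1 + z))%C by ring. rewrite Cmod_mult, Cmod_half.
  pose proof (Cmod_sqr (1 + z)) as E. simpl in E.
  assert (0 <= (1 + c) / 2) by lra.
  apply sqr_le; [apply sqrt_pos|]. rewrite sqrt_sqrt by auto. nra.
Qed.

Lemma half_factor_le_1 (z : C) : Cmod z < 1 -> Cmod (/ 2 + / 2 * z) <= 1.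
Proof.
  intros Hz. eapply Rle_trans; [apply Cmod_triangle|]. rewrite Cmod_mult, Cmod_half. lra.
Qed.

Lemma unit_coord_dist (b v : C) : Cmod b = 1 -> Cmod (Cconj b * v - 1) = Cmod (v - b).
Proof.
  intros Hb. replace (Cconj b * v - 1)%C with (Cconj b * (v - b))%C.
  - rewrite Cmod_mult, Cmod_conj, Hb. ring.
  - rewrite <- (conj_unit b Hb). ring.
Qed.

Section Final.
Context {K : Type} {op : (K -> Prop) -> Prop} (Htop : is_topology op) (Hcpt : compact_space op)
  (Hhaus : hausdorff op) (Hdisp : dispersed op).

(** Each step drops one constraint from the region, and the errors of the steps add up. *)
Lemma boundary_iterate (c0 : R) (a : K -> C) (bd : list K) : 0 <= c0 < 1 -> NoDup bd ->
  (forall j, In j bd -> Cmod (a j) = 1) ->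
  forall (G : (K -> C) -> C) (M : R), 0 <= M -> ghol op (region op c0 a bd) G -> bounded_on (region op c0 a bd) G M ->
  exists h A B, 0 <= A /\ ghol op (unit_ball op) h /\ bounded_on (unit_ball op) h B /\
    forall v, region op c0 a bd v -> Cmod (h v - G v) <= A * sumdist a bd v.
Proof.
  intros Hc0. induction bd as [|k bd IH]; intros Hnd Ha G M HM HG HB.
  - exists G, 0, M. split; [lra|].
    assert (E : forall v, unit_ball op v -> region op c0 a nil v) by (intros v Hv; split; auto; intros j []).
    split; [apply (ghol_sub_domain (region op c0 a nil)); auto|]. split; [intros v Hv; apply HB; auto|].
    intros v _. replace (G v - G v)%C with (RtoC 0) by ring. rewrite Cmod_0. lra.
  - inversion Hnd as [|? ? Hk Hnd']; subst.
    destruct (boundary_step Htop Hcpt c0 Hc0 a k bd Hk (Ha k (or_introl eq_refl)) (fun j Hj => Ha j (or_intror Hj)) G M HM HG HB Hhaus Hdisp)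
      as [h1 [A1 [B1 [HA1 [Hh1 [HB1 Hd1]]]]]].
    destruct (IH Hnd' (fun j Hj => Ha j (or_intror Hj)) h1 (Rmax 0 B1) (Rmax_l _ _) Hh1) as [h [A2 [B2 [HA2 [Hh [HB2 Hd2]]]]]].
    { intros v Hv. eapply Rle_trans; [apply HB1; auto|apply Rmax_r]. }
    exists h, (A1 + A2), B2. split; [lra|]. split; auto. split; auto.
    intros v Hv. simpl.
    assert (Hv' : region op c0 a bd v) by (destruct Hv as [V1 V2]; split; auto; intros j Hj; apply V2; right; auto).
    specialize (Hd1 v Hv). specialize (Hd2 v Hv').
    replace (h v - G v)%C with ((h v - h1 v) + (h1 v - G v))%C by ring.
    eapply Rle_trans; [apply Cmod_triangle|].
    assert (Hs : 0 <= sumdist a bd v).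
    { clear. induction bd as [|j bd IH]; simpl; [lra|]. pose proof (Cmod_ge_0 (v j - a j)). lra. }
    pose proof (Cmod_ge_0 (v k - a k)). nra.
Qed.

Context (k0 : K) (xss : Xstar op -> C) (Hxss : in_bidual_ball xss) (tau : (Bset op -> C) -> C) (Htau : in_fiber xss tau).

Definition hfun (F : (K -> C) -> C) : Prop := ghol op (unit_ball op) F /\ exists M, bounded_on (unit_ball op) F M.

Definition spec (F : (K -> C) -> C) : C := tau (restrict F).

Lemma hfun_Hinf (F : (K -> C) -> C) : hfun F -> in_Hinf (op := op) (restrict F).
Proof. intros [H [M HM]]. apply (Hinf_restrict Htop Hcpt k0 F M); auto. Qed.

Lemma hfun_const (c : C) : hfun (fun _ => c).
Proof. split; [apply ghol_const|]. exists (Cmod c). intros v _. lra. Qed.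

Lemma hfun_plus (F G : (K -> C) -> C) : hfun F -> hfun G -> hfun (fun v => F v + G v)%C.
Proof.
  intros [HF [M HM]] [HG [N HN]]. split; [apply ghol_plus; auto|]. exists (M + N). intros v Hv.
  eapply Rle_trans; [apply Cmod_triangle|]. specialize (HM v Hv). specialize (HN v Hv). lra.
Qed.

Lemma hfun_mult (F G : (K -> C) -> C) : hfun F -> hfun G -> hfun (fun v => F v * G v)%C.
Proof.
  intros [HF [M HM]] [HG [N HN]]. split; [apply ghol_mult; auto|]. exists (M * N). intros v Hv.
  rewrite Cmod_mult. apply Rmult_le_compat; try apply Cmod_ge_0; auto.
Qed.

Lemma hfun_eval (k : K) : hfun (fun v => v k).
Proof.
  split; [apply ghol_eval|]. exists 1. intros v [_ [r [Hr Hb]]]. specialize (Hb k). lra.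
Qed.

Lemma spec_plus (F G : (K -> C) -> C) : hfun F -> hfun G -> spec (fun v => F v + G v)%C = (spec F + spec G)%C.
Proof.
  intros HF HG. destruct Htau as [_ [H _]]. apply H; try apply hfun_Hinf; auto using hfun_plus. 
Qed.

Lemma spec_mult (F G : (K -> C) -> C) : hfun F -> hfun G -> spec (fun v => F v * G v)%C = (spec F * spec G)%C.
Proof.
  intros HF HG. destruct Htau as [_ [_ [_ [H _]]]]. apply H; try apply hfun_Hinf; auto using hfun_mult.
Qed.

(** [tau] is nonzero at some [f], and there tau f = tau 1 tau f can be divided by tau f. *)
Lemma spec_one : spec (fun _ => 1%C) = 1%C.
Proof.
  destruct Htau as [[f [Hf Hn]] [_ [_ [H _]]]].
  assert (E : tau f = Cmul (tau (restrict (fun _ => 1%C))) (tau f)).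
  { apply H; auto; [apply hfun_Hinf, hfun_const|]. intros b. symmetry. exact (Cmult_1_l (f b)). }
  change (tau f = (spec (fun _ => 1%C) * tau f)%C) in E.
  assert (Hn' : tau f <> 0%C) by exact Hn.
  transitivity (spec (fun _ => 1%C) * tau f / tau f)%C; [field; auto|]. rewrite <- E. field. auto.
Qed.

Lemma spec_const (c : C) : spec (fun _ => c) = c.
Proof.
  destruct Htau as [_ [_ [H _]]].
  assert (E : tau (restrict (fun _ => c)) = Cmul c (tau (restrict (fun _ => 1%C)))).
  { apply H; try apply hfun_Hinf; try apply hfun_const. intros b. symmetry. exact (Cmult_1_r c). }
  change (spec (fun _ => c) = (c * spec (fun _ => 1%C))%C) in E. rewrite E, spec_one. ring.
Qed.

Lemma spec_ext (F G : (K -> C) -> C) : (forall v, unit_ball op v -> F v = G v) -> spec F = spec G.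
Proof.
  intros H. unfold spec. f_equal. apply functional_extensionality. intros b. apply H, ball_elt.
Qed.

(** If the value exceeded the supremum, F - spec F would be bounded away from zero, hence invertible
    in the algebra, yet it is sent to 0. *)
Lemma spec_bound (F : (K -> C) -> C) (s : R) : ghol op (unit_ball op) F -> bounded_on (unit_ball op) F s -> Cmod (spec F) <= s.
Proof.
  intros HF Hs. apply Rnot_lt_le. intros Hlt. set (l := spec F) in *.
  assert (HFh : hfun F) by (split; eauto).
  assert (Hd : forall v, unit_ball op v -> Cmod l - s <= Cmod (F v + - l)).
  { intros v Hv. specialize (Hs v Hv).
    assert (Cmod l <= Cmod (F v + - l) + Cmod (F v)); [|lra].
    replace l with (- (F v + - l) + F v)%C at 1 by ring. eapply Rle_trans; [apply Cmod_triangle|]. rewrite Cmod_opp. lra. }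
  assert (HFl : hfun (fun v => F v + - l)%C) by (apply hfun_plus; auto; apply hfun_const).
  assert (HG : hfun (fun v => 1 / (F v + - l))%C).
  { split.
    - apply ghol_div; [apply ghol_const|apply HFl|]. intros v Hv. apply Cmod_gt_0. specialize (Hd v Hv). lra.
    - exists (/ (Cmod l - s)). intros v Hv. specialize (Hd v Hv).
      rewrite Cmod_div by (apply Cmod_gt_0; lra). rewrite Cmod_1. unfold Rdiv. rewrite Rmult_1_l. apply inv_le; lra. }
  assert (E : spec (fun v => (F v + - l) * (1 / (F v + - l)))%C = spec (fun _ => 1%C)).
  { apply spec_ext. intros v Hv. field. apply Cmod_gt_0. specialize (Hd v Hv). lra. }
  rewrite (spec_mult _ _ HFl HG), (spec_plus F (fun _ => (- l)%C)), spec_const, spec_one in E by (auto; apply hfun_const).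
  fold l in E. replace ((l + - l) * spec (fun v => 1 / (F v + - l)))%C with (RtoC 0) in E by ring.
  apply RtoC_inj in E. lra.
Qed.

Lemma evaluation_spec (k : K) : linearX (fun x : CK op => proj1_sig x k) /\ exists M, opnormle (fun x : CK op => proj1_sig x k) M.
Proof.
  split; [split; auto|]. exists 1. intros x Hx. apply Hx.
Qed.

Definition evaluation (k : K) : Xstar op := exist _ (fun x : CK op => proj1_sig x k) (evaluation_spec k).

(** The value of [xss] at the point mass at [k]: the number a k of the overview. *)
Definition val (k : K) : C := xss (evaluation k).

Lemma val_le_1 (k : K) : Cmod (val k) <= 1.
Proof. apply (proj2 (proj2 Hxss)). intros x Hx. apply Hx. Qed.

Lemma spec_eval (k : K) : spec (fun v => v k) = val k.
Proof. exact (proj2 (proj2 (proj2 (proj2 Htau))) (evaluation k)). Qed.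

Lemma Xstar_combination (phi psi : Xstar op) (c : C) : exists chi : Xstar op,
  (forall x, proj1_sig chi x = (proj1_sig phi x + c * proj1_sig psi x)%C) /\ xss chi = (xss phi + c * xss psi)%C.
Proof.
  (* The identities are proved over [C] and used up to conversion, because the goals are phrased
     with [Cadd] and [Cmul]. *)
  assert (R1 : forall x y z : C, (x * (y + z))%C = (x * y + x * z)%C) by (intros; ring).
  assert (R2 : forall x y z : C, (x * (y * z))%C = (y * (x * z))%C) by (intros; ring).
  assert (R3 : forall x y z u v : C, (x + y + z * (u + v))%C = (x + z * u + (y + z * v))%C) by (intros; ring).
  assert (R4 : forall x y z u : C, (x * y + z * (x * u))%C = (x * (y + z * u))%C) by (intros; ring).
  destruct phi as [p [[p1 p2] [Mp Hp]]] ; destruct psi as [q [[q1 q2] [Mq Hq]]].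
  assert (Hcq : linearX (fun x => (c * q x)%C) /\ exists M, opnormle (fun x => (c * q x)%C) M).
  { split; [split|exists (Cmod c * Mq)].
    - intros x y z Hz. change ((c * q z)%C = (c * q x + c * q y)%C). rewrite (q1 x y z Hz).
      exact (R1 _ _ _).
    - intros d x z Hz. change ((c * q z)%C = (d * (c * q x))%C). rewrite (q2 d x z Hz).
      exact (R2 _ _ _).
    - intros x Hx. change (Cmod (c * q x)%C <= Cmod c * Mq). rewrite Cmod_mult.
      apply Rmult_le_compat_l; [apply Cmod_ge_0|exact (Hq x Hx)]. }
  assert (Hs : linearX (fun x => (p x + c * q x)%C) /\ exists M, opnormle (fun x => (p x + c * q x)%C) M).
  { destruct Hcq as [[l1 l2] [Mc Hc]]. split; [split|exists (Mp + Mc)].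
    - intros x y z Hz. change ((p z + c * q z)%C = ((p x + c * q x) + (p y + c * q y))%C).
      rewrite (p1 x y z Hz), (q1 x y z Hz). exact (R3 _ _ _ _ _).
    - intros d x z Hz. change ((p z + c * q z)%C = (d * (p x + c * q x))%C).
      rewrite (p2 d x z Hz), (q2 d x z Hz). exact (R4 _ _ _ _).
    - intros x Hx. specialize (Hp x Hx). specialize (Hc x Hx). change (Cmod (p x + c * q x)%C <= Mp + Mc).
      eapply Rle_trans; [apply Cmod_triangle|]. apply Rplus_le_compat; auto. }
  set (P := fun L : CK op -> Cx => linearX L /\ exists M, opnormle L M).
  exists (exist P (fun x => (p x + c * q x)%C) Hs). split; [reflexivity|].
  destruct Hxss as [X1 [X2 _]].
  refine (eq_trans (X1 _ (exist P _ Hcq) (exist P _ Hs) _) (f_equal (Cadd _) (X2 c _ (exist P _ Hcq) _)));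
    intros x; reflexivity.
Qed.

Lemma Xstar_comb (l : list (C * K)) : exists chi : Xstar op,
  (forall x, proj1_sig chi x = comb l (proj1_sig x)) /\ xss chi = comb l val.
Proof.
  induction l as [|[c k] l [chi [H1 H2]]].
  (* The zero functional, obtained as an evaluation minus itself. *)
  - destruct (Xstar_combination (evaluation k0) (evaluation k0) (- (1))%C) as [chi [H1 H2]].
    assert (R0 : forall z : C, (z + - (1) * z)%C = 0%C) by (intros; ring).
    exists chi. split; [intros x; rewrite H1; exact (R0 _)|rewrite H2; exact (R0 _)].
  - destruct (Xstar_combination chi (evaluation k) c) as [chi' [H1' H2']].
    exists chi'. split.
    + intros x. rewrite H1', H1. exact (Cplus_comm _ _).
    + rewrite H2', H2. exact (Cplus_comm _ _).
Qed.

(** The second bound follows from the first: [xss] has norm at most 1 and the functional phi - comb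
    l has norm at most e. *)
Lemma weak_star_approx (phi : Xstar op) (e : R) : 0 < e -> exists l : list (C * K),
  (forall x : CK op, normle x 1 -> Cmod (proj1_sig phi x - comb l (proj1_sig x)) <= e) /\ Cmod (xss phi - comb l val) <= e.
Proof.
  intros He. destruct (proj2_sig phi) as [Hl [M HM]].
  destruct (functional_approx Htop Hcpt Hhaus Hdisp (proj1_sig phi) M Hl HM e He) as [l H].
  exists l. split; auto.
  destruct (Xstar_comb l) as [chi [C1 C2]]. destruct (Xstar_combination phi chi (- (1))%C) as [psi [P1 P2]].
  replace (xss phi - comb l val)%C with (xss psi) by (rewrite P2, C2; ring).
  apply (proj2 (proj2 Hxss)). intros x Hx. rewrite P1, C1.
  change (Cmod (proj1_sig phi x + - (1) * comb l (proj1_sig x))%C <= e).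
  replace (proj1_sig phi x + - (1) * comb l (proj1_sig x))%C with (proj1_sig phi x - comb l (proj1_sig x))%C by ring. auto.
Qed.

Definition near (e : R) (F : list K) (v : K -> C) : Prop := forall k, In k F -> Cmod (v k - val k) < e.

Lemma comb_close (l : list (C * K)) (e : R) : 0 < e -> exists d, 0 < d /\
  forall v : K -> C, near d (map snd l) v -> Cmod (comb l v - comb l val) <= e.
Proof.
  revert e. induction l as [|[c k] l IH]; intros e He.
  - exists 1. split; [lra|]. intros v _. simpl. replace (0 - 0)%C with (RtoC 0) by ring. rewrite Cmod_0. lra.
  - destruct (IH (e / 2) ltac:(lra)) as [d [Hd H]]. pose proof (Cmod_ge_0 c).
    exists (Rmin d (e / (2 * (Cmod c + 1)))). split; [apply Rmin_pos; auto; apply Rdiv_lt_0_compat; lra|].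
    intros v Hv. simpl.
    pose proof (Rmin_l d (e / (2 * (Cmod c + 1)))) as K1. pose proof (Rmin_r d (e / (2 * (Cmod c + 1)))) as K2.
    replace (c * v k + comb l v - (c * val k + comb l val))%C with (c * (v k - val k) + (comb l v - comb l val))%C by ring.
    eapply Rle_trans; [apply Cmod_triangle|]. rewrite Cmod_mult.
    assert (H2 : Cmod (comb l v - comb l val) <= e / 2).
    { apply H. intros j Hj. eapply Rlt_le_trans; [apply Hv; right; auto|auto]. }
    assert (H3 : Cmod (v k - val k) < Rmin d (e / (2 * (Cmod c + 1)))) by (apply Hv; left; auto).
    assert (H4 : Cmod c * Cmod (v k - val k) <= e / 2); [|lra].
    apply Rle_trans with ((Cmod c + 1) * (e / (2 * (Cmod c + 1)))); [|right; field; lra].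
    apply Rmult_le_compat; try apply Cmod_ge_0; lra.
Qed.

(** Each functional is replaced by a finite combination of evaluations, at the same cost on the ball
    and at [xss]; only the coordinates in these combinations remain. *)
Lemma weak_star_neighbourhood (Phi : list (Xstar op)) (e : R) : 0 < e -> exists F d, 0 < d /\
  forall b : Bset op, near d F (proj1_sig (proj1_sig b)) ->
    forall phi, In phi Phi -> Cmod (proj1_sig phi (proj1_sig b) - xss phi) < e.
Proof.
  intros He. induction Phi as [|phi Phi IH].
  - exists nil, 1. split; [lra|]. intros b _ phi [].
  - destruct IH as [F [d [Hd H]]].
    destruct (weak_star_approx phi (e / 4) ltac:(lra)) as [l [L1 L2]].
    destruct (comb_close l (e / 4) ltac:(lra)) as [d' [Hd' H']].
    exists (map snd l ++ F), (Rmin d d'). split; [apply Rmin_pos; auto|].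
    pose proof (Rmin_l d d'). pose proof (Rmin_r d d').
    intros b Hb phi' [<-|Hin].
    + assert (A1 : Cmod (proj1_sig phi (proj1_sig b) - comb l (proj1_sig (proj1_sig b))) <= e / 4).
      { apply L1. destruct (proj2_sig b) as [r [Hr Hn]]. intros k. eapply Rle_trans; [apply Hn|lra]. }
      assert (A2 : Cmod (comb l (proj1_sig (proj1_sig b)) - comb l val) <= e / 4).
      { apply H'. intros k Hk. eapply Rlt_le_trans; [apply Hb, in_or_app; auto|auto]. }
      replace (proj1_sig phi (proj1_sig b) - xss phi)%C with
        ((proj1_sig phi (proj1_sig b) - comb l (proj1_sig (proj1_sig b))) + (comb l (proj1_sig (proj1_sig b)) - comb l val)
          + - (xss phi - comb l val))%C by ring.
      eapply Rle_lt_trans; [apply Cmod_triangle|]. rewrite Cmod_opp.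
      eapply Rle_lt_trans; [apply Rplus_le_compat_r, Cmod_triangle|]. lra.
    + apply H; auto. intros k Hk. eapply Rlt_le_trans; [apply Hb, in_or_app; auto|auto].
Qed.

Lemma hfun_pow (F : (K -> C) -> C) (n : nat) : hfun F -> hfun (fun v => (F v ^ n)%C) /\ spec (fun v => (F v ^ n)%C) = (spec F ^ n)%C.
Proof.
  intros HF. induction n as [|n [IH1 IH2]].
  - split; [apply (hfun_const 1%C)|apply spec_one].
  - split; [exact (hfun_mult F _ HF IH1)|].
    transitivity (spec (fun v => F v * (F v ^ n))%C); [reflexivity|]. rewrite spec_mult, IH2 by auto. reflexivity.
Qed.

Lemma peak_spec (bd : list K) : (forall j, In j bd -> Cmod (val j) = 1) -> hfun (peak val bd) /\ spec (peak val bd) = 1%C.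
Proof.
  induction bd as [|j bd IH]; intros Ha.
  - split; [apply (hfun_const 1%C)|apply spec_one].
  - destruct IH as [H1 H2]; [intros; apply Ha; right; auto|].
    assert (Hm : hfun (fun v => Cconj (val j) * v j)%C) by (apply hfun_mult; [apply hfun_const|apply hfun_eval]).
    assert (Hm2 : hfun (fun v => / 2 * (Cconj (val j) * v j))%C) by (apply hfun_mult; auto; apply hfun_const).
    assert (Hl : hfun (fun v => / 2 + / 2 * (Cconj (val j) * v j))%C) by (apply hfun_plus; auto; apply hfun_const).
    split; [exact (hfun_mult _ _ Hl H1)|].
    transitivity (spec (fun v => (/ 2 + / 2 * (Cconj (val j) * v j)) * peak val bd v)%C); [reflexivity|].
    rewrite spec_mult, H2 by auto.
    rewrite (spec_plus (fun _ => (/ 2)%C) (fun v => / 2 * (Cconj (val j) * v j))%C) by (auto; apply hfun_const).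
    rewrite (spec_mult (fun _ => (/ 2)%C) (fun v => Cconj (val j) * v j)%C) by (auto; apply hfun_const).
    rewrite (spec_mult (fun _ => Cconj (val j)) (fun v => v j)) by (apply hfun_const || apply hfun_eval).
    rewrite !spec_const, spec_eval, (conj_unit (val j)) by (apply Ha; left; auto).
    field.
Qed.

Lemma peak_le_1 (bd : list K) (v : K -> C) : (forall j, In j bd -> Cmod (Cconj (val j) * v j) < 1) -> Cmod (peak val bd v) <= 1.
Proof.
  induction bd as [|j bd IH]; intros H; simpl; [rewrite Cmod_1; lra|].
  rewrite Cmod_mult. assert (H1 := half_factor_le_1 _ (H j (or_introl eq_refl))).
  assert (H2 := IH (fun i Hi => H i (or_intror Hi))).
  pose proof (Cmod_ge_0 (peak val bd v)). unfold peak in *. pose proof (Cmod_ge_0 (/ 2 + / 2 * (Cconj (val j) * v j))). nra.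
Qed.

Lemma peak_le (bd : list K) (v : K -> C) (c : R) (j : K) : 0 <= c <= 1 -> In j bd ->
  (forall j, In j bd -> Cmod (Cconj (val j) * v j) < 1) -> fst (Cconj (val j) * v j)%C <= c ->
  Cmod (peak val bd v) <= sqrt ((1 + c) / 2).
Proof.
  intros Hc. induction bd as [|i bd IH]; intros Hj H Hf; [destruct Hj|].
  simpl. rewrite Cmod_mult.
  assert (H1 := half_factor_le_1 _ (H i (or_introl eq_refl))).
  assert (H2 := peak_le_1 bd v (fun i Hi => H i (or_intror Hi))). unfold peak in H2.
  pose proof (Cmod_ge_0 (/ 2 + / 2 * (Cconj (val i) * v i))) as P1. pose proof (Cmod_ge_0 (peak val bd v)) as P2. unfold peak in P2.
  destruct Hj as [->|Hj].
  - assert (H3 : Cmod (/ 2 + / 2 * (Cconj (val j) * v j)) <= sqrt ((1 + c) / 2)).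
    { apply half_factor_le; auto; try lra. apply H. left; auto. }
    rewrite <- (Rmult_1_r (sqrt _)). apply Rmult_le_compat; auto; apply Cmod_ge_0.
  - assert (H3 := IH Hj (fun i Hi => H i (or_intror Hi)) Hf).
    rewrite <- (Rmult_1_l (sqrt _)). apply Rmult_le_compat; auto; apply Cmod_ge_0.
Qed.

Lemma sumdist_le (bd : list K) (v : K -> C) (e : R) : near e bd v -> sumdist val bd v <= INR (length bd) * e.
Proof.
  induction bd as [|j bd IH]; intros H.
  - simpl. lra.
  - change (sumdist val (j :: bd) v) with (Cmod (v j - val j) + sumdist val bd v).
    change (length (j :: bd)) with (S (length bd)). rewrite S_INR.
    assert (H1 := H j (or_introl eq_refl)). assert (H2 := IH (fun i Hi => H i (or_intror Hi))). lra.
Qed.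

(* [1 - f h] is small near the fibre and [peak ^ N] is small away from it, yet the spectrum sees both as 1. *)
Lemma boundary_contradiction (bd : list K) (f : (K -> C) -> C) (e d : R) : 0 < e -> 0 < d -> NoDup bd ->
  (forall j, In j bd -> Cmod (val j) = 1) -> hfun f -> spec f = 0%C ->
  (forall v, unit_ball op v -> near d bd v -> e <= Cmod (f v)) -> False.
Proof.
  intros He Hd Hnd Ha Hf Hf0 Hlow.
  (* By [near_of_fst] the region with threshold [c0] lies in the d-neighbourhood where [f] is
     bounded below. *)
  set (c0 := Rmax 0 (1 - d * d / 2)).
  assert (Hc0 : 0 <= c0 < 1) by (split; [apply Rmax_l|apply Rmax_lub_lt; nra]).
  assert (Hc0d : 1 - d * d / 2 <= c0) by apply Rmax_r.
  assert (Hco : forall v, unit_ball op v -> forall j, In j bd -> Cmod (Cconj (val j) * v j) < 1).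
  { intros v [_ [r [Hr Hb]]] j Hj. rewrite Cmod_mult, Cmod_conj, Ha, Rmult_1_l by auto. eapply Rle_lt_trans; [apply Hb|auto]. }
  assert (Hnear : forall c t v, 0 < t -> 1 - t * t / 2 <= c -> region op c val bd v -> near t bd v).
  { intros c t v Ht Hct [Hv Hj] j Hjb. rewrite <- unit_coord_dist by auto. apply (near_of_fst _ c); auto. }
  assert (HlowR : forall v, region op c0 val bd v -> e <= Cmod (f v)).
  { intros v Hv. apply Hlow; [apply Hv|apply (Hnear c0); auto]. }
  destruct (boundary_iterate c0 val bd Hc0 Hnd Ha (fun v => 1 / f v)%C (/ e)) as [h [A [B [HA [Hh [HB Hhf]]]]]].
  { left. apply Rinv_0_lt_compat; auto. }
  { apply ghol_div; [apply ghol_const|apply (ghol_sub_domain (unit_ball op)); [intros v Hv; apply Hv|apply Hf]|].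
    intros v Hv. apply Cmod_gt_0. specialize (HlowR v Hv). lra. }
  { intros v Hv. specialize (HlowR v Hv). rewrite Cmod_div by (apply Cmod_gt_0; lra).
    rewrite Cmod_1. unfold Rdiv. rewrite Rmult_1_l. apply inv_le; auto. }
  assert (Hhh : hfun h) by (split; eauto).
  set (q := fun v => (1 + (- (1)) * (f v * h v))%C).
  assert (Hfh : hfun (fun v => f v * h v)%C) by (apply hfun_mult; auto).
  assert (Hm : hfun (fun v => (- (1)) * (f v * h v))%C) by (apply hfun_mult; auto; apply hfun_const).
  assert (Hq : hfun q) by (apply hfun_plus; auto; apply hfun_const).
  assert (Eq : spec q = 1%C).
  { unfold q. rewrite (spec_plus (fun _ => 1%C)) by (auto; apply hfun_const).
    rewrite (spec_mult (fun _ => (- (1))%C)) by (auto; apply hfun_const).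
    rewrite (spec_mult f h), Hf0, spec_one by auto. ring. }
  destruct (proj2 Hf) as [M0 HM0]. destruct (proj2 Hq) as [Q0 HQ0].
  set (M := Rmax 0 M0). set (Q := Rmax 0 Q0).
  assert (HM : 0 <= M) by apply Rmax_l. assert (HQ : 0 <= Q) by apply Rmax_l.
  assert (HMf : bounded_on (unit_ball op) f M) by (intros v Hv; eapply Rle_trans; [apply HM0; auto|apply Rmax_r]).
  assert (HQq : bounded_on (unit_ball op) q Q) by (intros v Hv; eapply Rle_trans; [apply HQ0; auto|apply Rmax_r]).
  set (n := INR (length bd)). assert (Hn : 0 <= n) by apply pos_INR.
  assert (HMA : 0 <= M * A * n) by (repeat apply Rmult_le_pos; auto).
  (* If the n marked coordinates are within t of their values, then [h] differs from 1/f by at most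
     A n t, so |1 - f h| is at most 1/2. *)
  set (t := / (2 * (M * A * n + 1))).
  assert (Ht : 0 < t) by (apply Rinv_0_lt_compat; lra).
  assert (Htn : M * A * n * t <= / 2).
  { apply Rle_trans with ((M * A * n + 1) * t); [nra|]. unfold t. right. field. lra. }
  (* Above the threshold [c2] all marked coordinates are within t of their values; otherwise some
     factor of the peak function is at most [rho], which is less than 1. *)
  set (c2 := Rmax c0 (1 - t * t / 2)).
  assert (Hc2 : c0 <= c2 /\ 1 - t * t / 2 <= c2 /\ c2 < 1).
  { split; [apply Rmax_l|]. split; [apply Rmax_r|]. apply Rmax_lub_lt; nra. }
  set (rho := sqrt ((1 + c2) / 2)).
  assert (Hrho : 0 <= rho < 1).
  { split; [apply sqrt_pos|]. unfold rho. apply Rlt_le_trans with (sqrt 1); [apply sqrt_lt_1; lra|rewrite sqrt_1; lra]. }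
  (* [N] is large enough for rho^N Q to be at most 1/2, where Q bounds q. *)
  destruct (pow_lt_1_zero rho ltac:(rewrite Rabs_pos_eq; lra) (/ (2 * (Q + 1))) ltac:(apply Rinv_0_lt_compat; lra)) as [N HN].
  specialize (HN N (le_n N)). rewrite Rabs_pos_eq in HN by (apply pow_le; lra).
  destruct (peak_spec bd Ha) as [Hp Ep].
  destruct (hfun_pow (peak val bd) N Hp) as [HpN EpN].
  assert (Hbound : bounded_on (unit_ball op) (fun v => peak val bd v ^ N * q v)%C (/ 2)).
  { intros v Hv. rewrite Cmod_mult, Cmod_pow.
    destruct (classic (region op c2 val bd v)) as [Hr|Hr].
    - assert (Hr0 : region op c0 val bd v).
      { destruct Hr as [R1 R2]. split; auto. intros j Hj. specialize (R2 j Hj). lra. }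
      assert (H1 : Cmod (peak val bd v) ^ N <= 1).
      { rewrite <- (pow1 N). apply pow_incr. split; [apply Cmod_ge_0|]. apply peak_le_1. apply Hco; auto. }
      assert (H2 : Cmod (q v) <= / 2).
      { assert (Hfv : f v <> 0%C) by (apply Cmod_gt_0; specialize (HlowR v Hr0); lra).
        replace (q v) with (- (f v * (h v - 1 / f v)))%C by (unfold q; field; auto).
        rewrite Cmod_opp, Cmod_mult. eapply Rle_trans; [|apply Htn].
        replace (M * A * n * t) with (M * (A * (n * t))) by ring.
        apply Rmult_le_compat; try apply Cmod_ge_0; [apply HMf; auto|].
        eapply Rle_trans; [apply Hhf; auto|]. apply Rmult_le_compat_l; auto. apply sumdist_le. apply (Hnear c2); auto; apply Hc2. }
      rewrite <- (Rmult_1_l (/ 2)). apply Rmult_le_compat; auto; [apply pow_le|]; apply Cmod_ge_0.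
    - assert (Hex : exists j, In j bd /\ fst (Cconj (val j) * v j)%C <= c2).
      { apply NNPP. intros Hne. apply Hr. split; auto. intros j Hj. apply Rnot_le_lt. intros Hle. apply Hne. eauto. }
      destruct Hex as [j [Hj Hle]].
      assert (H1 : Cmod (peak val bd v) ^ N <= rho ^ N).
      { apply pow_incr. split; [apply Cmod_ge_0|]. apply (peak_le bd v c2 j); auto; lra. }
      apply Rle_trans with (/ (2 * (Q + 1)) * (Q + 1)).
      + apply Rmult_le_compat; [apply pow_le, Cmod_ge_0|apply Cmod_ge_0|lra|]. specialize (HQq v Hv). lra.
      + right. field. lra. }
  assert (HB2 := spec_bound (fun v => peak val bd v ^ N * q v)%C (/ 2) (proj1 (hfun_mult _ _ HpN Hq)) Hbound).
  rewrite (spec_mult _ _ HpN Hq), EpN, Ep, Eq in HB2.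
  rewrite Cmod_mult, Cmod_pow, Cmod_1, pow1 in HB2. lra.
Qed.

(** Induction on the coordinates still to be treated: those of modulus less than one are removed by
    [interior_step], those of modulus one are postponed to [bd]. Absence of repetitions ensures that
    removing [k] leaves the other constraints untouched. *)
Lemma spectrum_contradiction (F : list K) : forall (bd : list K) (f : (K -> C) -> C) (e d : R), 0 < e -> 0 < d -> NoDup (F ++ bd) ->
  (forall j, In j bd -> Cmod (val j) = 1) -> hfun f -> spec f = 0%C ->
  (forall v, unit_ball op v -> near d (F ++ bd) v -> e <= Cmod (f v)) -> False.
Proof.
  induction F as [|k F IH]; intros bd f e d He Hd Hnd Ha Hf Hf0 Hlow.
  - exact (boundary_contradiction bd f e d He Hd Hnd Ha Hf Hf0 Hlow).
  - destruct (Rlt_dec (Cmod (val k)) 1) as [Hlt|Hge].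
    + destruct (proj2 Hf) as [M0 HM0].
      assert (HM : bounded_on (unit_ball op) f (Rmax 0 M0)) by (intros v Hv; eapply Rle_trans; [apply HM0; auto|apply Rmax_r]).
      destruct (interior_step Htop Hcpt Hhaus Hdisp f (Rmax 0 M0) k ((k :: F) ++ bd) (val k) (proj1 Hf) HM (Rmax_l _ _) (or_introl eq_refl) Hlt)
        as [f0 [g [M' [H1 [H2 [H3 [H4 [H5 H6]]]]]]]].
      simpl in Hnd. inversion Hnd as [|? ? Hk Hnd']; subst.
      apply (IH bd f0 e d); auto; [split; eauto| |].
      (* The factor v k - val k is sent to 0, so [f] and [f0] have the same image. *)
      * assert (Hfh0 : hfun f0) by (split; eauto). assert (Hg : hfun g) by (split; eauto).
        assert (E : spec f = spec (fun v => f0 v + (v k + - val k) * g v)%C).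
        { apply spec_ext. intros v Hv. rewrite (H5 v Hv). ring. }
        assert (Hl : hfun (fun v => v k + - val k)%C) by (apply hfun_plus; [apply hfun_eval|apply hfun_const]).
        rewrite (spec_plus f0 (fun v => (v k + - val k) * g v)%C) in E by (auto; apply hfun_mult; auto).
        rewrite (spec_mult (fun v => v k + - val k)%C g) in E by auto.
        rewrite (spec_plus (fun v => v k) (fun _ => (- val k)%C)), spec_eval, spec_const in E by (apply hfun_eval || apply hfun_const).
        rewrite Hf0 in E. replace (spec f0 + (val k + - val k) * spec g)%C with (spec f0) in E by ring. auto.
      * intros v Hv Hnv. apply H6; auto. intros w Hw Hwk Hwm. apply Hlow; auto.
        intros j [<-|Hj].
        -- rewrite Hwk. replace (val k - val k)%C with (RtoC 0) by ring. rewrite Cmod_0. auto.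
        -- rewrite Hwm; [apply Hnv; auto|right; auto|]. intros ->. contradiction.
    + apply (IH (k :: bd) f e d); auto.
      * apply (Permutation_NoDup (l := (k :: F) ++ bd)); auto. simpl. apply Permutation_middle.
      * intros j [<-|Hj]; auto. pose proof (val_le_1 k). lra.
      * intros v Hv Hnv. apply Hlow; auto. intros j Hj. apply Hnv.
        apply (Permutation_in (l := (k :: F) ++ bd)); auto. simpl. apply Permutation_middle.
Qed.

(** If no such [b] existed, f - tau f would be bounded below on a neighbourhood given by finitely
    many coordinates, although [tau] sends it to 0. *)
Lemma fiber_approx (f : Bset op -> C) (Phi : list (Xstar op)) (e : R) : in_Hinf f -> 0 < e ->
  exists b : Bset op, (forall phi, In phi Phi -> Cmod (proj1_sig phi (proj1_sig b) - xss phi) < e) /\ Cmod (f b - tau f) < e.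
Proof.
  intros Hf He. apply NNPP. intros Hn.
  destruct (weak_star_neighbourhood Phi e He) as [F [d [Hd H]]].
  destruct (Hinf_extend Htop Hcpt f Hf) as [Hg HM].
  assert (Hfe : hfun (extend f)) by (split; auto).
  assert (Efe : spec (extend f) = tau f) by (unfold spec; rewrite restrict_extend; auto).
  set (F' := nodup (fun x y => excluded_middle_informative (x = y)) F).
  apply (spectrum_contradiction F' nil (fun v => extend f v + - tau f)%C e d); auto.
  - rewrite app_nil_r. apply NoDup_nodup.
  - intros j [].
  - apply hfun_plus; auto. apply hfun_const.
  - rewrite spec_plus, spec_const, Efe by (auto; apply hfun_const). ring.
  - intros v Hv Hnv. apply Rnot_lt_le. intros Hlt. apply Hn.
    destruct (elt_of_ball v Hv) as [b Hb]. exists b. split.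
    + apply H. rewrite Hb. intros k Hk. apply Hnv. rewrite app_nil_r. apply nodup_In; auto.
    + rewrite <- Hb, extend_elt in Hlt. exact Hlt.
Qed.
End Final.

(** The character is the limit of evaluations at the net, along an ultrafilter containing its tails.
    Boundedness makes every such limit exist, and limits respect sums and products. *)
Lemma cluster_value_in_fiber {K : Type} {op : (K -> Prop) -> Prop} (Htop : is_topology op) (Hcpt : compact_space op) (k0 : K)
  (xss : Xstar op -> C) (f : Bset op -> C) (lam : C) : in_Hinf f -> cluster_value f xss lam ->
  exists tau : (Bset op -> C) -> C, in_fiber xss tau /\ tau f = lam.
Proof.
  intros Hf [D [le [net [[[d0 _] [Hrefl [Htrans Hdir]]] [Hphi Hlam]]]]].
  destruct (ultrafilter_extends (fun A : D -> Prop => exists d, A = (fun d' => le d d'))) as [U [HU HB]].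
  { exists (fun d' => le d0 d'), d0. reflexivity. }
  { intros A [d ->]. exists d. apply Hrefl. }
  { intros A A' [d ->] [d' ->]. destruct (Hdir d d') as [c [H1 H2]]. exists (fun x => le c x).
    split; [eexists; reflexivity|]. intros i Hi. split; [apply (Htrans d c)|apply (Htrans d' c)]; auto. }
  assert (Hconv : forall (u : D -> C) l, net_conv le u l -> is_ulim (U := U) u l).
  { intros u l Hu e He. destruct (Hu e He) as [d Hd]. apply (ultra_mp HU (fun d' => le d d')); auto.
    apply HB. eexists; reflexivity. }
  assert (Hlim : forall g : Bset op -> C, in_Hinf g -> is_ulim (U := U) (fun d => g (net d)) (ulim U (fun d => g (net d)))).
  { intros g [_ [M HM]]. apply (ulim_spec HU _ M). apply (ultra_all HU). intros d. apply HM. }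
  exists (fun g => ulim U (fun d => g (net d))). split; [|apply (ulim_eq HU), Hconv, Hlam].
  split; [|split; [|split; [|split]]].
  - exists (fun _ => RtoC 1). split.
    + apply (Hinf_restrict Htop Hcpt k0 (fun _ => RtoC 1) 1); [apply ghol_const|]. intros v _. rewrite Cmod_1. lra.
    + rewrite (ulim_eq HU _ (RtoC 1)) by apply (is_ulim_const HU). intros E. injection E. lra.
  - intros g1 g2 g Hg1 Hg2 Hg E. apply (ulim_eq HU).
    apply (is_ulim_ext HU (fun d => g1 (net d) + g2 (net d))%C); [apply (ultra_all HU); intros d; symmetry; apply E|].
    apply (is_ulim_plus HU); apply Hlim; auto.
  - intros c g1 g Hg1 Hg E. apply (ulim_eq HU).
    apply (is_ulim_ext HU (fun d => c * g1 (net d))%C); [apply (ultra_all HU); intros d; symmetry; apply E|].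
    apply (is_ulim_mult HU); [apply (is_ulim_const HU)|apply Hlim; auto].
  - intros g1 g2 g Hg1 Hg2 Hg E. apply (ulim_eq HU).
    apply (is_ulim_ext HU (fun d => g1 (net d) * g2 (net d))%C); [apply (ultra_all HU); intros d; symmetry; apply E|].
    apply (is_ulim_mult HU); apply Hlim; auto.
  - intros phi. apply (ulim_eq HU), Hconv, Hphi.
Qed.

Theorem theorem3p1 :
  forall (K : Type) (op : (K -> Prop) -> Prop),
    is_topology op -> compact_space op -> hausdorff op -> dispersed op ->
    forall (xss : Xstar op -> Cx), in_bidual_ball xss ->
    forall (f : Bset op -> Cx), in_Hinf f ->
    forall lam : Cx,
      cluster_value f xss lam <->
      exists tau : (Bset op -> Cx) -> Cx, in_fiber xss tau /\ tau f = lam.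
Proof.
  intros K op Htop Hcpt Hhaus Hdisp xss Hxss f Hf lam.
  destruct (Hinf_inhabited Htop f Hf) as [k0 _].
  split; [exact (cluster_value_in_fiber Htop Hcpt k0 xss f lam Hf)|].
  intros [tau [Htau <-]].
  assert (Hex : forall p : list (Xstar op) * {e : R | 0 < e}, exists b : Bset op,
    (forall phi, In phi (fst p) -> Cmod (proj1_sig phi (proj1_sig b) - xss phi) < proj1_sig (snd p)) /\
    Cmod (f b - tau f) < proj1_sig (snd p)).
  { intros [Phi [e He]]. apply (fiber_approx Htop Hcpt Hhaus Hdisp k0 xss Hxss tau Htau f Phi e Hf He). }
  (* An index is a finite set of functionals with a tolerance, that is, a basic weak-star
     neighbourhood; the net picks the point given by [fiber_approx]. *)
  exists (list (Xstar op) * {e : R | 0 < e})%type,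
    (fun p p' => incl (fst p) (fst p') /\ proj1_sig (snd p') <= proj1_sig (snd p)),
    (fun p => proj1_sig (constructive_indefinite_description _ (Hex p))).
  split; [split; [|split; [|split]]|split].
  - exists (nil, exist _ 1 Rlt_0_1). exact I.
  - intros p. split; [apply incl_refl|lra].
  - intros p q r [H1 H2] [H3 H4]. split; [eapply incl_tran; eauto|lra].
  - intros [l [e He]] [l' [e' He']]. exists (l ++ l', exist _ (Rmin e e') (Rmin_pos e e' He He')). simpl.
    repeat split; [apply incl_appl, incl_refl|apply Rmin_l|apply incl_appr, incl_refl|apply Rmin_r].
  - intros phi e He. exists (phi :: nil, exist _ e He). intros p [H1 H2].
    eapply Rlt_le_trans; [|apply H2].
    apply (proj1 (proj2_sig (constructive_indefinite_description _ (Hex p)))). apply H1. left; auto.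
  - intros e He. exists (nil, exist _ e He). intros p [H1 H2].
    eapply Rlt_le_trans; [|apply H2].
    apply (proj2 (proj2_sig (constructive_indefinite_description _ (Hex p)))).
Qed.
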